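(* There exist constants $0<c\le C<\infty$ such that for every $f\in A^2(D)$, $$c\,S(f)\le \int_D |f(z)|^2\,dA(z)\le C\,S(f),$$ where $$S(f)=\sum_{n=0}^{\infty}\frac{2^n}{(2n+1)!}\int_0^{1/2}x^{2n+1}\Big(|f^{(n)}(x)|^2+|f^{(n)}(1-x)|^2+\big|f^{(n)}\big(\tfrac12+i(\tfrac12-x)\big)\big|^2+\big|f^{(n)}\big(\tfrac12+i(x-\tfrac12)\big)\big|^2\Big)dx.$$ Moreover, if $f$ is a complex-valued function which is $\mathcal{C}^\infty$ on $(0,1)\cup(\tfrac12-\tfrac i2,\tfrac12+\tfrac i2)$ (the two open diagonals of $D$) and holomorphic in some neighborhood of the point $\tfrac12$, and if $S(f)<\infty$, then $f$ extends to a function in $A^2(D)$, and the two-sided estimate above (with the same constants $c,C$) holds for this extension.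
   Context: $D=\{z\in\mathbb{C}: |\mathrm{Re}\,z-\tfrac12|+|\mathrm{Im}\,z|<\tfrac12\}$ is the open square one of whose diagonals is $(0,1)$; its other diagonal is the open vertical segment $(\tfrac12-\tfrac i2,\tfrac12+\tfrac i2)=\{\tfrac12+iy:|y|<\tfrac12\}$. $dA(z)=dx\,dy$ is planar Lebesgue measure. For a domain $U\subset\mathbb{C}$, the Bergman space $A^2(U)$ is the space of holomorphic functions $f$ on $U$ with $\int_U|f|^2\,dA<\infty$. For holomorphic $f$, $f^{(n)}$ is the complex derivative of order $n$. For a function that is only $\mathcal{C}^\infty$ on the diagonals, meaning that its restriction to each of the two open segments is $\mathcal{C}^\infty$, $f^{(n)}$ at a point of a diagonal is understood as the derivative along that diagonal: at points of $(0,1)$, $f^{(n)}(x)=\frac{d^n}{dx^n}f(x)$; at points of the vertical diagonal, $f^{(n)}(\tfrac12+iy)=(-i)^n\frac{d^n}{dy^n}f(\tfrac12+iy)$. These agree with the complex derivative wherever $f$ is holomorphic. *)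

(* Defs.v *)
From HB Require Import structures.
From mathcomp Require Export all_boot all_order all_algebra complex.
From mathcomp Require Export all_classical all_reals all_analysis.
Export Order.TTheory GRing.Theory Num.Theory numFieldNormedType.Exports.

Set Implicit Arguments.
Unset Strict Implicit.
Unset Printing Implicit Defensive.

Local Open Scope classical_set_scope.
Local Open Scope ring_scope.
Local Open Scope complex_scope.

Section Bergman.
Variable R : realType.

(* The complex numbers over [R]. The regular module [R[i]^o] is used (instead of
   the convertible [R[i]]) because it carries the norm topology, with [R[i]]
   as field of scalars: [derivable f z 1] is then complex differentiability
   at [z] and [derive1n n f z] is the complex derivative of order [n]. *)
Local Notation C := (R[i]^o).

Definition holomorphic (U : set C) (f : C -> C) : Prop :=
  forall z, U z -> derivable f z 1.

Definition sqnormL2 (U : set C) (f : C -> C) : \bar R :=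
  (\int[@lebesgue_measure R \x @lebesgue_measure R]_(p in
       [set p : R * R | U (p.1 +i* p.2)])
     (Normc.normc (f (p.1 +i* p.2)) ^+ 2)%:E)%E.

(* Functions on [U] are represented by total functions, whose values
   outside [U] are irrelevant. *)
Definition bergman (U : set C) (f : C -> C) : Prop :=
  holomorphic U f /\ (sqnormL2 U f < +oo)%E.

Definition square : set C :=
  [set z | `|complex.Re z - 2^-1| + `|complex.Im z| < 2^-1].

Definition center : C := 2^-1 +i* 0.

Definition hdiag (x : R) : C := x +i* 0.
Definition vdiag (y : R) : C := 2^-1 +i* y.

Definition diagonals : set C :=
  hdiag @` `]0, 1[ `|` vdiag @` `](- 2^-1), 2^-1[.

(* [h n x] and [v n y] stand for [f^(n)(x)] and [f^(n)(1/2 + i y)]. *)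
Definition diag_sum (h v : nat -> R -> C) : \bar R :=
  (\sum_(0 <= n <oo)
     ((2 ^+ n / ((2 * n).+1)`!%:R)%:E *
      \int[lebesgue_measure]_(x in `]0%R, 2^-1%R[)
        (x ^+ (2 * n).+1 *
         (Normc.normc (h n x) ^+ 2 + Normc.normc (h n (1 - x)) ^+ 2 +
          Normc.normc (v n (2^-1 - x)) ^+ 2 + Normc.normc (v n (x - 2^-1)) ^+ 2))%:E))%E.

Definition S_hol (f : C -> C) : \bar R :=
  diag_sum (fun n x => derive1n n f (hdiag x))
           (fun n y => derive1n n f (vdiag y)).

(* The derivative of order [n] of a complex-valued function of a real variable,
   taken componentwise. *)
Definition derivRC (n : nat) (g : R -> C) (t : R) : C :=
  (derive1n n (fun s => complex.Re (g s)) t) +i*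
  (derive1n n (fun s => complex.Im (g s)) t).

Definition smooth_on (I : set R) (g : R -> C) : Prop :=
  forall n t, I t ->
    derivable (derive1n n (fun s => complex.Re (g s))) t 1 /\
    derivable (derive1n n (fun s => complex.Im (g s))) t 1.

Definition smooth_diagonals (f : C -> C) : Prop :=
  smooth_on `]0, 1[ (f \o hdiag) /\ smooth_on `](- 2^-1), 2^-1[ (f \o vdiag).

(* Derivatives along the diagonals; since [z = 1/2 + i y], [d/dz] is
   [-i d/dy] on the vertical one. *)
Definition S_diag (f : C -> C) : \bar R :=
  diag_sum (fun n x => derivRC n (f \o hdiag) x)
           (fun n y => (0 +i* (- 1)) ^+ n * derivRC n (f \o vdiag) y).

End Bergman.

(* Main.v *)
(** With [c_n = 2^n/(2n+1)!] and [kappa] the area of the unit disc, Parseval's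
    identity on circles and a Beta integral give, for [f] holomorphic on
    [|z - x| < x / sqrt 2],
      [sum_n c_n x^(2n+1) |f^(n)(x)|^2
         = kappa^-1 * int_(|z-x| < x / sqrt 2) |f(z)|^2 / sqrt (x^2 - 2|z-x|^2) dA(z)].
    These discs fill the part of the square close to the vertex [0].  Integrating over
    [0 < x < 1/2], Tonelli's theorem turns the sum attached to that vertex into
    [kappa^-1 * int_D |f|^2 ker], where the kernel [ker] is at most [6] on [D] and at
    least [1/6] on a region whose four rotations about the center cover [D]; this gives
    the estimate, for every [f] holomorphic on [D], finite or not.

    For the extension let [u_n(x)] be the derivatives along a half-diagonal.  Since
      [d/dx sum_(n <= N) u_n(x) (z-x)^n / n! = u_(N+1)(x) (z-x)^N / N!],
    the finiteness of the sum and the arithmetic-geometric inequality show that the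
    Taylor polynomials at [z] centered at two points [x], [x'] whose discs contain [z]
    differ by a geometrically small quantity, and that they converge.  Their limit does
    not depend on [x], has Taylor coefficients [u_n(x)/n!] at [x], and the functions
    obtained at the four vertices agree on the inscribed disc, where all are the sum of
    the Taylor series of [f] at the center. *)

From HB Require Import structures.
Require Import Defs.
From mathcomp Require Import measurable_realfun ring lra.

Set Implicit Arguments.
Unset Strict Implicit.
Unset Printing Implicit Defensive.

Local Open Scope classical_set_scope.
Local Open Scope ring_scope.
Local Open Scope complex_scope.

(** * The norm of complex numbers and complex differentiability *)

(** The radius [x / sqrt 2] is the largest for which the discs centered at the points [x] of
    [(0, 1/2]] stay in the square: they touch the two sides that meet at 0. The coefficient
    [2^n / (2n+1)!] comes from the weight: it is the [n]-th moment in the squared radius, divided by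
    [n!^2 x^(2n+1)].

    The weight is unbounded near the bounding circle, where the Taylor partial sums have no uniform
    bound either. The disc identity is therefore proved for weights cut off at a smaller radius and
    extended by monotone convergence, which also covers infinite values.

    For the extension, the finiteness of the sum bounds the derivatives only in mean square over
    [x], never at a given [x]. Taylor polynomials are therefore compared through integrals over an
    interval of base points, and their last term is made small at a base point that varies with the
    degree. The gluing rests on plane geometry: the regions attached to two different vertices meet
    only inside the inscribed disc, where the Taylor series at the center decides. *)

Section NormC.
Variable R : realType.
Local Notation C := (R[i]^o).
Local Notation normc := (@Normc.normc R).
Implicit Types (z w h : C).

Lemma normc_ge0 z : 0 <= normc z.
Proof. by case: z => a b; exact: sqrtr_ge0. Qed.

Lemma normrE_normc z : `|z : R[i]| = (normc z)%:C.
Proof. by []. Qed.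

Lemma sqr_normc z : normc z ^+ 2 = complex.Re z ^+ 2 + complex.Im z ^+ 2.
Proof. by case: z => a b /=; rewrite sqr_sqrtr ?addr_ge0 ?sqr_ge0. Qed.

Lemma normcM z w : normc (z * w) = normc z * normc w.
Proof. exact: Normc.normcM. Qed.

Lemma normcX z n : normc (z ^+ n) = normc z ^+ n.
Proof.
elim: n => [|n IH]; first by rewrite !expr0; exact: Normc.normc1.
by rewrite !exprS normcM IH.
Qed.

Lemma normcN z : normc (- z) = normc z.
Proof. exact: normcN. Qed.

Lemma normcB z w : normc (z - w) = normc (w - z).
Proof. by rewrite -normcN opprB. Qed.

Lemma normcD z w : normc (z + w) <= normc z + normc w.
Proof. exact: le_normcD. Qed.

Lemma normc_real (x : R) : normc x%:C = `|x|.
Proof. by rewrite /= expr0n /= addr0 sqrtr_sqr. Qed.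

Lemma normc_nat n : normc n%:R = n%:R.
Proof.
have -> : (n%:R : C) = (n%:R : R)%:C by rewrite rmorph_nat.
by rewrite normc_real ger0_norm.
Qed.

Lemma normc0 : normc 0 = 0. Proof. exact: Normc.normc0. Qed.

Lemma normc_gt0 z : (0 < normc z) = (z != 0).
Proof.
rewrite lt_def normc_ge0 andbT; congr negb; apply/eqP/eqP => [/Normc.eq0_normc//|->].
exact: normc0.
Qed.

Lemma normcV z : normc z^-1 = (normc z)^-1.
Proof. exact: Normc.normcV. Qed.

Lemma normc_sum (I : Type) (r : seq I) (P : pred I) (F : I -> C) :
  normc (\sum_(i <- r | P i) F i) <= \sum_(i <- r | P i) normc (F i).
Proof.
elim/big_ind2 : _ => [|x1 x2 y1 y2 h1 h2|//]; first by rewrite normc0.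
by apply: le_trans (normcD _ _) _; rewrite lerD.
Qed.

Lemma normc_Re z : `|complex.Re z| <= normc z.
Proof. by rewrite -lecR; exact: normc_ge_Re. Qed.

Lemma normc_Im z : `|complex.Im z| <= normc z.
Proof.
case: z => a b /=; rewrite -sqrtr_sqr ler_wsqrtr// lerDr sqr_ge0//.
Qed.

Lemma normc_le_ReIm z : normc z <= `|complex.Re z| + `|complex.Im z|.
Proof.
rewrite -(@ler_pXn2r _ 2)// ?nnegrE ?normc_ge0 ?addr_ge0//.
rewrite sqr_normc sqrrD !real_normK ?num_real// lerD2r lerDl.
by rewrite mulrn_wge0// mulr_ge0.
Qed.

(** The norm of [R[i]^o], and so the radii of its balls, take values in [R[i]]; a positive complex
    number has zero imaginary part, which makes real radii sufficient. *)
Lemma nbhs_normcP (z : C) (A : set C) :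
  nbhs z A <-> exists2 d : R, 0 < d & forall w, normc (w - z) < d -> A w.
Proof.
split.
- move=> /nbhs_ballP[e /= e0 eA].
  have [e1 e2] : complex.Im e = 0 /\ 0 < complex.Re e.
    by move: e0; rewrite ltcE /= => /andP[/eqP-> ->].
  exists (complex.Re e) => // w wz; apply: eA; rewrite /ball/= distrC.
  by rewrite [`|_|]normrE_normc ltcE/= e1 eqxx.
- move=> [d d0 dA]; apply/nbhs_ballP; exists d%:C => /=; first by rewrite ltcR.
  by move=> w; rewrite /ball/= distrC [`|_|]normrE_normc ltcR => /dA.
Qed.

(** Complex differentiability in first-order expansion form: real tolerances, no quotient and no
    punctured neighborhood, so that estimates and the chain rule are direct. *)
Definition cdiff (f : C -> C) (z l : C) :=
  forall e : R, 0 < e -> exists2 d : R, 0 < d &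
    forall h, normc h < d -> normc (f (z + h) - f z - l * h) <= e * normc h.

Lemma cvg_normcP (T : Type) (f : T -> C) (F : set_system T) (FF : Filter F) (l : C) :
  (f @ F --> l) <-> forall e : R, 0 < e -> \forall w \near F, normc (f w - l) < e.
Proof.
split.
- move=> fl e e0.
  apply: (fl (fun w => normc (w - l) < e)).
  by apply/nbhs_normcP; exists e.
- move=> H A /nbhs_normcP[d d0 dA].
  by apply: filterS (H d d0) => w; exact: dA.
Qed.

Lemma is_derive_cdiff (f : C -> C) (z l : C) : is_derive z (1 : C) f l <-> cdiff f z l.
Proof.
have E : (fun h : C => h^-1 *: ((f \o shift z) (h *: (1 : C)) - f z)) =
         (fun h : C => h^-1 * (f (z + h) - f z)).
  by apply/funext => h /=; rewrite [h *: (1:C)]mulr1 [h + z]addrC.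
split.
- move=> [df dl] e e0.
  move: df; rewrite /derivable => /cvgP; rewrite E.
  have -> : lim ((fun h : C => h^-1 * (f (z + h) - f z)) @ 0^') = l.
    by rewrite -dl /derive E.
  move=> /cvg_normcP/(_ e e0); rewrite /dnbhs /within/= => /nbhs_normcP[d d0 dH].
  exists d => // h hd.
  have [->|h0] := eqVneq h 0; first by rewrite addr0 subrr mulr0 subrr normc0 mulr0.
  have := dH h; rewrite subr0 => /(_ hd h0) /ltW; rewrite -(ler_pM2r (_ : 0 < normc h)) ?normc_gt0//.
  move=> /(le_trans _); apply.
  by rewrite -normcM mulrBl mulrAC mulVf// mul1r.
- move=> H.
  have cv : (fun h : C => h^-1 * (f (z + h) - f z)) @ 0^' --> l.
    apply/cvg_normcP => e e0; rewrite /dnbhs /within/=; apply/nbhs_normcP.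
    have [d d0 dH] := H (e / 2) (divr_gt0 e0 (ltr0Sn R 1)).
    exists d => // h; rewrite subr0 => hd h0.
    have h0' : 0 < normc h by rewrite normc_gt0.
    apply: (@le_lt_trans _ _ (e / 2)); last by rewrite ltr_pdivrMr// ltr_pMr// ltr1n.
    rewrite -(ler_pM2r h0') -normcM mulrBl mulrAC mulVf// mul1r.
    exact: dH.
  apply: DeriveDef; first by rewrite /derivable E; apply/cvg_ex; exists l.
  by rewrite /derive E; apply/cvg_lim => //; exact: norm_hausdorff.
Qed.

Lemma cdiff_derive1 f z l : cdiff f z l -> derive1 f z = l.
Proof. by move=> /is_derive_cdiff[_ <-]; rewrite derive1E. Qed.

Lemma cdiff_derivable f z l : cdiff f z l -> derivable f z 1.
Proof. by move=> /is_derive_cdiff[]. Qed.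

Lemma derivable_cdiff f z : derivable f z 1 -> cdiff f z (derive1 f z).
Proof. by move=> df; apply/is_derive_cdiff; rewrite derive1E; exact/derivableP. Qed.

Lemma cdiff_near (f g : C -> C) z l (r : R) : 0 < r ->
  (forall w, normc (w - z) < r -> f w = g w) -> cdiff f z l -> cdiff g z l.
Proof.
move=> r0 fg H e e0; have [d d0 dH] := H e e0.
exists (Num.min r d); first by rewrite lt_min r0.
move=> h; rewrite lt_min => /andP[hr hd].
rewrite -!fg ?subrr ?normc0//; first exact: dH.
by rewrite addrC addKr.
Qed.

Lemma cdiff_comp (f g : C -> C) z l m :
  cdiff g z m -> cdiff f (g z) l -> cdiff (f \o g) z (l * m).
Proof.
move=> Hg Hf e e0.
pose K := normc m + 1.
have K0 : 0 < K by rewrite ltr_wpDl ?normc_ge0.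
pose L := normc l + 1.
have L0 : 0 < L by rewrite ltr_wpDl ?normc_ge0.
have [d1 d10 H1] := Hf (e / 2 / K) (divr_gt0 (divr_gt0 e0 (ltr0Sn R 1)) K0).
have [d2 d20 H2] := Hg 1 ltr01.
have [d3 d30 H3] := Hg (e / 2 / L) (divr_gt0 (divr_gt0 e0 (ltr0Sn R 1)) L0).
exists (Num.min d2 (Num.min d3 (d1 / K))).
  by rewrite !lt_min d20 d30 divr_gt0.
move=> h; rewrite !lt_min => /and3P[h2 h3 h1].
pose k := g (z + h) - g z.
have kn : normc k <= K * normc h.
  have -> : k = (k - m * h) + m * h by rewrite subrK.
  apply: le_trans (normcD _ _) _; rewrite normcM /K mulrDl addrC lerD2l.
  exact: H2.
have kd : normc k < d1.
  by apply: le_lt_trans kn _; rewrite mulrC -ltr_pdivlMr.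
have -> : (f \o g) (z + h) - (f \o g) z - l * m * h =
   (f (g z + k) - f (g z) - l * k) + l * (k - m * h).
  by rewrite /k /= [g z + _]addrC subrK; ring.
apply: le_trans (normcD _ _) _; rewrite normcM.
have A : normc (f (g z + k) - f (g z) - l * k) <= e / 2 * normc h.
  apply: le_trans (H1 _ kd) _; rewrite -mulrA ler_wpM2l//; first lra.
  by rewrite mulrC ler_pdivrMr// mulrC.
have B : normc l * normc (k - m * h) <= e / 2 * normc h.
  apply: (@le_trans _ _ (L * (e / 2 / L * normc h))).
    by apply: ler_pM; rewrite ?normc_ge0// ?lerDl//; exact: H3.
  by rewrite mulrA mulrCA divff ?gt_eqF// mulr1.
lra.
Qed.

Lemma cdiff_continuous f z l : cdiff f z l -> forall e : R, 0 < e ->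
  exists2 d : R, 0 < d & forall w, normc (w - z) < d -> normc (f w - f z) < e.
Proof.
move=> H e e0; have [d d0 dH] := H 1 ltr01.
have K0 : 0 < normc l + 1 by rewrite ltr_wpDl ?normc_ge0.
exists (Num.min d (e / (normc l + 1))); first by rewrite lt_min d0 divr_gt0.
move=> w; rewrite lt_min => /andP[wd we].
have := dH _ wd; rewrite [z + _]addrC subrK => Hw.
have -> : f w - f z = (f w - f z - l * (w - z)) + l * (w - z) by ring.
apply: le_lt_trans (normcD _ _) _; rewrite normcM.
rewrite ltr_pdivlMr// in we; nra.
Qed.

End NormC.

(** * Real integrals over segments and Goursat's lemma *)

Section SegmentIntegral.
Variable R : realType.
Notation mu := (@lebesgue_measure R).
Implicit Types (f g : R -> R) (a b c e k : R).

Definition seg_int a b f : R := \int[mu]_(x in `[a, b]) f x.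

(** Continuity is two-sided even at the end points. The integrands on closed segments below are
    continuous beyond the ends, and one-sided limits are avoided. *)
Definition cont_on a b f := forall x, a <= x <= b -> {for x, continuous f}.

Lemma cont_on_within a b f : cont_on a b f -> {within `[a, b], continuous f}.
Proof.
move=> cf; apply: continuous_in_subspaceT => x; rewrite inE/= in_itv/=.
exact: cf.
Qed.

Lemma cont_on_integrable a b f : cont_on a b f ->
  mu.-integrable `[a, b] (EFin \o f).
Proof.
move=> /cont_on_within cf; apply: continuous_compact_integrable => //.
exact: segment_compact.
Qed.

Lemma seg_int_cat a b c f : a <= b -> b <= c -> cont_on a c f ->
  seg_int a c f = seg_int a b f + seg_int b c f.
Proof.
move=> ab bc cf; have fi := cont_on_integrable cf.
have H := @Rintegral_itvB R f (BLeft a) (BRight c) b fi.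
have := H; rewrite !bnd_simp => /(_ ab bc) E.
rewrite /seg_int -(@Rintegral_itv_obnd_cbnd R b) ?(esym E) ?subrKC//.
apply: integrableS fi => //; apply: subset_itv; rewrite bnd_simp//.
Qed.

Lemma seg_int_ext a b f g : (forall x, a <= x <= b -> f x = g x) ->
  seg_int a b f = seg_int a b g.
Proof.
by move=> fg; apply: eq_Rintegral => x; rewrite inE/= in_itv/=; exact: fg.
Qed.

Lemma seg_intD a b f g : cont_on a b f -> cont_on a b g ->
  seg_int a b (fun x => f x + g x) = seg_int a b f + seg_int a b g.
Proof. by move=> cf cg; rewrite /seg_int RintegralD//; exact: cont_on_integrable. Qed.

Lemma seg_intB a b f g : cont_on a b f -> cont_on a b g ->
  seg_int a b (fun x => f x - g x) = seg_int a b f - seg_int a b g.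
Proof. by move=> cf cg; rewrite /seg_int RintegralB//; exact: cont_on_integrable. Qed.

Lemma seg_intZ a b f k : cont_on a b f ->
  seg_int a b (fun x => k * f x) = k * seg_int a b f.
Proof. by move=> cf; rewrite /seg_int RintegralZl//; exact: cont_on_integrable. Qed.

Lemma seg_int_cst a b k : a <= b -> seg_int a b (fun=> k) = k * (b - a).
Proof.
move=> ab; rewrite /seg_int Rintegral_cst//= lebesgue_measure_itv/= lte_fin.
case: ltP => // ba; have -> : b = a by lra.
by rewrite subrr mulr0.
Qed.

Lemma cont_on_cst a b k : cont_on a b (fun=> k).
Proof. by move=> x _; exact: cvg_cst. Qed.

Lemma le_seg_int a b f g : cont_on a b f -> cont_on a b g ->
  (forall x, a <= x <= b -> f x <= g x) -> seg_int a b f <= seg_int a b g.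
Proof.
move=> cf cg fg; apply: le_Rintegral => //; try exact: cont_on_integrable.
Qed.

Lemma seg_int_dev a b f k e : a <= b -> cont_on a b f ->
  (forall x, a <= x <= b -> `|f x - k| <= e) ->
  `|seg_int a b f - k * (b - a)| <= e * (b - a).
Proof.
move=> ab cf H; rewrite ler_norml; apply/andP; split.
- have : seg_int a b (fun=> k - e) <= seg_int a b f.
    apply: le_seg_int => //; first exact: cont_on_cst.
    by move=> x /H; rewrite ler_norml; lra.
  by rewrite seg_int_cst//; lra.
- have : seg_int a b f <= seg_int a b (fun=> k + e).
    apply: le_seg_int => //; first exact: cont_on_cst.
    by move=> x /H; rewrite ler_norml; lra.
  by rewrite seg_int_cst//; lra.
Qed.

Lemma seg_int_norm_le a b f e : a <= b -> cont_on a b f ->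
  (forall x, a <= x <= b -> `|f x| <= e) -> `|seg_int a b f| <= e * (b - a).
Proof.
move=> ab cf H; have := @seg_int_dev a b f 0 e ab cf; rewrite mul0r subr0; apply.
by move=> x /H; rewrite subr0.
Qed.

Lemma continuous_epsP f x : {for x, continuous f} <->
  forall e, 0 < e -> exists2 d, 0 < d & forall u, `|u| < d -> `|f (x + u) - f x| < e.
Proof.
split.
- move=> /cvgrPdist_lt cf e e0; have := cf e e0 => /nbhs_ballP[d /= d0 H].
  exists d => // u ud; rewrite distrC; apply: H.
  by rewrite /ball/= opprD addNKr normrN.
- move=> H; apply/cvgrPdist_lt => e e0; have [d d0 Hd] := H e e0.
  apply/nbhs_ballP; exists d => // y; rewrite /ball/= => xy.
  have H' := Hd (y - x); rewrite subrKC in H'; rewrite distrC; apply: H'.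
  by rewrite distrC.
Qed.

End SegmentIntegral.

(** * Goursat's lemma for closed forms on a rectangle, by repeated quartering *)

Section Goursat.
Variable R : realType.
Variables P Q : R -> R -> R.

(* [P dx + Q dy] is closed at [(x, y)], in the pointwise sense: [P] and [Q] are
   differentiable there and [dP/dy = dQ/dx = k]. *)
Definition closed_form_at (x y : R) := exists p k q : R, forall e, 0 < e ->
  exists2 d, 0 < d & forall u v, `|u| < d -> `|v| < d ->
    `|P (x + u) (y + v) - P x y - (p * u + k * v)| <= e * (`|u| + `|v|) /\
    `|Q (x + u) (y + v) - Q x y - (k * u + q * v)| <= e * (`|u| + `|v|).

(** The integral of [P dx + Q dy] along the boundary of [[a, b] x [c, d]], counterclockwise, with
    opposite sides taken together. *)
Definition rect_int (a b c d : R) :=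
  seg_int a b (fun t => P t c - P t d) + seg_int c d (fun s => Q b s - Q a s).

Lemma affine_continuous (g : R -> R) (x m : R) :
  (exists2 d, 0 < d & forall u, `|u| < d -> `|g (x + u) - g x - m * u| <= `|u|) ->
  {for x, continuous g}.
Proof.
move=> [d d0 H]; apply/continuous_epsP => e e0.
have K0 : 0 < `|m| + 1 by rewrite ltr_wpDl.
exists (Num.min d (e / (`|m| + 1))); first by rewrite lt_min d0 divr_gt0.
move=> u; rewrite lt_min => /andP[/H Hu ue].
have -> : g (x + u) - g x = (g (x + u) - g x - m * u) + m * u by ring.
apply: le_lt_trans (ler_normD _ _) _; rewrite normrM.
by rewrite ltr_pdivlMr// in ue; nra.
Qed.

Lemma closed_form_continuous x y : closed_form_at x y ->
  [/\ {for x, continuous (P ^~ y)}, {for y, continuous (P x)},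
      {for x, continuous (Q ^~ y)} & {for y, continuous (Q x)}].
Proof.
move=> [p [k [q /(_ 1 ltr01)[d d0 H]]]]; split.
- apply: (@affine_continuous _ _ p); exists d => // u ud.
  have [+ _] := H u 0 ud ltac:(by rewrite normr0).
  by rewrite addr0 mulr0 addr0 normr0 addr0 mul1r.
- apply: (@affine_continuous _ _ k); exists d => // u ud.
  have [+ _] := H 0 u ltac:(by rewrite normr0) ud.
  by rewrite addr0 mulr0 add0r normr0 add0r mul1r.
- apply: (@affine_continuous _ _ k); exists d => // u ud.
  have [_ +] := H u 0 ud ltac:(by rewrite normr0).
  by rewrite addr0 mulr0 addr0 normr0 addr0 mul1r.
- apply: (@affine_continuous _ _ q); exists d => // u ud.
  have [_ +] := H 0 u ltac:(by rewrite normr0) ud.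
  by rewrite addr0 mulr0 add0r normr0 add0r mul1r.
Qed.

Variables a0 b0 c0 d0 : R.
Hypothesis ab0 : a0 <= b0.
Hypothesis cd0 : c0 <= d0.
Hypothesis PQ : forall x y, a0 <= x <= b0 -> c0 <= y <= d0 -> closed_form_at x y.

Let contB (f g : R -> R) a b : cont_on a b f -> cont_on a b g ->
  cont_on a b (fun t => f t - g t).
Proof. by move=> cf cg x xab; apply: cvgB; [exact: cf | exact: cg]. Qed.

Let contP a b y : a0 <= a -> b <= b0 -> c0 <= y <= d0 -> cont_on a b (P ^~ y).
Proof.
move=> ha hb hy x /andP[ax xb].
by have [] // := @closed_form_continuous x y (PQ _ hy); lra.
Qed.

Let contQ c d x : c0 <= c -> d <= d0 -> a0 <= x <= b0 -> cont_on c d (Q x).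
Proof.
move=> ha hb hy y /andP[ax xb].
by have [] // := @closed_form_continuous x y (PQ hy _); lra.
Qed.

(** Each inner side is run once in both directions and cancels. Right and upper ends are written as
    corner plus half side, the shape that iterating the quartering requires. *)
Lemma rect_int_split a w c h : 0 <= w -> 0 <= h ->
  a0 <= a -> a + w <= b0 -> c0 <= c -> c + h <= d0 ->
  rect_int a (a + w) c (c + h) =
    (rect_int a (a + w / 2) c (c + h / 2) +
     rect_int a (a + w / 2) (c + h / 2) (c + h / 2 + h / 2)) +
    (rect_int (a + w / 2) (a + w / 2 + w / 2) c (c + h / 2) +
     rect_int (a + w / 2) (a + w / 2 + w / 2) (c + h / 2) (c + h / 2 + h / 2)).
Proof.
move=> w0 h0 ha haw hc hch; rewrite /rect_int.
have -> : a + w / 2 + w / 2 = a + w by field.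
have -> : c + h / 2 + h / 2 = c + h by field.
set a1 := a + w / 2; set c1 := c + h / 2.
have cP y a' b' : c <= y <= c + h -> a <= a' -> b' <= a + w -> cont_on a' b' (P ^~ y).
  by move=> *; apply: contP; lra.
have cQ x a' b' : a <= x <= a + w -> c <= a' -> b' <= c + h -> cont_on a' b' (Q x).
  by move=> *; apply: contQ; lra.
have a1E : a1 = a + w / 2 by [].
have c1E : c1 = c + h / 2 by [].
have [aa1 a1w] : a <= a1 /\ a1 <= a + w by lra.
have [cc1 c1h] : c <= c1 /\ c1 <= c + h by lra.
have aw : a <= a + w by lra.
have ch : c <= c + h by lra.
have yc : c <= c <= c + h by rewrite lexx.
have yc1 : c <= c1 <= c + h by rewrite cc1.
have ych : c <= c + h <= c + h by rewrite lexx andbT.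
have xa : a <= a <= a + w by rewrite lexx.
have xa1 : a <= a1 <= a + w by rewrite aa1.
have xaw : a <= a + w <= a + w by rewrite lexx andbT.
do ![rewrite seg_intB; [|by (apply: cP || apply: cQ)
   |by (apply: cP || apply: cQ)]].
have sP y : c <= y <= c + h -> seg_int a (a + w) (P ^~ y) =
   seg_int a a1 (P ^~ y) + seg_int a1 (a + w) (P ^~ y).
  by move=> hy; apply: seg_int_cat => //; apply: cP.
have sQ y : a <= y <= a + w -> seg_int c (c + h) (Q y) =
   seg_int c c1 (Q y) + seg_int c1 (c + h) (Q y).
  by move=> hy; apply: seg_int_cat => //; apply: cQ.
by rewrite (sP c) ?(sP (c + h)) ?(sQ a) ?(sQ (a + w)) //; ring.
Qed.

Lemma rect_int_quarter a w c h eta : 0 <= w -> 0 <= h ->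
  a0 <= a -> a + w <= b0 -> c0 <= c -> c + h <= d0 ->
  eta <= `|rect_int a (a + w) c (c + h)| ->
  exists s : R * R, [/\ (a <= s.1 <= a + w / 2), (c <= s.2 <= c + h / 2) &
    eta / 4 <= `|rect_int s.1 (s.1 + w / 2) s.2 (s.2 + h / 2)|].
Proof.
move=> w0 h0 ha haw hc hch; rewrite rect_int_split// => H.
set j1 := rect_int a (a + w / 2) c (c + h / 2) in H.
set j2 := rect_int a _ (c + h / 2) _ in H.
set j3 := rect_int (a + w / 2) _ c _ in H.
set j4 := rect_int (a + w / 2) _ (c + h / 2) _ in H.
have : eta <= (`|j1| + `|j2|) + (`|j3| + `|j4|).
  apply: le_trans H _; apply: le_trans (ler_normD _ _) _.
  by apply: lerD; exact: ler_normD.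
have [h1 _|h1] := leP (eta / 4) `|j1|; first by exists (a, c); split => //=; lra.
have [h2 _|h2] := leP (eta / 4) `|j2|; first by exists (a, c + h / 2); split => //=; lra.
have [h3 _|h3] := leP (eta / 4) `|j3|; first by exists (a + w / 2, c); split => //=; lra.
have [h4 _|h4] := leP (eta / 4) `|j4|; first by exists (a + w / 2, c + h / 2); split => //=; lra.
lra.
Qed.

(** The affine parts contribute [- k h w] through the horizontal sides and [k w h] through the
    vertical ones; they cancel because [dP/dy] and [dQ/dx] are the same [k]. What remains is at most
    [2 * e] per unit of length. *)
Lemma rect_int_local a w c h x y p k q e : 0 <= e -> 0 <= w -> 0 <= h ->
  a0 <= a -> a + w <= b0 -> c0 <= c -> c + h <= d0 ->
  (forall t s, a <= t <= a + w -> c <= s <= c + h ->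
    `|P t s - P x y - (p * (t - x) + k * (s - y))| <= e /\
    `|Q t s - Q x y - (k * (t - x) + q * (s - y))| <= e) ->
  `|rect_int a (a + w) c (c + h)| <= 2 * e * (w + h).
Proof.
move=> e0 w0 h0 h1 h2 h3 h4 key.
have aw : a <= a + w by rewrite lerDl.
have ch : c <= c + h by rewrite lerDl.
have yc : c <= c <= c + h by rewrite lexx.
have ych : c <= c + h <= c + h by rewrite lexx andbT.
have xa : a <= a <= a + w by rewrite lexx.
have xaw : a <= a + w <= a + w by rewrite lexx andbT.
have cP s : c <= s <= c + h -> cont_on a (a + w) (P ^~ s).
  move=> /andP[s1 s2]; apply: contP => //.
  by rewrite (le_trans h3 s1) (le_trans s2 h4).
have cQ s : a <= s <= a + w -> cont_on c (c + h) (Q s).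
  move=> /andP[s1 s2]; apply: contQ => //.
  by rewrite (le_trans h1 s1) (le_trans s2 h2).
have B1 : `|seg_int a (a + w) (fun t => P t c - P t (c + h)) - (k * - h) * (a + w - a)|
    <= 2 * e * (a + w - a).
  apply: seg_int_dev => //; first by apply: contB; apply: cP.
  move=> t ht; have [A1 _] := key t c ht yc; have [A2 _] := key t (c + h) ht ych.
  by move: A1 A2; clear -ab0 cd0 PQ; rewrite !ler_norml; lra.
have B2 : `|seg_int c (c + h) (fun s => Q (a + w) s - Q a s) - (k * w) * (c + h - c)|
    <= 2 * e * (c + h - c).
  apply: seg_int_dev => //; first by apply: contB; apply: cQ.
  move=> s hs; have [_ A1] := key a s xa hs; have [_ A2] := key (a + w) s xaw hs.
  by move: A1 A2; clear -ab0 cd0 PQ; rewrite !ler_norml; lra.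
move: B1 B2; rewrite /rect_int; set i1 := seg_int _ _ _; set i2 := seg_int _ _ _.
by clearbody i1 i2; clear -ab0 cd0 PQ; rewrite !ler_norml; lra.
Qed.

Theorem goursat : rect_int a0 b0 c0 d0 = 0.
Proof.
apply/eqP/negP => /negP; rewrite -normr_gt0; set eta := `|_| => eta0.
pose w := b0 - a0; pose h := d0 - c0.
have wE : w = b0 - a0 by [].
have hE : h = d0 - c0 by [].
have w_ge0 : 0 <= w by rewrite wE subr_ge0.
have h_ge0 : 0 <= h by rewrite hE subr_ge0.
clearbody w h.
(* The invariant is a hypothesis inside the statement, so that [choice] yields a total successor
   function; [(0, 0)] is the value when the invariant fails. *)
have nextP (ns : nat * (R * R)) : exists s' : R * R,
    let n := ns.1 in let s := ns.2 in
    a0 <= s.1 -> s.1 + w / 2 ^+ n <= b0 -> c0 <= s.2 -> s.2 + h / 2 ^+ n <= d0 ->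
    eta / 4 ^+ n <= `|rect_int s.1 (s.1 + w / 2 ^+ n) s.2 (s.2 + h / 2 ^+ n)| ->
    [/\ s.1 <= s'.1 <= s.1 + w / 2 ^+ n.+1, s.2 <= s'.2 <= s.2 + h / 2 ^+ n.+1 &
     eta / 4 ^+ n.+1 <= `|rect_int s'.1 (s'.1 + w / 2 ^+ n.+1) s'.2 (s'.2 + h / 2 ^+ n.+1)|].
  move: ns => [n [a c]] /=.
  have [H|H] := pselect ([/\ a0 <= a, a + w / 2 ^+ n <= b0,
     c0 <= c, c + h / 2 ^+ n <= d0 &
     eta / 4 ^+ n <= `|rect_int a (a + w / 2 ^+ n) c (c + h / 2 ^+ n)|]); last first.
    by exists (0, 0) => /= *; exfalso; apply: H.
  have [h1 h2 h3 h4 h5] := H.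
  have [||s [s1 s2 s3]] := rect_int_quarter _ _ h1 h2 h3 h4 h5.
  - by rewrite divr_ge0 ?exprn_ge0.
  - by rewrite divr_ge0 ?exprn_ge0.
  exists s => _ _ _ _ _.
  by rewrite !exprSr !invfM !mulrA.
have [next nextPP] := choice nextP.
pose step n s := next (n, s).
have stepP n s := nextPP (n, s).
pose S := fix S n := if n is m.+1 then step m (S m) else (a0, c0).
have SP n : [/\ a0 <= (S n).1, (S n).1 + w / 2 ^+ n <= b0, c0 <= (S n).2,
    (S n).2 + h / 2 ^+ n <= d0 &
    eta / 4 ^+ n <= `|rect_int (S n).1 ((S n).1 + w / 2 ^+ n) (S n).2 ((S n).2 + h / 2 ^+ n)|].
  elim: n => [|n [h1 h2 h3 h4 h5]].
    rewrite /= !expr0 !divr1 wE hE !subrKC; split => //.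
  have [/andP[s1 s1'] /andP[s2 s2'] s3] := stepP n (S n) h1 h2 h3 h4 h5.
  have E x : x / 2 ^+ n = x / 2 ^+ n.+1 + x / 2 ^+ n.+1 :> R.
    by rewrite exprSr; field; rewrite expf_neq0.
  by split => //=; move: s1 s1' s2 s2' h1 h2 h3 h4; rewrite !E; clear -ab0 cd0 PQ; lra.
have SS n : [/\ (S n).1 <= (S n.+1).1, (S n.+1).1 + w / 2 ^+ n.+1 <= (S n).1 + w / 2 ^+ n,
    (S n).2 <= (S n.+1).2 & (S n.+1).2 + h / 2 ^+ n.+1 <= (S n).2 + h / 2 ^+ n].
  have [h1 h2 h3 h4 h5] := SP n.
  have [/andP[s1 s1'] /andP[s2 s2'] s3] := stepP n (S n) h1 h2 h3 h4 h5.
  have E x : x / 2 ^+ n = x / 2 ^+ n.+1 + x / 2 ^+ n.+1 :> R.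
    by rewrite exprSr; field; rewrite expf_neq0.
  by rewrite /= !E; move: s1 s1' s2 s2'; rewrite /step; clear -ab0 cd0 PQ; split; lra.
have pw x n : 0 <= x -> 0 <= x / 2 ^+ n :> R by move=> x0; rewrite divr_ge0 ?exprn_ge0.
have nested (al be : nat -> R) : (forall n, al n <= al n.+1) ->
    (forall n, be n.+1 <= be n) -> (forall n, al n <= be n) ->
    exists x, forall n, al n <= x <= be n.
  move=> al1 be1 ab.
  have al_be m n : al m <= be n.
    have /nondecreasing_seqP ha : forall n, al n <= al n.+1 := al1.
    have /nonincreasing_seqP hb : forall n, be n.+1 <= be n := be1.
    apply: (@le_trans _ _ (al (maxn m n))); first exact/ha/leq_maxl.
    by apply: le_trans (ab _) _; exact/hb/leq_maxr.
  exists (sup (range al)) => n; apply/andP; split.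
    apply: ub_le_sup; last by exists n.
    by exists (be 0%N) => _ [m _ <-].
  apply: ge_sup; first by exists (al 0%N), 0%N.
  by move=> _ [m _ <-].
have [x Hx] := nested (fun n => (S n).1) (fun n => (S n).1 + w / 2 ^+ n)
  (fun n => let: And4 h _ _ _ := SS n in h) (fun n => let: And4 _ h _ _ := SS n in h)
  (fun n => ltac:(rewrite lerDl; apply: pw; lra)).
have [y Hy] := nested (fun n => (S n).2) (fun n => (S n).2 + h / 2 ^+ n)
  (fun n => let: And4 _ _ h _ := SS n in h) (fun n => let: And4 _ _ _ h := SS n in h)
  (fun n => ltac:(rewrite lerDl; apply: pw; lra)).
have [p [k [q HPQ]]] : closed_form_at x y.
  apply: PQ; first by have := Hx 0%N; rewrite /= expr0 divr1 wE; lra.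
  by have := Hy 0%N; rewrite /= expr0 divr1 hE; lra.
have wh0 : 0 < w + h + 1 by lra.
(* With this tolerance the local bound is at most [eta / 2] over [4 ^+ n], against the lower bound
   [eta] over [4 ^+ n]. The [1] keeps the denominator positive for a degenerate rectangle. *)
pose e := eta / (4 * (w + h + 1) ^+ 2).
have e0 : 0 < e by rewrite divr_gt0// mulr_gt0// exprn_gt0.
have [d d_gt0 Hd] := HPQ e e0.
have [n wn] : exists n, (w + h + 1) / 2 ^+ n < d.
  have /cvgrPdist_lt := @cvg_geometric R (w + h + 1) 2^-1 ltac:(rewrite ger0_norm ?invr_ge0//; lra).
  move=> /(_ d d_gt0)[n _ /(_ n (leqnn n))]; rewrite /geometric/= sub0r normrN => Hn.
  by exists n; rewrite -exprVn (le_lt_trans _ Hn)// ler_norm.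
have [h1 h2 h3 h4 h5] := SP n.
set a := (S n).1 in h1 h2 h5 *; set c := (S n).2 in h3 h4 h5 *.
set wn' := w / 2 ^+ n in h2 h5; set hn' := h / 2 ^+ n in h4 h5.
have wn0 : 0 <= wn' by apply: pw; lra.
have hn0 : 0 <= hn' by apply: pw; lra.
have whn : wn' + hn' < d.
  by apply: le_lt_trans wn; rewrite -mulrDl ler_pM2r ?invr_gt0 ?exprn_gt0//; lra.
have xa : a <= x <= a + wn' := Hx n.
have yc : c <= y <= c + hn' := Hy n.
have : `|rect_int a (a + wn') c (c + hn')| <= 2 * (e * (wn' + hn')) * (wn' + hn').
  apply: (@rect_int_local _ _ _ _ x y p k q) => //.
    by rewrite mulr_ge0 ?addr_ge0// ltW.
  move=> t s ht hs.
  have tx : `|t - x| <= wn'.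
    by move: ht xa; clear -ab0 cd0 PQ; rewrite ler_norml; lra.
  have sy : `|s - y| <= hn'.
    by move: hs yc; clear -ab0 cd0 PQ; rewrite ler_norml; lra.
  have [|| A B] := Hd (t - x) (s - y).
  - by move: tx whn hn0; clear -ab0 cd0 PQ; lra.
  - by move: sy whn wn0; clear -ab0 cd0 PQ; lra.
  rewrite !subrKC in A B.
  by split; [apply: le_trans A _|apply: le_trans B _]; rewrite ler_pM2l// lerD.
move=> /(le_trans h5); apply/negP; rewrite -ltNge.
have -> : 2 * (e * (wn' + hn')) * (wn' + hn') = (eta / 2 * ((w + h) / (w + h + 1)) ^+ 2) / 4 ^+ n.
  have -> : (4 : R) ^+ n = 2 ^+ n * 2 ^+ n by rewrite -exprMn; congr (_ ^+ _); ring.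
  by rewrite /wn' /hn' /e; field; rewrite (gt_eqF wh0) expf_neq0.
rewrite ltr_pM2r ?invr_gt0 ?exprn_gt0//.
have wh : 0 <= w + h by exact: addr_ge0.
have q1 : ((w + h) / (w + h + 1)) ^+ 2 <= 1.
  apply: exprn_ile1; first by rewrite divr_ge0// ltW.
  by rewrite ler_pdivrMr// mul1r lerDl.
have e2 : 0 < eta / 2 by rewrite divr_gt0.
apply: (@le_lt_trans _ _ (eta / 2)); first by rewrite ler_piMr// ltW.
by rewrite ltr_pdivrMr// ltr_pMr// ltr1n.
Qed.

End Goursat.

(** * The complex exponential and integrals along circles *)

Section CircleMean.
Variable R : realType.
Local Notation C := (R[i]^o).
Local Notation normc := (@Normc.normc R).

Definition cis (t : R) : C := cos t +i* sin t.

Lemma normc_cis t : normc (cis t) = 1.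
Proof. by rewrite /= cos2Dsin2 sqrtr1. Qed.

Lemma cisD s t : cis (s + t) = cis s * cis t.
Proof. by rewrite /cis cosD sinD; apply/eqP; rewrite eq_complex/= eqxx/= addrC [cos s * _]mulrC mulrC eqxx. Qed.

Definition circ (r t : R) : C := r%:C * cis t.

Lemma normc_circ r t : 0 <= r -> normc (circ r t) = r.
Proof. by move=> r0; rewrite normcM normc_cis mulr1 normc_real ger0_norm. Qed.

Definition cexp (z : C) : C := circ (expR (complex.Re z)) (complex.Im z).

Lemma cexpD z w : cexp (z + w) = cexp z * cexp w.
Proof.
case: z w => [a b] [c d]; rewrite /cexp /circ/= expRD cisD rmorphM.
by rewrite mulrACA.
Qed.

Lemma normc_cexp z : normc (cexp z) = expR (complex.Re z).
Proof. by rewrite normc_circ// expR_ge0. Qed.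

Lemma is_derive_affine (f : R -> R) (x l : R) : is_derive x 1 f l ->
  forall e, 0 < e -> exists2 d, 0 < d & forall h, `|h| < d ->
    `|f (x + h) - f x - l * h| <= e * `|h|.
Proof.
move=> [df dl] e e0.
move: df; rewrite /derivable => /cvgP.
have -> : lim ((fun h : R => h^-1 *: ((f \o shift x) (h *: (1 : R)) - f x)) @ 0^') = l.
  by rewrite -dl.
move=> /cvgrPdist_lt/(_ e e0); rewrite /dnbhs /within/= => /nbhs_ballP[d /= d0 dH].
exists d => // h hd; have [->|h0] := eqVneq h 0.
  by rewrite addr0 subrr mulr0 subrr normr0 mulr0.
have := dH h; rewrite /ball/= sub0r normrN => /(_ hd h0) /ltW.
rewrite -(ler_pM2r (_ : 0 < `|h|)) ?normr_gt0// -normrM.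
move=> /(le_trans _); apply; rewrite distrC mulrBl [h%:A]mulr1 [h + x]addrC.
by rewrite [_ *: _]/(_ * _) mulrAC mulVf// mul1r lexx.
Qed.

Lemma cdiff_cexp0 : cdiff cexp 0 1.
Proof.
move=> e e0.
(* Tolerance [e / 16] suffices: [B1] below uses four multiples of [e / 16 * n] and [B2] five. *)
have [d1 d10 H1] := is_derive_affine (is_derive_expR (0:R)) (divr_gt0 e0 (ltr0Sn R 15)).
have [d2 d20 H2] := is_derive_affine (is_derive_sin (0:R)) (divr_gt0 e0 (ltr0Sn R 15)).
have [d3 d30 H3] := is_derive_affine (is_derive_cos (0:R)) (divr_gt0 e0 (ltr0Sn R 15)).
have [d4 d40 H4] := is_derive_affine (is_derive_expR (0:R)) (ltr01).
pose d := Num.min (Num.min d1 d2) (Num.min (Num.min d3 d4) (Num.min 1 (e / 16))).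
exists d; first by rewrite /d !lt_min d10 d20 d30 d40 ltr01 divr_gt0.
move=> h; rewrite /d !lt_min => /andP[/andP[hd1 hd2] /andP[/andP[hd3 hd4] /andP[hd5 hd6]]].
have hR := normc_Re h; have hI := normc_Im h.
rewrite add0r mul1r.
have -> : cexp 0 = 1.
  by rewrite /cexp/= expR0 /circ /cis cos0 sin0 mul1r.
have -> : cexp h - 1 - h =
    (expR (complex.Re h) * cos (complex.Im h) - 1 - complex.Re h) +i*
    (expR (complex.Re h) * sin (complex.Im h) - complex.Im h).
  case: h {hd1 hd2 hd3 hd4 hd5 hd6 hR hI} => s t; rewrite /cexp /circ /cis /=.
  by apply/eqP; rewrite eq_complex/=; apply/andP; split; apply/eqP; ring.
have n0 := normc_ge0 h.
move: (complex.Re h) (complex.Im h) (normc h) hd1 hd2 hd3 hd4 hd5 hd6 hR hI n0.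
move=> s t n hd1 hd2 hd3 hd4 hd5 hd6 hR hI n0.
have := H1 s (le_lt_trans hR hd1); have := H2 t (le_lt_trans hI hd2).
have := H3 t (le_lt_trans hI hd3); have := H4 s (le_lt_trans hR hd4).
rewrite !add0r expR0 sin0 cos0 oppr0 mul0r !subr0 ?addr0 !mul1r => A4 A2 A3 A1.
apply: le_trans (normc_le_ReIm _) _ => /=.
set E := expR s in A1 A4 *; set co := cos t in A2 *; set si := sin t in A3 *.
have E3 : `|E| <= 3.
  have -> : E = (E - 1 - s) + (1 + s) by ring.
  apply: le_trans (ler_normD _ _) _; have : `|1 + s| <= 1 + `|s|.
    by apply: le_trans (ler_normD _ _) _; rewrite normr1.
  by move: A4 hR hd5; lra.
have B1 : `|E * co - 1 - s| <= 3 * (e / 16 * n) + e / 16 * n.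
  have -> : E * co - 1 - s = E * (co - 1) + (E - 1 - s) by ring.
  apply: le_trans (ler_normD _ _) _; apply: lerD.
    rewrite normrM; apply: ler_pM => //; apply: le_trans A2 _.
    by rewrite ler_pM2l ?divr_gt0.
  by apply: le_trans A1 _; rewrite ler_pM2l ?divr_gt0.
have B2 : `|E * si - t| <= 3 * (e / 16 * n) + (2 * n) * (e / 16).
  have -> : E * si - t = E * (si - t) + (E - 1) * t by ring.
  apply: le_trans (ler_normD _ _) _; apply: lerD.
    rewrite normrM; apply: ler_pM => //; apply: le_trans A3 _.
    by rewrite ler_pM2l ?divr_gt0.
  rewrite normrM; apply: ler_pM => //; last by apply: le_trans hI _; exact: ltW.
  have -> : E - 1 = (E - 1 - s) + s by ring.
  by apply: le_trans (ler_normD _ _) _; move: A4 hR; lra.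
have en : 0 <= e * n by rewrite mulr_ge0// ltW.
move: B1 B2 en; clear; lra.
Qed.

Lemma cdiff_cexp z : cdiff cexp z (cexp z).
Proof.
have K : 0 < normc (cexp z) by rewrite normc_cexp expR_gt0.
move=> e e0; have [d d0 H] := cdiff_cexp0 (divr_gt0 e0 K).
exists d => // h hd; have := H h hd; rewrite add0r mul1r.
have E0 : cexp 0 = 1 by rewrite /cexp/= expR0 /circ /cis cos0 sin0 mul1r.
rewrite E0 => H'.
have -> : cexp (z + h) - cexp z - cexp z * h = cexp z * (cexp h - 1 - h).
  by rewrite cexpD; ring.
rewrite normcM mulrC -ler_pdivlMr//; apply: le_trans H' _.
by rewrite mulrAC.
Qed.

(* The Cauchy-Riemann equations: [g dz = (u dx - v dy) + i (v dx + u dy)]. *)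
Lemma cdiff_closed_form (g : C -> C) (x y : R) (m : C) : cdiff g (x +i* y) m ->
  closed_form_at (fun s t => complex.Re (g (s +i* t)))
                 (fun s t => - complex.Im (g (s +i* t))) x y /\
  closed_form_at (fun s t => complex.Im (g (s +i* t)))
                 (fun s t => complex.Re (g (s +i* t))) x y.
Proof.
case: m => a b H.
suff key : forall e, 0 < e -> exists2 d, 0 < d & forall u v, `|u| < d -> `|v| < d ->
    `|complex.Re (g ((x + u) +i* (y + v))) - complex.Re (g (x +i* y)) - (a * u - b * v)|
       <= e * (`|u| + `|v|) /\
    `|complex.Im (g ((x + u) +i* (y + v))) - complex.Im (g (x +i* y)) - (b * u + a * v)|
       <= e * (`|u| + `|v|).
  split.
  - exists a, (- b), (- a) => e e0; have [d d0 Hd] := key e e0.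
    exists d => // u v hu hv; have [A B] := Hd u v hu hv; split.
      by apply: le_trans A; rewrite mulNr.
    apply: le_trans B; rewrite -normrN le_eqVlt; apply/orP; left; apply/eqP.
    by congr `|_|; ring.
  - exists b, a, (- b) => e e0; have [d d0 Hd] := key e e0.
    exists d => // u v hu hv; have [A B] := Hd u v hu hv; split => //.
    by apply: le_trans A; rewrite mulNr.
move=> e e0; have [d d0 Hd] := H e e0.
exists (d / 2); first by rewrite divr_gt0.
move=> u v hu hv.
have nuv : normc (u +i* v) <= `|u| + `|v| := normc_le_ReIm (u +i* v).
have := Hd (u +i* v) ltac:(lra).
set h := g _ - _ - _ => hle.
have E : g (x +i* y + u +i* v) = g ((x + u) +i* (y + v)) by [].
have ReE : complex.Re h = complex.Re (g ((x + u) +i* (y + v))) - complex.Re (g (x +i* y)) - (a * u - b * v).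
  by rewrite /h E; case: (g ((x + u) +i* (y + v))) (g (x +i* y)) => [? ?] [? ?].
have ImE : complex.Im h = complex.Im (g ((x + u) +i* (y + v))) - complex.Im (g (x +i* y)) - (b * u + a * v).
  rewrite /h E; case: (g ((x + u) +i* (y + v))) (g (x +i* y)) => [? ?] [? ?] /=; ring.
rewrite -ReE -ImE; split.
- apply: le_trans (normc_Re h) _; apply: le_trans hle _; by rewrite ler_pM2l.
- apply: le_trans (normc_Im h) _; apply: le_trans hle _; by rewrite ler_pM2l.
Qed.

Definition cint (a b : R) (u : R -> C) : C :=
  seg_int a b (fun t => complex.Re (u t)) +i* seg_int a b (fun t => complex.Im (u t)).

Definition ccont_on (a b : R) (u : R -> C) :=
  cont_on a b (fun t => complex.Re (u t)) /\ cont_on a b (fun t => complex.Im (u t)).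

Lemma cintD a b u v : ccont_on a b u -> ccont_on a b v ->
  cint a b (fun t => u t + v t) = cint a b u + cint a b v.
Proof.
move=> [u1 u2] [v1 v2]; rewrite /cint.
have -> : (fun t => complex.Re (u t + v t)) = (fun t => complex.Re (u t) + complex.Re (v t)).
  by apply/funext => t; case: (u t) (v t) => [? ?] [? ?].
have -> : (fun t => complex.Im (u t + v t)) = (fun t => complex.Im (u t) + complex.Im (v t)).
  by apply/funext => t; case: (u t) (v t) => [? ?] [? ?].
by rewrite !seg_intD.
Qed.

Lemma cont_onD (a b : R) (f g : R -> R) : cont_on a b f -> cont_on a b g ->
  cont_on a b (fun t => f t + g t).
Proof. by move=> cf cg x xab; apply: cvgD; [exact: cf | exact: cg]. Qed.

Lemma cont_onZ (a b k : R) (f : R -> R) : cont_on a b f ->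
  cont_on a b (fun t => k * f t).
Proof. by move=> cf x xab; apply: cvgM; [exact: cvg_cst | exact: cf]. Qed.

Lemma cintZ a b (k : C) u : ccont_on a b u ->
  cint a b (fun t => k * u t) = k * cint a b u.
Proof.
case: k => [k l] [u1 u2]; rewrite /cint.
have -> : (fun t => complex.Re (k +i* l * u t)) = (fun t => k * complex.Re (u t) + (- l) * complex.Im (u t)).
  by apply/funext => t; case: (u t) => [? ?] /=; rewrite mulNr.
have -> : (fun t => complex.Im (k +i* l * u t)) = (fun t => k * complex.Im (u t) + l * complex.Re (u t)).
  by apply/funext => t; case: (u t) => [? ?] /=.
rewrite !seg_intD ?seg_intZ//; try exact: cont_onZ.
by apply/eqP; rewrite eq_complex/= mulNr !eqxx.
Qed.

Lemma ccont_onZ a b (k : C) u : ccont_on a b u -> ccont_on a b (fun t => k * u t).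
Proof.
case: k => [k l] [u1 u2]; split.
- have -> : (fun t => complex.Re (k +i* l * u t)) = (fun t => k * complex.Re (u t) + (- l) * complex.Im (u t)).
    by apply/funext => t; case: (u t) => [? ?] /=; rewrite mulNr.
  by apply: cont_onD; apply: cont_onZ.
- have -> : (fun t => complex.Im (k +i* l * u t)) = (fun t => k * complex.Im (u t) + l * complex.Re (u t)).
    by apply/funext => t; case: (u t) => [? ?] /=.
  by apply: cont_onD; apply: cont_onZ.
Qed.

Lemma ccont_onD a b u v : ccont_on a b u -> ccont_on a b v ->
  ccont_on a b (fun t => u t + v t).
Proof.
move=> [u1 u2] [v1 v2]; split.
- have -> : (fun t => complex.Re (u t + v t)) = (fun t => complex.Re (u t) + complex.Re (v t)).
    by apply/funext => t; case: (u t) (v t) => [? ?] [? ?].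
  exact: cont_onD.
- have -> : (fun t => complex.Im (u t + v t)) = (fun t => complex.Im (u t) + complex.Im (v t)).
    by apply/funext => t; case: (u t) (v t) => [? ?] [? ?].
  exact: cont_onD.
Qed.

Lemma ccont_on_cst a b (k : C) : ccont_on a b (fun=> k).
Proof. by split; exact: cont_on_cst. Qed.

Lemma ccont_on_sum a b N (u : nat -> R -> C) : (forall n, ccont_on a b (u n)) ->
  ccont_on a b (fun t => \sum_(n < N) u n t).
Proof.
move=> cu; elim: N => [|N IH].
  under [X in ccont_on _ _ X]eq_fun do rewrite big_ord0; exact: ccont_on_cst.
by under [X in ccont_on _ _ X]eq_fun do rewrite big_ord_recr/=; exact: ccont_onD.
Qed.

Lemma cint_sum a b N (u : nat -> R -> C) : a <= b -> (forall n, ccont_on a b (u n)) ->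
  cint a b (fun t => \sum_(n < N) u n t) = \sum_(n < N) cint a b (u n).
Proof.
move=> ab cu; elim: N => [|N IH].
  rewrite big_ord0; under [X in cint _ _ X]eq_fun do rewrite big_ord0.
  by rewrite /cint/= seg_int_cst// mul0r.
under [X in cint _ _ X]eq_fun do rewrite big_ord_recr/=.
by rewrite cintD// ?IH ?big_ord_recr//; exact: ccont_on_sum.
Qed.

(** The factor 2 comes from bounding real and imaginary parts separately; it is harmless since the
    bound is used only for quantities that tend to 0. *)
Lemma cint_le a b u (e : R) : a <= b -> ccont_on a b u ->
  (forall t, a <= t <= b -> normc (u t) <= e) -> normc (cint a b u) <= 2 * e * (b - a).
Proof.
move=> ab [c1 c2] H; apply: le_trans (normc_le_ReIm _) _ => /=.
have -> : 2 * e * (b - a) = e * (b - a) + e * (b - a) by ring.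
apply: lerD; apply: seg_int_norm_le => // t /H; apply: le_trans;
  [exact: normc_Re | exact: normc_Im].
Qed.

Lemma cint_ext a b u v : (forall t, a <= t <= b -> u t = v t) -> cint a b u = cint a b v.
Proof. by move=> uv; rewrite /cint; congr (_ +i* _); apply: seg_int_ext => t /uv ->. Qed.

End CircleMean.

Arguments Normc.normc : simpl never.

(** * Integrals over circles centered at 0 and their dependence on the radius *)

Section Cauchy.
Variable R : realType.
Local Notation C := (R[i]^o).
Local Notation normc := (@Normc.normc R).
Implicit Types (G f : C -> C) (z w : C).

Definition ccont G z := forall e : R, 0 < e ->
  exists2 d : R, 0 < d & forall w, normc (w - z) < d -> normc (G w - G z) < e.

Lemma derivable_ccont G z : derivable G z 1 -> ccont G z.
Proof. by move=> /derivable_cdiff/cdiff_continuous. Qed.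

(** Integration is against [dt], that is [dz / (i z)]: in the coordinate [log z] a circle becomes a
    vertical segment. This accounts for the extra factor [z] in the function [G] of
    [holo_expand]. *)
Definition circle_int G r : C := cint 0 (pi *+ 2) (fun t => G (circ r t)).

Let pi2_ge0 : 0 <= pi *+ 2 :> R.
Proof. by rewrite mulrn_wge0// ltW// pi_gt0. Qed.

Lemma circ_near (r0 t0 e : R) : 0 < e -> exists2 d, 0 < d &
  forall r t, `|r - r0| < d -> `|t - t0| < d -> normc (circ r t - circ r0 t0) < e.
Proof.
move=> e0.
have /continuous_epsP/(_ (e / (3 * (`|r0| + 1))))[|d1 d10 H1] := @continuous_cos R t0.
  by rewrite divr_gt0 ?mulr_gt0 ?ltr_wpDl.
have /continuous_epsP/(_ (e / (3 * (`|r0| + 1))))[|d2 d20 H2] := @continuous_sin R t0.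
  by rewrite divr_gt0 ?mulr_gt0 ?ltr_wpDl.
exists (Num.min (e / 3) (Num.min d1 d2)); first by rewrite !lt_min d10 d20 divr_gt0.
move=> r t; rewrite !lt_min => /and3P[r1 _ _] /and3P[_ t1 t2].
have -> : circ r t - circ r0 t0 = (r - r0)%:C * cis t + r0%:C * (cis t - cis t0).
  by rewrite /circ rmorphB/=; ring.
apply: le_lt_trans (normcD _ _) _; rewrite !normcM normc_cis mulr1 !normc_real.
have := H1 _ t1; have := H2 _ t2; rewrite !subrKC => A2 A1.
have B : normc (cis t - cis t0) <= 2 * (e / (3 * (`|r0| + 1))).
  by apply: le_trans (normc_le_ReIm _) _ => /=; lra.
have r00 : 0 <= `|r0| := normr_ge0 _.
have : `|r0| * normc (cis t - cis t0) <= `|r0| * (2 * (e / (3 * (`|r0| + 1)))).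
  by rewrite ler_wpM2l.
have -> : `|r0| * (2 * (e / (3 * (`|r0| + 1)))) = 2 / 3 * e * (`|r0| / (`|r0| + 1)).
  by field; lra.
have : `|r0| / (`|r0| + 1) <= 1 by rewrite ler_pdivrMr ?mul1r ?lerDl// ltr_wpDl.
by move: e0 r1; move: (`|r0| / _) => q; nra.
Qed.

Lemma ccont_circ_on G r : (forall t, ccont G (circ r t)) ->
  ccont_on 0 (pi *+ 2) (fun t => G (circ r t)).
Proof.
move=> cG; split=> t _; apply/continuous_epsP => e e0;
  have [d d0 Hd] := cG t e e0; have [d' d'0 Hd'] := circ_near r t d0;
  exists d' => // u ud.
- apply: le_lt_trans (Hd (circ r (t + u)) _); last first.
    by apply: Hd'; rewrite ?subrr ?normr0// addrC addKr.
  by have := normc_Re (G (circ r (t + u)) - G (circ r t)); rewrite raddfB.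
- apply: le_lt_trans (Hd (circ r (t + u)) _); last first.
    by apply: Hd'; rewrite ?subrr ?normr0// addrC addKr.
  by have := normc_Im (G (circ r (t + u)) - G (circ r t)); rewrite raddfB.
Qed.

(* Goursat's lemma on rectangles in the coordinates [z = exp (s + i t)]. *)
Lemma circle_int_const G (a b r1 r2 : R) : 0 <= a ->
  (forall z, a < normc z -> normc z < b -> derivable G z 1) ->
  a < r1 -> r1 <= r2 -> r2 < b -> circle_int G r1 = circle_int G r2.
Proof.
move=> a0 dG ar1 r12 r2b.
have r10 : 0 < r1 by apply: le_lt_trans ar1.
have r20 : 0 < r2 by apply: lt_le_trans r12.
pose g := G \o (@cexp R).
have lr1 x : ln r1 <= x -> r1 <= expR x by rewrite -ler_expR lnK.
have lr2 x : x <= ln r2 -> expR x <= r2 by rewrite -ler_expR lnK.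
have H x y : ln r1 <= x <= ln r2 -> 0 <= y <= pi *+ 2 ->
    exists m, cdiff g (x +i* y) m.
  move=> /andP[/lr1 x1 /lr2 x2] _.
  have dGz : derivable G (cexp (x +i* y)) 1.
    apply: dG; rewrite normc_cexp/=; first exact: lt_le_trans x1.
    exact: le_lt_trans r2b.
  eexists; apply: cdiff_comp; first exact: cdiff_cexp.
  exact: derivable_cdiff dGz.
have l12 : ln r1 <= ln r2 by rewrite ler_ln.
have per x : g (x +i* 0) = g (x +i* (pi *+ 2)).
  by rewrite /g /cexp /circ /cis/= cos0 sin0 cos2pi sin2pi.
have g1 t r : 0 < r -> g (ln r +i* t) = G (circ r t).
  by move=> r0; rewrite /g /cexp/= lnK.
pose u s t := complex.Re (g (s +i* t)).
pose v s t := complex.Im (g (s +i* t)).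
have A : rect_int u (fun s t => - v s t) (ln r1) (ln r2) 0 (pi *+ 2) = 0.
  apply: goursat => // x y hx hy; have [m hm] := H x y hx hy.
  exact: (cdiff_closed_form hm).1.
have B : rect_int v u (ln r1) (ln r2) 0 (pi *+ 2) = 0.
  apply: goursat => // x y hx hy; have [m hm] := H x y hx hy.
  exact: (cdiff_closed_form hm).2.
(* The sides [t = 0] and [t = 2 pi] of the rectangle carry the same values and cancel; only the two
   circles remain. *)
have zero (F : R -> R -> R) : (forall x, F x 0 = F x (pi *+ 2)) ->
    seg_int (ln r1) (ln r2) (fun t => F t 0 - F t (pi *+ 2)) = 0.
  move=> HF; rewrite (@seg_int_ext _ _ _ _ (fun=> 0)) ?seg_int_cst ?mul0r//.
  by move=> x _; rewrite HF subrr.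
have cg r : 0 < r -> r1 <= r -> r <= r2 -> ccont_on 0 (pi *+ 2) (fun t => G (circ r t)).
  move=> r0 h1 h2; apply: ccont_circ_on => t; apply: derivable_ccont; apply: dG.
    by rewrite normc_circ ?ltW//; apply: lt_le_trans h1.
  by rewrite normc_circ ?ltW//; apply: le_lt_trans r2b.
have [cr1 ci1] := cg r1 r10 (lexx _) r12.
have [cr2 ci2] := cg r2 r20 r12 (lexx _).
move: A B; rewrite /rect_int (zero u) ?(zero v) ?add0r; last 2 first.
- by move=> x; rewrite /v per.
- by move=> x; rewrite /u per.
have uE r t : 0 < r -> u (ln r) t = complex.Re (G (circ r t)) by move=> r0; rewrite /u g1.
have vE r t : 0 < r -> v (ln r) t = complex.Im (G (circ r t)) by move=> r0; rewrite /v g1.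
under seg_int_ext do rewrite !vE//.
under [X in _ -> X = 0 -> _]seg_int_ext do rewrite !uE//.
rewrite seg_intB//; last 2 first.
- by move=> x /ci2 cx; apply: cvgN.
- by move=> x /ci1 cx; apply: cvgN.
move=> A; rewrite seg_intB// => /eqP; rewrite subr_eq0 => /eqP B.
rewrite /circle_int /cint -B; congr (_ +i* _).
have N (f : R -> R) : cont_on 0 (pi *+ 2) f ->
   seg_int 0 (pi *+ 2) (fun t => - f t) = - seg_int 0 (pi *+ 2) f.
  by move=> cf; rewrite -mulN1r -seg_intZ//; apply: seg_int_ext => t _; rewrite mulN1r.
by move: A; rewrite !N// => /eqP; rewrite subr_eq0 eqr_opp => /eqP.
Qed.

Lemma circle_int_le G r e : 0 <= r -> (forall t, ccont G (circ r t)) ->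
  (forall t, normc (G (circ r t)) <= e) -> normc (circle_int G r) <= 4 * pi * e.
Proof.
move=> r0 cG He.
have -> : 4 * pi * e = 2 * e * (pi *+ 2 - 0) by rewrite -mulr_natl; ring.
by apply: cint_le => //; exact: ccont_circ_on.
Qed.

Lemma circle_int_continuous G r0 (a b : R) : 0 <= a -> a < r0 -> r0 < b ->
  (forall z, a < normc z -> normc z < b -> ccont G z) ->
  forall e, 0 < e -> exists2 d, 0 < d & forall r, `|r - r0| < d ->
    normc (circle_int G r - circle_int G r0) <= e.
Proof.
move=> a0 ar rb cG e e0.
have r00 : 0 < r0 by apply: le_lt_trans ar.
pose e' := e / (4 * pi + 1).
have p0 : 0 < (4 * pi + 1 : R) by rewrite ltr_wpDl// mulr_ge0// ltW// pi_gt0.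
have e'0 : 0 < e' by rewrite divr_gt0.
(* Compactness of the interval of angles turns continuity at each point of the circle into closeness
   uniform in the angle. *)
have cov : near_covering (`[0, pi *+ 2] : set R).
  by apply/compact_near_coveringP; exact: segment_compact.
have := cov R (nbhs r0) (fun r t => normc (G (circ r t) - G (circ r0 t)) < e') _.
case.
  move=> t _.
  have cGt : ccont G (circ r0 t) by apply: cG; rewrite normc_circ// ltW.
  have [d d0 Hd] := cGt (e' / 2) (divr_gt0 e'0 (ltr0Sn _ _)).
  have [d' d'0 Hd'] := circ_near r0 t d0.
  exists (ball t d', ball r0 d') => /=.
    by split; apply: nbhsx_ballx.
  case=> t' r [/= + +]; rewrite /ball/= => ht hr.
  have -> : G (circ r t') - G (circ r0 t') = (G (circ r t') - G (circ r0 t)) -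
     (G (circ r0 t') - G (circ r0 t)) by ring.
  apply: le_lt_trans (normcD _ _) _; rewrite normcN.
  have h1 : normc (G (circ r t') - G (circ r0 t)) < e' / 2.
    by apply: Hd; apply: Hd'; rewrite distrC.
  have h2 : normc (G (circ r0 t') - G (circ r0 t)) < e' / 2.
    by apply: Hd; apply: Hd'; rewrite ?subrr ?normr0// distrC.
  lra.
move=> d /= d0 Hd.
exists (Num.min d (Num.min (r0 - a) (b - r0))).
  by rewrite !lt_min d0 !subr_gt0 ar.
move=> r; rewrite !lt_min => /and3P[rd ra rb'].
have {}ra : a < r by move: ra; rewrite ltr_norml; lra.
have {}rb' : r < b by move: rb'; rewrite ltr_norml; lra.
have rge : 0 <= r by apply: le_trans a0 (ltW ra).
have c1 : ccont_on 0 (pi *+ 2) (fun t => G (circ r t)).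
  by apply: ccont_circ_on => t; apply: cG; rewrite normc_circ.
have c2 : ccont_on 0 (pi *+ 2) (fun t => G (circ r0 t)).
  by apply: ccont_circ_on => t; apply: cG; rewrite normc_circ// ltW.
have -> : circle_int G r - circle_int G r0 =
    cint 0 (pi *+ 2) (fun t => G (circ r t) + (-1) * G (circ r0 t)).
  by rewrite cintD ?cintZ// ?mulN1r//; exact: ccont_onZ.
apply: le_trans (@cint_le _ _ _ _ e' _ _ _) _ => //.
- by apply: ccont_onD => //; exact: ccont_onZ.
- move=> t ht; rewrite mulN1r ltW//; apply: (Hd r); last by rewrite /= in_itv.
  by rewrite /ball/= distrC.
- have -> : 2 * e' * (pi *+ 2 - 0) = e * (4 * pi / (4 * pi + 1)).
    by rewrite /e' -[pi *+ 2]mulr_natl; field; rewrite lt0r_neq0 //; move: p0; rewrite ?mulrA; lra.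
  by rewrite ler_piMr ?ltW// ltr_pdivrMr// mul1r ltrDl.
Qed.

(** [rw] is the modulus of the point where the difference quotient of Cauchy's formula is only known
    to be continuous. Below [rw] the integral is constant, hence 0 since it is small for small
    radii; continuity in the radius carries the value 0 to [rw], and then beyond. The case [rw <= 0]
    is the one without an exceptional circle. *)
Lemma circle_int0 G (rho rw : R) :
  (forall z, 0 < normc z -> normc z < rho -> ccont G z) ->
  (forall z, 0 < normc z -> normc z < rho -> normc z != rw -> derivable G z 1) ->
  (forall e, 0 < e -> exists2 d, 0 < d & forall z, 0 < normc z -> normc z < d -> normc (G z) < e) ->
  forall r, 0 < r -> r < rho -> circle_int G r = 0.
Proof.
move=> cG dG G0.
have small (a : R) : 0 < a -> a < rho -> (forall r, 0 < r -> r < a ->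
    circle_int G r = circle_int G a) -> circle_int G a = 0.
  move=> a0 arho H; apply/eqP/negP => /negP; rewrite -normc_gt0 => e0.
  have p0 : 0 < (4 * pi + 1 : R) by rewrite ltr_wpDl// mulr_ge0// ltW// pi_gt0.
  have [d d0 Hd] := G0 _ (divr_gt0 e0 p0).
  pose r := Num.min (a / 2) (d / 2).
  have r0 : 0 < r by rewrite lt_min !divr_gt0.
  have rd : r < d by rewrite gt_min orbC ltr_pdivrMr// ltr_pMr// ltr1n.
  have ra : r < a by rewrite gt_min ltr_pdivrMr// ltr_pMr// ltr1n.
  have := @circle_int_le G r (normc (circle_int G a) / (4 * pi + 1)) (ltW r0).
  rewrite (H r)// => H1.
  have /H1 : forall t, ccont G (circ r t).
    by move=> t; apply: cG; rewrite normc_circ ?ltW//; apply: lt_trans arho.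
  have h : forall t, normc (G (circ r t)) <= normc (circle_int G a) / (4 * pi + 1).
    by move=> t; rewrite ltW//; apply: Hd; rewrite normc_circ// ltW.
  move=> /(_ h); apply/negP; rewrite -ltNge.
  rewrite mulrCA gtr_pMr// ltr_pdivrMr// mul1r ltrDl//.
have below a : 0 < a -> a < rho -> (rw <= 0 \/ a < rw) -> circle_int G a = 0.
  move=> a0 arho arw; apply: small => // r r0 ra.
  have [m am mrho] : exists2 m, a < m & (m <= rho /\ (rw <= 0 \/ m <= rw)).
    case: arw => arw; first by exists rho => //; split => //; left.
    exists (Num.min rho rw); first by rewrite lt_min arho.
    by split; [rewrite ge_min lexx|right; rewrite ge_min lexx orbT].
  apply: (@circle_int_const G 0 m) => //; last exact: ltW.
  move=> z z0 zm; apply: dG => //; first by apply: lt_le_trans zm mrho.1.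
  case: mrho => _ [rw0|mrw]; first by rewrite gt_eqF// (le_lt_trans rw0).
  by rewrite lt_eqF// (lt_le_trans zm).
have at_rw : 0 < rw -> rw < rho -> circle_int G rw = 0.
  move=> rw0 rwrho; apply/eqP/negP => /negP; rewrite -normc_gt0 => e0.
  have [d d0 Hd] := @circle_int_continuous G rw 0 rho (lexx _) rw0 rwrho cG _ (divr_gt0 e0 (ltr0Sn _ 1)).
  pose r := Num.max (rw / 2) (rw - d / 2).
  have r0 : 0 < r by rewrite lt_max divr_gt0.
  have rrw : r < rw.
    by rewrite gt_max ltr_pdivrMr// ltr_pMr// ltr1n/= gtrBl divr_gt0.
  have := Hd r; rewrite below//; [|exact: lt_trans rwrho|by right].
  rewrite sub0r normcN => H.
  have : `|r - rw| < d.
    rewrite ltr_norml; apply/andP; split; last by lra.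
    have : rw - d / 2 <= r by rewrite le_max lexx orbT.
    lra.
  by move=> /H; lra.
move=> r r0 rrho; have [rw0|rw0] := leP rw 0; first by apply: below => //; left.
have [rrw|rwr|E] := ltgtP r rw; first by apply: below => //; right.
- apply/eqP/negP => /negP; rewrite -normc_gt0 => e0.
  have rwrho : rw < rho by apply: lt_trans rrho.
  have [d d0 Hd] := @circle_int_continuous G rw 0 rho (lexx _) rw0 rwrho cG _ (divr_gt0 e0 (ltr0Sn _ 1)).
  pose r' := Num.min r (rw + d / 2).
  have r'rw : rw < r' by rewrite lt_min rwr ltrDl divr_gt0.
  have r'r : r' <= r by rewrite ge_min lexx.
  have := Hd r'; rewrite at_rw// subr0.
  rewrite (@circle_int_const G rw rho r' r)//; last 2 first.
  - exact: ltW.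
  - by move=> z z1 z2; apply: dG => //; [apply: lt_trans z1|rewrite gt_eqF].
  move=> H; have : `|r' - rw| < d.
    rewrite ltr_norml; apply/andP; split; first by lra.
    have : r' <= rw + d / 2 by rewrite ge_min lexx orbT.
    lra.
  by move=> /H; lra.
- by rewrite E at_rw// -E.
Qed.

End Cauchy.

(** * Power series *)

Section PowerSeries.
Variable R : realType.
Local Notation C := (R[i]^o).
Local Notation normc := (@Normc.normc R).
Implicit Types (f : C -> C) (x z w : C) (a : nat -> C).

Lemma cvg_normc_le (T : Type) (F : set_system T) (FF : ProperFilter F) (u : T -> C) (l : C) (B : R) :
  u @ F --> l -> (\forall t \near F, normc (u t) <= B) -> normc l <= B.
Proof.
move=> /cvg_normcP ul uB; apply/ler_addgt0Pr => e e0.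
have [t [h1 h2]] := filter_ex (filterI uB (ul e e0)).
have -> : l = u t - (u t - l) by ring.
by apply: le_trans (normcD _ _) _; rewrite normcN; apply: lerD => //; exact: ltW.
Qed.

Lemma cvg_normc_seqP (u : nat -> C) (l : C) :
  (u @ \oo --> l) <-> forall e : R, 0 < e -> exists N0, forall N, (N0 <= N)%N -> normc (u N - l) < e.
Proof.
split=> [/cvg_normcP H e e0|H].
  by have [N0 _ HN] := H e e0; exists N0 => N /HN.
apply/cvg_normcP => e e0; have [N0 HN] := H e e0.
by exists N0.
Qed.

Lemma cvg_normc_squeeze (u : nat -> C) (l : C) (v : nat -> R) :
  (forall n, normc (u n - l) <= v n) -> v @ \oo --> (0 : R) -> u @ \oo --> l.
Proof.
move=> uv /cvgrPdist_lt v0; apply/cvg_normc_seqP => e e0.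
have [N0 _ HN] := v0 e e0; exists N0 => N /HN /=; rewrite sub0r normrN => H.
apply: le_lt_trans (uv N) _; exact: le_lt_trans (ler_norm _) H.
Qed.

Lemma ccvgB (u v : nat -> C) (l m : C) : u @ \oo --> l -> v @ \oo --> m ->
  (fun n => u n - v n) @ \oo --> l - m.
Proof.
move=> /cvg_normc_seqP ul /cvg_normc_seqP vm; apply/cvg_normc_seqP => e e0.
have [N1 H1] := ul _ (divr_gt0 e0 (ltr0Sn R 1)).
have [N2 H2] := vm _ (divr_gt0 e0 (ltr0Sn R 1)).
exists (maxn N1 N2) => N; rewrite geq_max => /andP[/H1 h1 /H2 h2].
have -> : u N - v N - (l - m) = (u N - l) - (v N - m) by ring.
by apply: le_lt_trans (normcD _ _) _; rewrite normcN; lra.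
Qed.

Lemma ccvgMr (u : nat -> C) (l k : C) : u @ \oo --> l ->
  (fun n => u n * k) @ \oo --> l * k.
Proof.
move=> /cvg_normc_seqP ul; apply/cvg_normc_seqP => e e0.
have k0 : 0 < normc k + 1 by rewrite ltr_wpDl// normc_ge0.
have [N1 H1] := ul _ (divr_gt0 e0 k0).
exists N1 => N /H1; rewrite ltr_pdivlMr// => h.
rewrite -mulrBl normcM; apply: le_lt_trans h.
by rewrite ler_wpM2l ?normc_ge0// lerDl.
Qed.

Lemma ccvg_shiftS (u : nat -> C) (l : C) :
  (fun n => u n.+1) @ \oo --> l <-> u @ \oo --> l.
Proof.
split => /cvg_normc_seqP H; apply/cvg_normc_seqP => e e0;
  have [N0 HN] := H e e0.
- by exists N0.+1 => -[//|N] /HN.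
- by exists N0 => N hN; apply: HN; exact: leqW.
Qed.

Lemma ccvg_cst (l : C) : (fun _ : nat => l) @ \oo --> l.
Proof.
by apply/cvg_normc_seqP => e e0; exists 0%N => N _; rewrite subrr normc0.
Qed.

Lemma ccvg_unique (u : nat -> C) (l m : C) : u @ \oo --> l -> u @ \oo --> m -> l = m.
Proof.
move=> ul um; apply/eqP; rewrite -subr_eq0; apply/negP => /negP lm.
have e0 : 0 < normc (l - m) by rewrite normc_gt0.
have /cvg_normc_seqP/(_ _ e0)[N] := ccvgB ul um.
move=> /(_ N (leqnn N)); rewrite subrr sub0r normcN ltxx//.
Qed.

Lemma cseries_cvg (b : nat -> C) (K q : R) : 0 <= q -> q < 1 ->
  (forall n, normc (b n) <= K * q ^+ n) ->
  exists l : C, (fun N => \sum_(n < N) b n) @ \oo --> l.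
Proof.
move=> q0 q1 bK.
have K0 : 0 <= K by have := le_trans (normc_ge0 _) (bK 0%N); rewrite expr0 mulr1.
have key (c : nat -> R) : (forall n, `|c n| <= K * q ^+ n) ->
    exists l : R, (fun N => \sum_(n < N) c n) @ \oo --> l.
  move=> cK.
  have : cvgn (series c).
    apply: normed_cvg; apply: (@series_le_cvg _ _ (fun n => K * q ^+ n)).
    - by move=> n; exact: normr_ge0.
    - by move=> n; rewrite mulr_ge0// exprn_ge0.
    - exact: cK.
    - by apply: (@is_cvg_geometric_series _ K q); rewrite ger0_norm.
  move=> /cvg_ex[l Hl]; exists l.
  have -> : (fun N => \sum_(n < N) c n) = series c.
    by apply/funext => N; rewrite /series/= big_mkord.
  exact: Hl.
have [l1 /cvgrPdist_lt H1] := key (fun n => complex.Re (b n)) (fun n => le_trans (normc_Re _) (bK n)).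
have [l2 /cvgrPdist_lt H2] := key (fun n => complex.Im (b n)) (fun n => le_trans (normc_Im _) (bK n)).
exists (l1 +i* l2); apply/cvg_normc_seqP => e e0.
have [N1 _ HN1] := H1 _ (divr_gt0 e0 (ltr0Sn R 1)).
have [N2 _ HN2] := H2 _ (divr_gt0 e0 (ltr0Sn R 1)).
exists (maxn N1 N2) => N; rewrite geq_max => /andP[/HN1 /= h1 /HN2 /= h2].
apply: le_lt_trans (normc_le_ReIm _) _.
rewrite !raddfB/= !raddf_sum/= distrC.
by rewrite [X in _ + X]distrC; lra.
Qed.

(** Bernoulli's inequality for the powers of [q^-1 = 1 + (q^-1 - 1)]. *)
Lemma exprn_nat_bound (q : R) : 0 <= q -> q < 1 -> exists K, forall n, n%:R * q ^+ n <= K.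
Proof.
move=> q0 q1; have [->|qn0] := eqVneq q 0.
  exists 1 => n; case: n => [|n]; first by rewrite mul0r.
  by rewrite expr0n mulr0.
have qgt : 0 < q by rewrite lt_def qn0.
have d0 : 0 < q^-1 - 1 by rewrite subr_gt0 invf_gt1.
exists (q^-1 - 1)^-1 => n.
have bern m : 1 + m%:R * (q^-1 - 1) <= q^-1 ^+ m.
  elim: m => [|m IH]; first by rewrite mul0r addr0 expr0.
  rewrite exprS; apply: (@le_trans _ _ (q^-1 * (1 + m%:R * (q^-1 - 1)))); last first.
    by rewrite ler_wpM2l// invr_ge0.
  rewrite -natr1; have m0 : 0 <= m%:R :> R by [].
  have -> : q^-1 * (1 + m%:R * (q^-1 - 1)) =
     1 + (m%:R + 1) * (q^-1 - 1) + m%:R * (q^-1 - 1) ^+ 2 by ring.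
  by rewrite lerDl mulr_ge0// sqr_ge0.
have := bern n; rewrite exprVn => H.
rewrite -ler_pdivlMr ?exprn_gt0// -ler_pdivrMl ?invr_gt0// invrK.
by rewrite mulrC; apply: le_trans H; rewrite lerDr.
Qed.

(** With [t] the fourth root of [q], each factor [n] is absorbed by one [t ^+ n], and
    [p ^+ n = (t ^+ n) ^+ 2] is left over as geometric decay. *)
Lemma exprn_nat2_bound (q : R) : 0 <= q -> q < 1 ->
  exists K p, [/\ 0 <= p, p < 1, 0 <= K & forall n, n%:R ^+ 2 * q ^+ n <= K * p ^+ n].
Proof.
move=> q0 q1.
have s1 (y : R) : 0 <= y -> y < 1 -> [/\ 0 <= Num.sqrt y, Num.sqrt y < 1 & y = Num.sqrt y ^+ 2].
  by move=> y0 y1; rewrite sqrtr_ge0 sqr_sqrtr// -[X in _ < X]sqrtr1 ltr_sqrt.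
have [p0 p1 qE] := s1 q q0 q1; set p := Num.sqrt q in p0 p1 qE.
have [t0 t1 pE] := s1 p p0 p1; set t := Num.sqrt p in t0 t1 pE.
have [K HK] := exprn_nat_bound t0 t1.
exists (K ^+ 2), p; split=> //; first exact: sqr_ge0.
move=> n.
have A : (t ^+ n) ^+ 2 = p ^+ n by rewrite [in RHS]pE -!exprM mulnC.
have B : q ^+ n = p ^+ n * p ^+ n by rewrite [in LHS]qE -exprM mulnC exprM expr2.
have -> : n%:R ^+ 2 * q ^+ n = (n%:R * t ^+ n) ^+ 2 * p ^+ n.
  by rewrite B exprMn A mulrA.
by rewrite ler_wpM2r ?exprn_ge0// lerXn2r// nnegrE ?mulr_ge0 ?exprn_ge0//;
  apply: le_trans (HK 0%N); rewrite mul0r.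
Qed.

Lemma sum_nat2_bound (q : R) : 0 <= q -> q < 1 ->
  exists2 B, 0 <= B & forall N, \sum_(n < N) n%:R ^+ 2 * q ^+ n <= B.
Proof.
move=> q0 q1; have [K [p [p0 p1 K0 H]]] := exprn_nat2_bound q0 q1.
exists (K / (1 - p)); first by rewrite divr_ge0// subr_ge0 ltW.
move=> N; apply: (@le_trans _ _ (\sum_(n < N) K * p ^+ n)); first exact: ler_sum.
rewrite -mulr_sumr ler_wpM2l//.
rewrite -[X in _ <= X]mul1r ler_pdivlMr ?subr_gt0//.
by rewrite mulrC -opprB mulNr -subrX1 opprB gerBl exprn_ge0.
Qed.

Definition psum a w (N : nat) : C := \sum_(n < N) a n * w ^+ n.

Definition pser f x (r : R) a := forall w, normc w < r -> psum a w @ \oo --> f (x + w).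

(** A term is the difference of two consecutive partial sums, hence at most 2 once both are within 1
    of the limit; the earlier terms are dominated by their sum. *)
Lemma pser_bound f x r a r' : pser f x r a -> 0 <= r' -> r' < r ->
  exists K, forall n, normc (a n) * r' ^+ n <= K.
Proof.
move=> H r0 r1.
have /H/cvg_normc_seqP/(_ 1 ltr01)[N0 HN] : normc (r'%:C) < r by rewrite normc_real ger0_norm.
have T n : normc (a n) * r' ^+ n = normc (psum a r'%:C n.+1 - psum a r'%:C n).
  by rewrite /psum big_ord_recr/= [X in X - _]addrC addrK normcM normcX normc_real ger0_norm.
exists (2 + \sum_(n < N0) normc (a n) * r' ^+ n) => n.
have S0 M : 0 <= \sum_(n < M) normc (a n) * r' ^+ n.
  by apply: sumr_ge0 => i _; rewrite mulr_ge0 ?exprn_ge0// normc_ge0.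
have [nN|nN] := ltnP n N0.
  rewrite (bigD1 (Ordinal nN))//= addrCA lerDl addr_ge0//.
  by apply: sumr_ge0 => i _; rewrite mulr_ge0 ?exprn_ge0// normc_ge0.
apply: (@le_trans _ _ 2); last by rewrite lerDl.
rewrite T; set l := f _ in HN.
have -> : psum a r'%:C n.+1 - psum a r'%:C n =
  (psum a r'%:C n.+1 - l) - (psum a r'%:C n - l) by ring.
apply: le_trans (normcD _ _) _; rewrite normcN.
by have := HN _ nN; have := HN _ (leqW nN); lra.
Qed.

(** The second-order remainder of a power, multiplied by [s ^+ 2] so that the exponent [n - 2] does
    not occur. Passing from [n] to [n.+1] multiplies the remainder by [w + h] and adds
    [n w^(n-1) h^2]. *)
Lemma expr_remainder (w h : C) (s : R) n : normc w <= s -> normc (w + h) <= s ->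
  s ^+ 2 * normc ((w + h) ^+ n - w ^+ n - n%:R * w ^+ n.-1 * h) <=
  n%:R ^+ 2 * s ^+ n * normc h ^+ 2.
Proof.
move=> ws whs; have s0 : 0 <= s by apply: le_trans ws; exact: normc_ge0.
elim: n => [|n IH]; first by rewrite !mul0r subrr subr0 normc0 mulr0 expr0n/= !mul0r.
have -> : (w + h) ^+ n.+1 - w ^+ n.+1 - n.+1%:R * w ^+ n.+1.-1 * h =
   (w + h) * ((w + h) ^+ n - w ^+ n - n%:R * w ^+ n.-1 * h) + n%:R * w ^+ n.-1 * h ^+ 2.
  case: n {IH} => [|n]; first by rewrite !expr0 expr1 !mul0r; ring.
  by rewrite !exprS -natr1 /=; ring.
apply: (@le_trans _ _ (s ^+ 2 * (s * normc ((w + h) ^+ n - w ^+ n - n%:R * w ^+ n.-1 * h) +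
    n%:R * s ^+ n.-1 * normc h ^+ 2))).
  rewrite ler_wpM2l ?sqr_ge0//; apply: le_trans (normcD _ _) _.
  rewrite !normcM; apply: lerD; first by rewrite ler_wpM2r// normc_ge0.
  rewrite normc_nat !normcX ler_wpM2r ?sqr_ge0// ler_wpM2l//.
  by rewrite lerXn2r// nnegrE normc_ge0.
have h0 := sqr_ge0 (normc h).
have E : s ^+ 2 * (n%:R * s ^+ n.-1 * normc h ^+ 2) = n%:R * s ^+ n.+1 * normc h ^+ 2.
  case: n {IH} => [|n]; first by rewrite !mul0r mulr0.
  by rewrite !exprS /=; ring.
rewrite mulrDr E mulrCA.
apply: (@le_trans _ _ (s * (n%:R ^+ 2 * s ^+ n * normc h ^+ 2) + n%:R * s ^+ n.+1 * normc h ^+ 2)).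
  by rewrite lerD2r ler_wpM2l.
rewrite -subr_ge0.
have -> : n.+1%:R ^+ 2 * s ^+ n.+1 * normc h ^+ 2 -
  (s * (n%:R ^+ 2 * s ^+ n * normc h ^+ 2) + n%:R * s ^+ n.+1 * normc h ^+ 2) =
  (n%:R + 1) * s ^+ n.+1 * normc h ^+ 2 by rewrite -natr1 [s ^+ n.+1]exprS; ring.
by apply: mulr_ge0 => //; apply: mulr_ge0; rewrite ?exprn_ge0 ?addr_ge0.
Qed.

(** The remainders of the monomials add up to at most [M * normc h ^+ 2], uniformly in the number of
    terms. This holds because [normc (a n) * s ^+ n] decays like the powers of [s / s1], where [s1]
    lies between [s] and [r], and [s] exceeds [normc w] to leave room for [h]. *)
Lemma pser_diff f x r a w : pser f x r a -> normc w < r ->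
  exists2 l : C, psum (fun n => n.+1%:R * a n.+1) w @ \oo --> l & cdiff f (x + w) l.
Proof.
move=> H wr; have w0 := normc_ge0 w.
pose s := (normc w + r) / 2; pose s1 := (s + r) / 2.
have ws : normc w < s by rewrite /s; lra.
have ss1 : s < s1 by rewrite /s1 /s; lra.
have s1r : s1 < r by rewrite /s1 /s; lra.
have s0 : 0 < s by apply: le_lt_trans ws.
have s10 : 0 < s1 by apply: lt_trans ss1.
have [K HK] := pser_bound H (ltW s10) s1r.
have K0 : 0 <= K by have := HK 0%N; rewrite expr0 mulr1; apply: le_trans; exact: normc_ge0.
have q0 : 0 <= s / s1 by rewrite divr_ge0// ltW.
have q1 : s / s1 < 1 by rewrite ltr_pdivrMr// mul1r.
have aK n : normc (a n) * s ^+ n <= K * (s / s1) ^+ n.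
  have -> : normc (a n) * s ^+ n = normc (a n) * s1 ^+ n * (s / s1) ^+ n.
    by rewrite -mulrA -exprMn; congr (_ * _ ^+ _); field; rewrite gt_eqF.
  by rewrite ler_wpM2r// exprn_ge0.
have [l Hl] : exists l : C, psum (fun n => n.+1%:R * a n.+1) w @ \oo --> l.
  have [K' [p [p0 p1 K'0 Hp]]] := exprn_nat2_bound q0 q1.
  apply: (@cseries_cvg (fun n => n.+1%:R * a n.+1 * w ^+ n) (K * K' * p / s) p) => // n.
  rewrite !normcM normc_nat normcX.
  have -> : K * K' * p / s * p ^+ n = K * (K' * p ^+ n.+1) / s by rewrite exprS; ring.
  rewrite ler_pdivlMr//.
  apply: (@le_trans _ _ (n.+1%:R * (normc (a n.+1) * s ^+ n.+1))).
    rewrite -!mulrA ler_wpM2l// ler_wpM2l ?normc_ge0// exprSr.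
    apply: ler_wpM2r; first exact: ltW.
    by rewrite lerXn2r// ?nnegrE ?normc_ge0 ltW.
  apply: (@le_trans _ _ (n.+1%:R * (K * (s / s1) ^+ n.+1))); first by rewrite ler_wpM2l.
  rewrite mulrCA ler_wpM2l//; apply: le_trans (Hp n.+1).
  by rewrite ler_wpM2r ?exprn_ge0// expr2 ler_peMr// ler1n.
exists l => //.
have [B B0 HB] := sum_nat2_bound q0 q1.
pose M := K * B / s ^+ 2.
have M0 : 0 <= M by rewrite divr_ge0 ?sqr_ge0// mulr_ge0.
have main h : normc h < s - normc w ->
    normc (f (x + w + h) - f (x + w) - l * h) <= M * normc h ^+ 2.
  move=> hs; have whs : normc (w + h) < s by have := normcD w h; lra.
  have c1 : psum a (w + h) @ \oo --> f (x + w + h).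
    by rewrite -addrA; apply: H; lra.
  have c2 : psum a w @ \oo --> f (x + w) by apply: H.
  (* The derivative of a partial sum with [N] terms has [N.-1] terms, hence the shift. *)
  have c3 : (fun N => psum a (w + h) N - psum a w N - psum (fun n => n.+1%:R * a n.+1) w N.-1 * h) @ \oo
      --> f (x + w + h) - f (x + w) - l * h.
    apply: ccvgB; first exact: ccvgB.
    by apply: ccvgMr; apply/ccvg_shiftS; exact: Hl.
  apply: (cvg_normc_le _ c3); exists 1%N => // -[//|N] _ /=.
  have -> : psum a (w + h) N.+1 - psum a w N.+1 - psum (fun n => n.+1%:R * a n.+1) w N * h
     = \sum_(n < N.+1) a n * ((w + h) ^+ n - w ^+ n - n%:R * w ^+ n.-1 * h).
    rewrite /psum [RHS](eq_bigr (fun n : 'I_N.+1 => a n * (w + h) ^+ n - a n * w ^+ n -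
      a n * (n%:R * w ^+ n.-1 * h))); last by move=> i _; rewrite !mulrBr.
    rewrite !sumrB; congr (_ - _ - _).
    rewrite [RHS]big_ord_recl/= !mul0r mulr0 add0r mulr_suml; apply: eq_bigr => i _.
    by rewrite /bump/= add1n; ring.
  apply: le_trans (normc_sum _ _ _) _.
  have -> : M * normc h ^+ 2 = normc h ^+ 2 * (K * B) / s ^+ 2 by rewrite /M; ring.
  rewrite ler_pdivlMr ?exprn_gt0// mulr_suml.
  apply: (@le_trans _ _ (\sum_(n < N.+1) normc h ^+ 2 * (K * (n%:R ^+ 2 * (s / s1) ^+ n)))); last first.
    by rewrite -mulr_sumr -mulr_sumr ler_wpM2l ?sqr_ge0// ler_wpM2l.
  apply: ler_sum => n _; rewrite normcM -[X in X <= _]mulrA (mulrC _ (s ^+ 2)).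
  apply: (@le_trans _ _ (normc (a n) * (n%:R ^+ 2 * s ^+ n * normc h ^+ 2))).
    by rewrite ler_wpM2l ?normc_ge0//; apply: expr_remainder; exact: ltW.
  have -> : normc (a n) * (n%:R ^+ 2 * s ^+ n * normc h ^+ 2) =
    normc h ^+ 2 * (n%:R ^+ 2 * (normc (a n) * s ^+ n)) by ring.
  by rewrite ler_wpM2l ?sqr_ge0// [X in _ <= X]mulrCA ler_wpM2l ?sqr_ge0.
move=> e e0; exists (Num.min (s - normc w) (e / (M + 1))).
  by rewrite lt_min subr_gt0 ws divr_gt0// ltr_wpDl.
move=> h; rewrite lt_min => /andP[h1 h2]; apply: le_trans (main h h1) _.
rewrite ltr_pdivlMr ?ltr_wpDl// in h2.
have h0 := normc_ge0 h.
by rewrite expr2 mulrA ler_wpM2r//; lra.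
Qed.

Lemma pser_derive1 f x r a : pser f x r a ->
  pser (derive1 f) x r (fun n => n.+1%:R * a n.+1).
Proof.
move=> H w wr; have [l Hl /cdiff_derive1 ->] := pser_diff H wr.
exact: Hl.
Qed.

Lemma pser_derivable f x r a w : pser f x r a -> normc w < r -> derivable f (x + w) 1.
Proof. by move=> H /(pser_diff H)[l _ /cdiff_derivable]. Qed.

Lemma factr_neq0 n : n`!%:R != 0 :> C.
Proof. by rewrite pnatr_eq0 -lt0n fact_gt0. Qed.

Lemma pser_derive1n k f x r a : pser f x r a ->
  pser (derive1n k f) x r (fun n => ((n + k)`!%:R / n`!%:R) * a (n + k)%N).
Proof.
move=> H; elim: k => [|k IH].
  have -> : (fun n => ((n + 0)`!%:R / n`!%:R) * a (n + 0)%N) = a; last exact: H.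
  apply/funext => i; rewrite addn0 divff ?mul1r//; exact: factr_neq0.
rewrite derive1nS.
have -> : (fun n => ((n + k.+1)`!%:R / n`!%:R) * a (n + k.+1)%N) =
    fun n => n.+1%:R * (((n.+1 + k)`!%:R / n.+1`!%:R) * a (n.+1 + k)%N).
  apply/funext => i; rewrite addSnnS mulrA; congr (_ * _).
  have i0 := factr_neq0 i; have i1 : i.+1%:R != 0 :> C by rewrite pnatr_eq0.
  have gen (p q F : C) : p != 0 -> F / q = p * (F / (p * q)).
    by move=> p0; rewrite invfM mulrCA mulVKf.
  by rewrite [i.+1`!]factS natrM -gen.
exact: (pser_derive1 IH).
Qed.

Lemma psum0 a N : psum a 0 N.+1 = a 0%N.
Proof.
rewrite /psum big_ord_recl expr0 mulr1 big1 ?addr0// => i _.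
by rewrite expr0n/= mulr0.
Qed.

Lemma pser0 f x r a : 0 < r -> pser f x r a -> f x = a 0%N.
Proof.
move=> r0 H; have := H 0; rewrite normc0 addr0 => /(_ r0) c.
apply: (ccvg_unique c); apply/ccvg_shiftS.
have -> : (fun n => psum a 0 n.+1) = fun=> a 0%N.
  by apply/funext => n /=; rewrite psum0.
exact: ccvg_cst.
Qed.

Lemma pser_coef f x r a n : 0 < r -> pser f x r a -> derive1n n f x = n`!%:R * a n.
Proof.
by move=> r0 /(@pser_derive1n n)/(pser0 r0) ->; rewrite add0n fact0 divr1.
Qed.

Lemma pser_eq_derive f x r a : 0 < r -> pser f x r a ->
  a = fun n => derive1n n f x / n`!%:R.
Proof.
move=> r0 H; apply/funext => n; rewrite (@pser_coef f x r a n r0 H) mulrC mulKf//; exact: factr_neq0.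
Qed.

End PowerSeries.

(** * Taylor series of holomorphic functions *)

Section Taylor.
Variable R : realType.
Local Notation C := (R[i]^o).
Local Notation normc := (@Normc.normc R).
Implicit Types (f : C -> C) (x z w : C) (a : nat -> C).

Let pi2_ge0 : 0 <= pi *+ 2 :> R.
Proof. by rewrite mulrn_wge0// ltW// pi_gt0. Qed.

Lemma cont_on_bounded (a b : R) (g : R -> R) : a <= b -> cont_on a b g ->
  exists M, forall t, a <= t <= b -> `|g t| <= M.
Proof.
move=> ab cg.
have cn : cont_on a b (fun t => `|g t|).
  by move=> t ht; apply: cvg_norm; exact: cg.
have [c _ Hc] := EVT_max ab (cont_on_within cn).
by exists `|g c| => t ht; apply: Hc; rewrite in_itv.
Qed.

Lemma ccont_on_bounded (a b : R) (u : R -> C) : a <= b -> ccont_on a b u ->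
  exists M, forall t, a <= t <= b -> normc (u t) <= M.
Proof.
move=> ab [/(cont_on_bounded ab)[M1 H1] /(cont_on_bounded ab)[M2 H2]].
exists (M1 + M2) => t ht; apply: le_trans (normc_le_ReIm _) _.
by apply: lerD; [exact: H1 | exact: H2].
Qed.

Lemma normc_neq0 z : 0 < normc z -> z != 0.
Proof. by rewrite normc_gt0. Qed.

Lemma derivable_expV n z : z != 0 -> derivable (fun z : C => (z ^+ n)^-1 : C) z 1.
Proof.
move=> z0; apply: derivableV; first by rewrite expf_neq0.
exact: exprn_derivable.
Qed.

(** For a positive exponent the integral scales like [r ^- n.+1] and yet, by [circle_int_const],
    does not depend on the radius; comparing the radii 1 and 2 leaves only the value 0. *)
Lemma circle_int_expV n (r : R) : 0 < r ->
  circle_int (fun z : C => (z ^+ n)^-1) r = if n is 0%N then (pi *+ 2)%:C else 0.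
Proof.
move=> r0; case: n => [|n].
  rewrite /circle_int /cint.
  have -> : (fun t : R => complex.Re (((circ r t) ^+ 0)^-1)) = fun=> 1.
    by apply/funext => t; rewrite expr0 invr1.
  have -> : (fun t : R => complex.Im (((circ r t) ^+ 0)^-1)) = fun=> 0.
    by apply/funext => t; rewrite expr0 invr1.
  by rewrite !seg_int_cst// subr0 mul1r mul0r.
have dG z : 0 < normc z -> derivable (fun z : C => (z ^+ n.+1)^-1 : C) z 1.
  by move=> /normc_neq0/derivable_expV; exact.
have E s : 0 < s -> circle_int (fun z : C => (z ^+ n.+1)^-1) s =
    (s ^- n.+1)%:C * circle_int (fun z : C => (z ^+ n.+1)^-1) 1.
  move=> s0; rewrite /circle_int -cintZ; last first.
    apply: (@ccont_circ_on _ (fun z : C => (z ^+ n.+1)^-1)) => t.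
    by apply: derivable_ccont; apply: dG; rewrite normc_circ.
  apply: cint_ext => t _; rewrite /circ mul1r exprMn invfM; congr (_ * _).
  by rewrite fmorphV rmorphXn.
have H : circle_int (fun z : C => (z ^+ n.+1)^-1) 1 = circle_int (fun z : C => (z ^+ n.+1)^-1) 2.
  apply: (@circle_int_const _ _ 0 3) => //.
  - by move=> z z0 _; exact: dG.
  - by rewrite ler1n.
  - by rewrite ltr_nat.
have := E 2 ltac:(lra); rewrite -H.
set c := circle_int _ 1 => cE.
suff -> : circle_int (fun z : C => (z ^+ n.+1)^-1) r = 0 by [].
rewrite (E r r0) -/c.
have -> : c = 0; last by rewrite mulr0.
apply/eqP; apply/negP => /negP c0.
have k1 : 2 ^- n.+1 < 1 :> R.
  have h : 0 < 2 ^+ n.+1 :> R by apply: exprn_gt0.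
  rewrite invf_lt1; last exact: h.
  by rewrite (exprn_egt1 n.+1 (_ : 1 < 2)) ?ltr1n.
move: k1 cE; set k := 2 ^- n.+1; clearbody k => k1 cE.
have : (k%:C : C) - 1 = 0.
  apply/eqP; move: c0; apply: contraNT => k0; apply/eqP.
  by apply: (mulfI k0); rewrite mulr0 mulrBl mul1r -cE subrr.
move=> /(congr1 (@complex.Re R)) /= /eqP; rewrite subr_eq0.
by rewrite lt_eqF.
Qed.

(** Cauchy's argument with an explicit remainder: the mean of [z (f z - f w) / (z - w)] over the
    circle vanishes, and expanding [z / (z - w)] in powers of [w / z] turns this into the
    convergence of a power series in [w]. *)
Theorem holo_expand f (rho r : R) : 0 < r -> r < rho ->
  (forall z, normc z < rho -> derivable f z 1) ->
  exists a, pser f 0 r a.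
Proof.
move=> r0 rrho df.
pose A n := circle_int (fun z : C => f z * (z ^+ n)^-1) r.
have pi0 : (pi *+ 2)%:C != 0 :> C.
  by rewrite -normc_gt0 normc_real normr_gt0 gt_eqF// mulrn_wgt0// pi_gt0.
exists (fun n => A n / (pi *+ 2)%:C) => w wr; rewrite add0r.
pose l := derive1 f w.
(* The value [w * l] at [w] is the one that makes [G] continuous there; differentiability at [w] is
   not claimed, which is why [circle_int0] allows an exceptional circle. *)
pose G z := if z == w then w * l else z * ((f z - f w) / (z - w)).
have wrho : normc w < rho by apply: lt_trans rrho.
have dfw : cdiff f w l by apply: derivable_cdiff; exact: df.
have dG z : normc z < rho -> z != w -> derivable G z 1.
  move=> zr zw.
  have zw0 : 0 < normc (z - w) by rewrite normc_gt0 subr_eq0.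
  have dH : derivable (fun z : C => z * ((f z - f w) / (z - w)) : C) z 1.
    apply: derivableM; first exact: derivable_id.
    apply: derivableM.
      apply: derivableB; first exact: df.
      exact: derivable_cst.
    apply: derivableV; first by rewrite subr_eq0.
    apply: derivableB; first exact: derivable_id.
    exact: derivable_cst.
  apply: cdiff_derivable; apply: (@cdiff_near _ _ _ _ _ (normc (z - w))); last exact: (derivable_cdiff dH).
    by [].
  move=> u uz; rewrite /G ifN//; apply: contraTneq uz => ->.
  by rewrite normcB ltxx.
have cG z : normc z < rho -> ccont G z.
  move=> zr; have [zw|zw] := eqVneq z w; last by apply: derivable_ccont; exact: dG.
  rewrite {}zw {z zr} => e e0.
  have K0 : 0 < normc w + normc l + 2.
    by have := normc_ge0 w; have := normc_ge0 l; lra.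
  have [d d0 Hd] := dfw _ (divr_gt0 e0 K0).
  exists (Num.min d (Num.min 1 (e / (normc w + normc l + 2)))).
    by rewrite !lt_min d0 ltr01 divr_gt0.
  move=> z; rewrite !lt_min => /and3P[zd z1 ze].
  have [->|zw] := eqVneq z w; first by rewrite subrr normc0.
  rewrite /G eqxx ifN//.
  have zw0 : 0 < normc (z - w) by rewrite normc_gt0 subr_eq0.
  have -> : z * ((f z - f w) / (z - w)) - w * l =
    z * ((f z - f w - l * (z - w)) / (z - w)) + (z - w) * l.
    by field; rewrite subr_eq0.
  apply: le_lt_trans (normcD _ _) _; rewrite !normcM normcV.
  have := Hd _ zd; rewrite subrKC => B.
  have {}B : normc (f z - f w - l * (z - w)) / normc (z - w) <= e / (normc w + normc l + 2).
    by rewrite ler_pdivrMr.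
  have zn : normc z <= normc w + 1.
    have -> : z = w + (z - w) by rewrite subrKC.
    by apply: le_trans (normcD _ _) _; rewrite lerD2l ltW.
  have l0 := normc_ge0 l; have zz0 := normc_ge0 z; have w0 := normc_ge0 w.
  have e'0 : 0 <= e / (normc w + normc l + 2) by rewrite divr_ge0// ltW.
  apply: (@le_lt_trans _ _ ((normc w + 1) * (e / (normc w + normc l + 2)) + (e / (normc w + normc l + 2)) * normc l)).
    apply: lerD; last by rewrite ler_wpM2r// ltW.
    by apply: ler_pM => //; rewrite divr_ge0// normc_ge0.
  have -> : (normc w + 1) * (e / (normc w + normc l + 2)) + (e / (normc w + normc l + 2)) * normc l =
    e * ((normc w + normc l + 1) / (normc w + normc l + 2)) by ring.
  rewrite gtr_pMr// ltr_pdivrMr//; lra.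
pose G' z := if z == 0 then 0 else G z.
have G0 : circle_int G r = 0.
  apply: (@circle_int0 _ G rho (normc w)) => //.
  - by move=> z _; exact: cG.
  - move=> z z0 zr zw; apply: dG => //; apply: contra zw => /eqP ->//.
  (* Smallness near 0: for [w = 0] the function is [f z - f 0], otherwise the factor [z] makes
     [G 0 = 0]. *)
  - move=> e e0; have [w0|w0] := eqVneq w 0.
      have [d d0 Hd] := cdiff_continuous dfw e0.
      exists d => // z z0 zd; rewrite /G ifN; last by rewrite w0 -normc_gt0.
      rewrite w0 subr0 mulrC divfK -?normc_gt0//.
      by rewrite -w0; apply: Hd; rewrite w0 subr0.
    have rho0 : 0 < rho by exact: lt_trans rrho.
    have [d d0 Hd] := cG 0 ltac:(by rewrite normc0) e e0.
    exists d => // z z0 zd; have := Hd z; rewrite subr0 => /(_ zd).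
    by rewrite {2}/G eq_sym (negbTE w0) mul0r subr0.
have czr t : normc (circ r t) = r by rewrite normc_circ// ltW.
have cz0 t : circ r t != 0 by rewrite -normc_gt0 czr.
have czw t : circ r t != w.
  by apply: contraTneq wr => <-; rewrite czr ltxx.
have cGc : ccont_on 0 (pi *+ 2) (fun t => G (circ r t)).
  by apply: ccont_circ_on => t; apply: cG; rewrite czr.
have [M HM] := ccont_on_bounded pi2_ge0 cGc.
have cT n : ccont_on 0 (pi *+ 2) (fun t => f (circ r t) * (circ r t ^+ n)^-1).
  apply: (@ccont_circ_on _ (fun z => f z * (z ^+ n)^-1)) => t; apply: derivable_ccont.
  apply: derivableM; first by apply: df; rewrite czr.
  exact: derivable_expV.
have cE n : ccont_on 0 (pi *+ 2) (fun t => (circ r t ^+ n)^-1).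
  by apply: (@ccont_circ_on _ (fun z => (z ^+ n)^-1)) => t; apply: derivable_ccont; apply: derivable_expV.
have cGE N : ccont_on 0 (pi *+ 2) (fun t => G (circ r t) * (circ r t ^+ N)^-1).
  apply: (@ccont_circ_on _ (fun z => G z * (z ^+ N)^-1)) => t; apply: derivable_ccont.
  apply: derivableM; first by apply: dG; rewrite ?czr.
  exact: derivable_expV.
(* From [z / (z - w)], written as the sum of [(w / z) ^+ n] for [n <= N] plus
   [(w / z) ^+ N.+1 * z / (z - w)]. After integration the terms in [f w] vanish except for
   [n = 0]. *)
have key N : psum (fun n => A n / (pi *+ 2)%:C) w N.+1 - f w =
    - ((w ^+ N.+1 / (pi *+ 2)%:C) * circle_int (fun z => G z * (z ^+ N.+1)^-1) r).
  pose T n t : C := f (circ r t) * (circ r t ^+ n)^-1.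
  pose E n t : C := (circ r t ^+ n)^-1.
  pose U n t : C := w ^+ n * (T n t + (- f w) * E n t).
  pose V t : C := G (circ r t) * (circ r t ^+ N.+1)^-1.
  have cTE n : ccont_on 0 (pi *+ 2) (fun t => T n t + (- f w) * E n t).
    by apply: (@ccont_onD _ _ _ (T n) (fun t => (- f w) * E n t)); [exact: cT|apply: ccont_onZ; exact: cE].
  have cU n : ccont_on 0 (pi *+ 2) (U n).
    by apply: ccont_onZ; exact: cTE.
  have cV : ccont_on 0 (pi *+ 2) V by exact: cGE.
  have := G0; rewrite /circle_int.
  rewrite (@cint_ext _ _ _ _ (fun t => \sum_(n < N.+1) U n t + w ^+ N.+1 * V t)); last first.
    rewrite /U /V /T /E.
    move=> t _; move: (cz0 t) (czw t); move: (circ r t) => z z0 zw.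
    rewrite (eq_bigr (fun n : 'I_N.+1 => (f z - f w) * (w / z) ^+ n)); last first.
      by move=> i _; rewrite exprMn exprVn; ring.
    rewrite -mulr_sumr /G (negbTE zw).
    have q1 : w / z - 1 != 0.
      by rewrite subr_eq0; apply: contra zw => /eqP E1; rewrite -[w](divfK z0) E1 mul1r.
    have -> : \sum_(n < N.+1) (w / z) ^+ n = ((w / z) ^+ N.+1 - 1) / (w / z - 1).
      by rewrite subrX1 mulrAC divff// mul1r.
    rewrite exprMn exprVn.
    field.
    rewrite ?z0 ?subr_eq0 ?zw ?expf_neq0 //= ?mulN1r ?subr_eq0 ?[w == z]eq_sym ?zw //.
  rewrite (@cintD _ _ _ (fun t => \sum_(n < N.+1) U n t) (fun t => w ^+ N.+1 * V t)); last 2 first.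
  - exact: ccont_on_sum.
  - exact: ccont_onZ.
  rewrite cint_sum// (@cintZ _ _ _ _ V)//.
  have S : \sum_(n < N.+1) cint 0 (pi *+ 2) (U n) =
     \sum_(n < N.+1) w ^+ n * A n - f w * (pi *+ 2)%:C.
    transitivity (\sum_(n < N.+1) (w ^+ n * A n - w ^+ n * (f w * circle_int (fun z => (z ^+ n)^-1) r))).
      apply: eq_bigr => n _; rewrite /U (@cintZ _ _ _ _ (fun t => T n t + (- f w) * E n t))//.
      rewrite (@cintD _ _ _ (T n) (fun t => (- f w) * E n t)) ?(@cintZ _ _ _ _ (E n))//; last 3 first.
      - exact: cE.
      - exact: cT.
      - by apply: ccont_onZ; exact: cE.
      by rewrite /A /circle_int mulNr mulrBr.
    rewrite sumrB; congr (_ - _).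
    rewrite big_ord_recl circle_int_expV// expr0 mul1r big1 ?addr0// => i _.
    by rewrite circle_int_expV//= !mulr0.
  rewrite S => /eqP; rewrite addr_eq0 subr_eq => /eqP EE.
  have -> : psum (fun n => A n / (pi *+ 2)%:C) w N.+1 = (\sum_(n < N.+1) w ^+ n * A n) / (pi *+ 2)%:C.
    by rewrite /psum mulr_suml; apply: eq_bigr => i _; ring.
  by rewrite EE mulrDl mulfK// addrK mulNr [in RHS]mulrAC.
apply/ccvg_shiftS.
have q0 : 0 <= normc w / r by rewrite divr_ge0 ?normc_ge0// ltW.
have q1 : normc w / r < 1 by rewrite ltr_pdivrMr// mul1r.
pose K := normc ((pi *+ 2)%:C^-1 : C) * (2 * M * (pi *+ 2)).
apply: (@cvg_normc_squeeze _ _ _ (fun N => K * (normc w / r) * (normc w / r) ^+ N)); last first.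
  by apply: (@cvg_geometric R (K * (normc w / r))); rewrite ger0_norm.
move=> N; rewrite key normcN !normcM normcX.
have -> : K * (normc w / r) * (normc w / r) ^+ N =
   normc w ^+ N.+1 * normc (pi *+ 2)%:C^-1 * (2 * (M * r ^- N.+1) * (pi *+ 2 - 0)).
  by rewrite -mulrA -exprS exprMn -exprVn /K subr0; ring.
rewrite ler_wpM2l ?mulr_ge0 ?exprn_ge0 ?normc_ge0//.
apply: cint_le => // t ht.
rewrite normcM normcV normcX czr ler_wpM2r ?invr_ge0 ?exprn_ge0 ?(ltW r0)//.
exact: HM.
Qed.

Lemma cdiff_shift f x w l : cdiff f (x + w) l <-> cdiff (fun z => f (x + z)) w l.
Proof.
by split => H e e0; have [d d0 Hd] := H e e0; exists d => // h /Hd; rewrite addrA.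
Qed.

(** [holo_expand] gives coefficients for each radius below [rho]; [pser_eq_derive] identifies them
    with derivatives at [x], which do not depend on the radius, so the expansion reaches the whole
    disc. *)
Theorem taylor_series f x (rho : R) : 0 < rho ->
  (forall w, normc w < rho -> derivable f (x + w) 1) ->
  pser f x rho (fun n => derive1n n f x / n`!%:R).
Proof.
move=> rho0 df w wr.
pose r := (normc w + rho) / 2.
have w0 := normc_ge0 w.
have r0 : 0 < r by rewrite /r; lra.
have rrho : r < rho by rewrite /r; lra.
have wr' : normc w < r by rewrite /r; lra.
have [z zr|a Ha] := @holo_expand (fun z => f (x + z)) rho r r0 rrho.
  have := df z zr; move=> /derivable_cdiff/cdiff_shift; exact: cdiff_derivable.
have Hx : pser f x r a.
  by move=> u ur; have := Ha u ur; rewrite add0r.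
rewrite -(pser_eq_derive r0 Hx); exact: Hx.
Qed.

Definition copen (U : set C) := forall z, U z -> exists2 r : R, 0 < r & forall w, normc w < r -> U (z + w).

Lemma holomorphic_derive1n (U : set C) f n : copen U -> holomorphic U f -> holomorphic U (derive1n n f).
Proof.
move=> oU hf z Uz; have [r r0 Hr] := oU z Uz.
have H := @taylor_series f z r r0 (fun w wr => hf _ (Hr w wr)).
have := pser_derivable (@pser_derive1n _ n _ _ _ _ H) (w := 0).
by rewrite addr0 normc0; exact.
Qed.

End Taylor.

(** * Plane Lebesgue measure: translations, rotations, scalings *)

Section LinearChange.
Variable R : realType.
Local Notation mu := (@lebesgue_measure R).
Local Notation mu2 := (mu \x mu)%E.
Local Notation RR := (R * R)%type.

Lemma measurable_affine (k c : R) :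
  measurable_fun setT (fun x : R => k * x + c : R).
Proof.
apply: measurable_funD; last exact: measurable_cst.
by apply: measurable_funM; [exact: measurable_cst|exact: measurable_id].
Qed.

Lemma lebesgue_measure_affine (k c : R) (A : set (R)) : 0 < k ->
  measurable A ->
  (k%:E * pushforward mu (fun x : R => (k * x + c)%R : R) A = mu A)%E.
Proof.
move=> k0 mA.
pose phi : measurableTypeR R -> measurableTypeR R := fun x => k * x + c.
have mphi : measurable_fun setT phi := measurable_affine k c.
pose nu : {measure set (measurableTypeR R) -> \bar R} := mscale (NngNum (ltW k0)) (pushforward mu phi).
have := @lebesgue_measure_unique R (nu mphi) _ A mA; rewrite /nu /mscale/= => -> //.
move=> _ [[a b]] _ <-; rewrite /mscale/= /pushforward.
have -> : phi @^-1` `]a, b]%classic = `](a - c) / k, (b - c) / k]%classic.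
  apply/seteqP; split => x /=; rewrite /phi !in_itv/= ltr_pdivrMr// ler_pdivlMr//;
    by rewrite mulrC; lra.
rewrite !lebesgue_measure_itv/= !lte_fin ltr_pM2r ?invr_gt0// ltrD2r.
case: ifPn => _; last by rewrite mule0.
by rewrite -!EFinB -EFinM; congr (_%:E); field; rewrite gt_eqF.
Qed.

Lemma integral_affine (k c : R) (F : R -> \bar R) : 0 < k ->
  measurable_fun setT (F : R -> \bar R) -> (forall x, 0 <= F x)%E ->
  (k%:E * \int[mu]_x F (k * x + c)%R = \int[mu]_x F x)%E.
Proof.
move=> k0 mF F0.
pose phi : measurableTypeR R -> measurableTypeR R := fun x => k * x + c.
have mphi : measurable_fun setT phi := measurable_affine k c.
pose mu' : {measure set (measurableTypeR R) -> \bar R} := mu.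
pose nu : {measure set (measurableTypeR R) -> \bar R} := pushforward mu phi.
have E := @ge0_integral_pushforward _ _ _ _ _ phi mphi mu' setT F measurableT mF (fun y _ => F0 y).
rewrite preimage_setT in E.
transitivity (k%:E * \int[nu mphi]_y F y)%E; first by rewrite E.
rewrite -(@ge0_integral_mscale _ _ _ (nu mphi) setT measurableT (NngNum (ltW k0)) F)//.
apply: eq_measure_integral => A mA _; rewrite /mscale/=.
exact: lebesgue_measure_affine.
Qed.

Lemma tonelli1 (F : RR -> \bar R) : measurable_fun setT F -> (forall p, 0 <= F p)%E ->
  (\int[mu2]_p F p = \int[mu]_x \int[mu]_y F (x, y))%E.
Proof. by move=> mF F0; exact: (@fubini_tonelli1 _ _ _ _ R mu mu F mF F0). Qed.

Lemma tonelli2 (F : RR -> \bar R) : measurable_fun setT F -> (forall p, 0 <= F p)%E ->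
  (\int[mu2]_p F p = \int[mu]_y \int[mu]_x F (x, y))%E.
Proof. by move=> mF F0; exact: (@fubini_tonelli2 _ _ _ _ R mu mu F mF F0). Qed.

Lemma measurable_fun_int2 (F : RR -> \bar R) : measurable_fun setT F -> (forall p, 0 <= F p)%E ->
  measurable_fun setT (fun x : R => \int[mu]_y F (x, y))%E.
Proof.
by move=> mF F0; exact: (@measurable_fun_fubini_tonelli_F _ _ _ _ R mu F mF F0).
Qed.

(** Preservation of plane Lebesgue measure, stated on integrals of nonnegative functions: it is then
    stable under composition and follows for shears from Tonelli's theorem and one-dimensional
    translations. *)
Definition ipres (T : RR -> RR) := measurable_fun setT T /\
  forall F : RR -> \bar R, measurable_fun setT F -> (forall p, 0 <= F p)%E ->
    (\int[mu2]_p F (T p) = \int[mu2]_p F p)%E.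

Lemma ipres_comp T U : ipres T -> ipres U -> ipres (T \o U).
Proof.
move=> [mT HT] [mU HU]; split; first exact: measurableT_comp.
move=> F mF F0; rewrite -[RHS]HT// -[RHS]HU//.
exact: measurableT_comp.
Qed.

Lemma ipres_id : ipres id.
Proof. by split => //; exact: measurable_id. Qed.

Lemma measurable_pair2 d (X : measurableType d) (f g : X -> R) :
  measurable_fun setT f -> measurable_fun setT g ->
  measurable_fun setT (fun p => (f p, g p) : RR).
Proof. by move=> mf mg; exact: measurable_fun_pair. Qed.

Lemma ipres_shear1 (t c : R) : ipres (fun p : R * R => (p.1 + (t * p.2 + c), p.2)).
Proof.
have mT : measurable_fun setT (fun p : RR => (p.1 + (t * p.2 + c), p.2) : RR).
  apply: measurable_pair2; last exact: measurable_snd.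
  apply: measurable_funD; first exact: measurable_fst.
  apply: measurable_funD; last exact: measurable_cst.
  by apply: measurable_funM; [exact: measurable_cst|exact: measurable_snd].
split=> // F mF F0.
etransitivity; first exact: (@tonelli2 (F \o (fun p : R * R => (p.1 + (t * p.2 + c), p.2))) (measurableT_comp mF mT) (fun p => F0 _)).
rewrite tonelli2//; apply: eq_integral => y _ /=.
have mFy : measurable_fun setT (fun x : R => F (x, y)).
  exact: measurableT_comp.
rewrite -(@integral_affine 1 (t * y + c) (fun x => F (x, y)))// mul1e.
by apply: eq_integral => x _; rewrite mul1r.
Qed.

Lemma ipres_shear2 (t c : R) : ipres (fun p : R * R => (p.1, p.2 + (t * p.1 + c))).
Proof.
have mT : measurable_fun setT (fun p : RR => (p.1, p.2 + (t * p.1 + c)) : RR).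
  apply: measurable_pair2; first exact: measurable_fst.
  apply: measurable_funD; first exact: measurable_snd.
  apply: measurable_funD; last exact: measurable_cst.
  by apply: measurable_funM; [exact: measurable_cst|exact: measurable_fst].
split=> // F mF F0.
etransitivity; first exact: (@tonelli1 (F \o (fun p : R * R => (p.1, p.2 + (t * p.1 + c)))) (measurableT_comp mF mT) (fun p => F0 _)).
rewrite tonelli1//; apply: eq_integral => x _ /=.
have mFx : measurable_fun setT (fun y : R => F (x, y)).
  exact: measurableT_comp.
rewrite -(@integral_affine 1 (t * x + c) (fun y => F (x, y)))// mul1e.
by apply: eq_integral => y _; rewrite mul1r.
Qed.

Lemma ipres_translation (a b : R) : ipres (fun p : R * R => (p.1 + a, p.2 + b)).
Proof.
have := ipres_comp (ipres_shear1 0 a) (ipres_shear2 0 b).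
rewrite (_ : _ \o _ = fun p : R * R => (p.1 + a, p.2 + b))//.
by apply/funext => p /=; rewrite !mul0r !add0r.
Qed.

(* A rotation is a product of three shears. *)
Lemma ipres_rotation (c s : R) : c ^+ 2 + s ^+ 2 = 1 -> c != -1 ->
  ipres (fun p : R * R => (c * p.1 - s * p.2, s * p.1 + c * p.2)).
Proof.
move=> cs c1; have c1' : 1 + c != 0 by rewrite addrC addr_eq0.
(* The tangent of half the angle. The half turn, where it is undefined, is obtained in [ipres_rot]
   by rotating twice by half the angle. *)
pose t := s / (1 + c).
have ts : t * s = 1 - c.
  have -> : t * s = s ^+ 2 / (1 + c) by rewrite /t; ring.
  have -> : s ^+ 2 = (1 - c) * (1 + c) by rewrite -[s ^+ 2](addKr (c ^+ 2)) cs; ring.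
  by rewrite mulfK.
have tc : t * (1 + c) = s by rewrite /t divfK.
have := ipres_comp (ipres_comp (ipres_shear1 (- t) 0) (ipres_shear2 s 0)) (ipres_shear1 (- t) 0).
rewrite (_ : _ \o _ = fun p : R * R => (c * p.1 - s * p.2, s * p.1 + c * p.2))//.
apply/funext => -[x y] /=; congr pair; last first.
  have -> : y + (s * (x + (- t * y + 0)) + 0) = s * x + (1 - t * s) * y by ring.
  by rewrite ts; ring.
have -> : x + (- t * y + 0) + (- t * (y + (s * (x + (- t * y + 0)) + 0)) + 0) =
  (1 - t * s) * x - (t * (1 + (1 - t * s))) * y by ring.
by rewrite ts opprB addrCA subrr addr0 tc.
Qed.

Lemma integral_scale2 (k : R) (F : RR -> \bar R) : 0 < k ->
  measurable_fun setT F -> (forall p, 0 <= F p)%E ->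
  ((k ^+ 2)%R%:E * \int[mu2]_p F (k * p.1, k * p.2)%R = \int[mu2]_p F p)%E.
Proof.
move=> k0 mF F0.
have mk (X : measurableType _) (f : X -> R) : measurable_fun setT f ->
    measurable_fun setT (fun x => k * f x : R).
  by move=> mf; apply: measurable_funM => //; exact: measurable_cst.
have mT : measurable_fun setT (fun p : RR => (k * p.1, k * p.2) : RR).
  by apply: measurable_pair2; apply: mk; [exact: measurable_fst|exact: measurable_snd].
have mG : measurable_fun setT (fun p : RR => F (k * p.1, k * p.2)).
  exact: (measurableT_comp mF mT).
have -> : (\int[mu2]_p F (k * p.1, k * p.2)%R = \int[mu]_x \int[mu]_y F (k * x, k * y)%R)%E.
  exact: (@tonelli1 (F \o (fun p : R * R => (k * p.1, k * p.2))) mG (fun p => F0 _)).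
rewrite tonelli1// expr2 EFinM -muleA.
pose F1 (x : R) := (\int[mu]_y F (x, y))%E.
have F10 x : (0 <= F1 x)%E by apply: integral_ge0.
have mF1 : measurable_fun setT (F1 : R -> \bar R).
  exact: measurable_fun_int2.
rewrite -(@integral_affine k 0 F1)//; congr (_ * _)%E.
rewrite -ge0_integralZl//=; last 3 first.
- exact: (@measurable_fun_int2 (fun p : R * R => F (k * p.1, k * p.2)) mG (fun p => F0 _)).
- by move=> x _; apply: integral_ge0.
- by rewrite lee_fin ltW.
apply: eq_integral => x _; rewrite addr0 /F1.
have mFx : measurable_fun setT (fun y : R => F (k * x, y)).
  exact: measurableT_comp.
rewrite -(@integral_affine k 0 (fun y => F (k * x, y)))//; congr (_ * _)%E.
by apply: eq_integral => y _; rewrite addr0.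
Qed.

End LinearChange.

(** * Radial functions *)

Section Radial.
Variable R : realType.
Local Notation mu := (@lebesgue_measure R).
Local Notation mu2 := (mu \x mu)%E.

Definition sqn (p : R * R) : R := p.1 ^+ 2 + p.2 ^+ 2.

Lemma sqn_ge0 p : 0 <= sqn p. Proof. by rewrite addr_ge0 ?sqr_ge0. Qed.

Lemma measurable_sqn : measurable_fun setT sqn.
Proof.
by apply: measurable_funD; apply: measurable_funX;
  [exact: measurable_fst|exact: measurable_snd].
Qed.

Lemma measurable_sqn_le b : measurable [set p | sqn p <= b].
Proof.
have -> : [set p | sqn p <= b] = sqn @^-1` `]-oo, b]%classic.
  by apply/seteqP; split=> p /=; rewrite in_itv.
rewrite -[_ @^-1` _]setTI; apply: measurable_sqn => //.
Qed.

Definition kappa : R := fine (mu2 [set p | sqn p <= 1]).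

Lemma mu2_rect (a b : R) : 0 <= a -> 0 <= b ->
  mu2 (`[- a, a] `*` `[- b, b]) = (4 * a * b)%:E.
Proof.
have H c : 0 <= c -> mu `[- c, c]%classic = (2 * c)%:E.
  move=> c0; rewrite lebesgue_measure_itv/= lte_fin; case: ifPn => h.
    by rewrite -EFinB; congr _%:E; ring.
  by have -> : c = 0 by [lra]; rewrite mulr0.
move=> a0 b0.
pose I (c : R) : set R := `[- c, c]%classic.
have -> : mu2 (`[- a, a] `*` `[- b, b]) = (mu (I a) * mu (I b))%E.
  by apply: product_measure1E; exact: measurable_itv.
by rewrite /I !H// -EFinM; congr _%:E; ring.
Qed.

Lemma mu2_unit_disc : mu2 [set p | sqn p <= 1] = kappa%:E.
Proof.
rewrite /kappa fineK// ge0_fin_numE ?measure_ge0//.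
apply: (@le_lt_trans _ _ (mu2 (`[- 1, 1] `*` `[- 1, 1]))).
  apply: le_measure; rewrite ?inE; [exact: measurable_sqn_le| |].
    by apply: measurableX; exact: measurable_itv.
  move=> [x y]; rewrite /sqn/= => h.
  have x0 := sqr_ge0 x; have y0 := sqr_ge0 y.
  split; rewrite in_itv/= -ler_norml -(@ler_pXn2r _ 2)// ?nnegrE// expr1n real_normK ?num_real//; lra.
by rewrite mu2_rect// ltry.
Qed.

Lemma kappa_gt0 : 0 < kappa.
Proof.
rewrite -lte_fin -mu2_unit_disc.
apply: (@lt_le_trans _ _ (mu2 (`[- 2^-1, 2^-1] `*` `[- 2^-1, 2^-1]))).
  by rewrite mu2_rect ?invr_ge0// lte_fin; lra.
apply: le_measure; rewrite ?inE; [|exact: measurable_sqn_le|].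
  by apply: measurableX; exact: measurable_itv.
move=> [x y] []; rewrite /sqn/= !in_itv/= => hx hy.
by rewrite !expr2; nra.
Qed.

Lemma mu2_disc b : mu2 [set p | sqn p <= b] = (Num.max b 0 * kappa)%:E.
Proof.
have pos c : 0 < c -> mu2 [set p | sqn p <= c] = (c * kappa)%:E.
  move=> c0; pose k := Num.sqrt c.
  have k0 : 0 < k by rewrite sqrtr_gt0.
  have kc : k ^+ 2 = c by rewrite sqr_sqrtr// ltW.
  have I : forall e, (\int[mu2]_p (\1_[set p | sqn p <= e] p)%:E)%E = mu2 [set p | sqn p <= e].
    by move=> e; rewrite integral_indic ?setIT//; exact: measurable_sqn_le.
  rewrite -I -(integral_scale2 k0); last 2 first.
  - by apply/measurable_EFinP; apply: measurable_indic; exact: measurable_sqn_le.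
  - by move=> p; rewrite lee_fin.
  rewrite kc EFinM -mu2_unit_disc -I; congr (_ * _)%E.
  apply: eq_integral => p _; rewrite !indicE; congr ((nat_of_bool _)%:R%:E).
  apply/idP/idP; rewrite !inE/= /sqn/= !exprMn -mulrDr kc.
  - by rewrite -[X in _ <= X]mulr1 ler_pM2l.
  - by rewrite -[X in _ -> _ <= X]mulr1 ler_pM2l.
have [b0|b0] := ltP 0 b; first by rewrite pos.
rewrite mul0r; apply/eqP; rewrite eq_le measure_ge0 andbT.
apply/lee_addgt0Pr => e e0; rewrite add0e.
have k0 := kappa_gt0.
apply: (@le_trans _ _ (mu2 [set p | sqn p <= e / kappa])).
  apply: le_measure; rewrite ?inE; [exact: measurable_sqn_le|exact: measurable_sqn_le|].
  move=> p /= h; apply: le_trans h _; apply: le_trans b0 _.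
  by rewrite divr_ge0// ltW.
by rewrite pos ?divr_gt0// divfK// gt_eqF.
Qed.

Lemma mu2_annulus a b : a <= b ->
  mu2 (sqn @^-1` `]a, b]%classic) = ((Num.max b 0 - Num.max a 0) * kappa)%:E.
Proof.
move=> ab.
have -> : sqn @^-1` `]a, b]%classic = [set p | sqn p <= b] `\` [set p | sqn p <= a].
  apply/seteqP; split => p /=; rewrite in_itv/=.
    by move=> /andP[h1 h2]; split=> //; apply/negP; rewrite -ltNge.
  by move=> [h1 /negP]; rewrite -ltNge => ->.
have fb : (mu2 [set p | (sqn p <= b)%R] < +oo)%E by rewrite mu2_disc ltry.
pose D c := [set p | sqn p <= c]; rewrite -/(D a) -/(D b).
have -> : mu2 (D b `\` D a) = (mu2 (D b) - mu2 (D b `&` D a))%E.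
  by apply: measureD; [exact: measurable_sqn_le|exact: measurable_sqn_le|exact: fb].
have -> : D b `&` D a = D a.
  by apply/seteqP; split => p /=; [case|move=> h; split => //; exact: le_trans ab].
by rewrite /D !mu2_disc -EFinB -mulrBl.
Qed.

(** Polar coordinates in the variable [t = |z|^2]: the disc [t <= b] has area [kappa * b], so plane
    measure is carried by [sqn] to [kappa dt] on the half-line. Adding Lebesgue measure on []-oo,
    0]] to [kappa^-1] times this image gives [nu], a measure on the whole line to which uniqueness
    of Lebesgue measure applies. *)
Theorem integral_radial (F : R -> \bar R) : measurable_fun setT F -> (forall t, 0 <= F t)%E ->
  (\int[mu2]_p F (sqn p) = kappa%:E * \int[mu]_(t in `]0%R, +oo[) F t)%E.
Proof.
move=> mF F0.
have k0 := kappa_gt0.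
have ki0 : 0 <= kappa^-1 by rewrite invr_ge0 ltW.
pose m2 : {measure set (measurableTypeR R * measurableTypeR R) -> \bar R} := mu2.
pose N : measurableTypeR R * measurableTypeR R -> measurableTypeR R := sqn.
have mN : measurable_fun setT N := measurable_sqn.
pose push : {measure set (measurableTypeR R) -> \bar R} := pushforward m2 N.
have mneg : measurable (`]-oo, 0%R]%classic : set (measurableTypeR R)) by exact: measurable_itv.
pose rmu : {measure set (measurableTypeR R) -> \bar R} := mrestr mu mneg.
pose nu : {measure set (measurableTypeR R) -> \bar R} :=
  measure_add (mscale (NngNum ki0) (push mN)) rmu.
have nuE A : measurable A -> mu A = nu A.
  apply: lebesgue_measure_unique => _ [[a b]] _ <-.
  have -> : nu `]a, b]%classic = ((kappa^-1)%R%:E * m2 (N @^-1` `]a, b]%classic) +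
      mu (`]a, b]%classic `&` `]-oo, 0%R]%classic))%E by exact: measure_addE.
  have [ba|ab] := leP b a.
    rewrite set_itv_ge ?bnd_simp -?leNgt// preimage_set0 set0I !measure0 mule0 adde0//.
  have -> : m2 (N @^-1` `]a, b]%classic) = ((Num.max b 0 - Num.max a 0) * kappa)%:E.
    by rewrite -mu2_annulus// ltW.
  have -> : `]a, b]%classic `&` `]-oo, 0]%classic = `]a, Num.min b 0]%classic.
    by apply/seteqP; split => x /=; rewrite !in_itv/= le_min;
      [move=> [/andP[-> ->] ->]|move=> /and3P[-> -> ->]].
  rewrite !lebesgue_measure_itv/= !lte_fin ab -EFinM mulrCA mulVf ?gt_eqF// mulr1.
  have [b0|b0] := leP 0 b; have [a0|a0] := leP 0 a.
  - by rewrite adde0.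
  - by rewrite -!EFinB -EFinD; congr _%:E; ring.
  - by move: (le_lt_trans a0 ab); rewrite ltNge ltW.
  - by rewrite ab subrr add0e.
have disj : m2 (N @^-1` `]-oo, 0]%classic) = 0%E.
  have -> : N @^-1` `]-oo, 0]%classic = [set p | sqn p <= 0].
    by apply/seteqP; split => p /=; rewrite /N in_itv.
  by apply: etrans (mu2_disc 0) _; rewrite maxxx mul0r.
have -> : (\int[mu]_(t in `]0%R, +oo[) F t = \int[nu]_(t in `]0%R, +oo[) F t)%E.
  by apply: eq_measure_integral => A mA _; exact: nuE.
have mFD D : measurable D -> measurable_fun D F by move=> mD; exact: measurable_funS mF.
rewrite ge0_integral_measure_add//; last exact: mFD.
rewrite ge0_integral_mscale//; last exact: mFD.
have -> : (\int[rmu]_(t in `]0%R, +oo[) F t = 0)%E.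
  apply: null_set_integral => //; first exact: mFD.
  rewrite /rmu/= /mrestr (_ : _ `&` _ = set0) ?measure0//.
  apply/seteqP; split => x //= []; rewrite !in_itv/= andbT => x0 x1.
  by move: x0; rewrite ltNge x1.
rewrite adde0 muleA -EFinM mulfV ?gt_eqF// mul1e.
have E := @ge0_integral_pushforward _ _ _ _ _ N mN m2 `]0, +oo[%classic F.
rewrite [RHS]E//; last exact: mFD.
have mA : measurable (N @^-1` `]0, +oo[%classic).
  by rewrite -[_ @^-1` _]setTI; have mN' := mN; apply: mN' => //; exact: measurable_itv.
have mB : measurable (N @^-1` `]-oo, 0]%classic).
  by rewrite -[_ @^-1` _]setTI; have mN' := mN; apply: mN' => //; exact: measurable_itv.
have AB : N @^-1` `]0, +oo[%classic `|` N @^-1` `]-oo, 0]%classic = setT.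
  apply/seteqP; split => p //= _; rewrite !in_itv/= andbT.
  by have [|] := ltP 0 (N p); [left|right].
have mFN : measurable_fun setT (F \o N) by exact: measurableT_comp.
transitivity (\int[m2]_(p in setT) (F \o N) p)%E; first by [].
rewrite -{1}AB ge0_integral_setU//; last 3 first.
- by rewrite AB.
- by move=> x _; exact: F0.
- apply/disj_setPS => p []/=; rewrite !in_itv/= andbT => h1 h2.
  by move: h1; rewrite ltNge h2.
rewrite [X in (_ + X)%E]null_set_integral ?adde0//.
exact: measurable_funS mFN.
Qed.

End Radial.

(** * The weights and their moments *)

Section Moments.
Variable R : realType.
Local Notation mu := (@lebesgue_measure R).

Lemma is_derive_continuous (F : R -> R) (x l : R) : is_derive x 1 F l -> {for x, continuous F}.
Proof.
by move=> [dF _]; apply: differentiable_continuous; apply/derivable1_diffP.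
Qed.

Lemma integral_FTC (f F : R -> R) (a b : R) : a < b ->
  (forall x, a <= x <= b -> {for x, continuous f}) ->
  (forall x, a <= x <= b -> is_derive x 1 F (f x)) ->
  (\int[mu]_(x in `[a, b]) (f x)%:E = (F b - F a)%:E)%E.
Proof.
move=> ab cf dF; rewrite EFinB; apply: continuous_FTC2 => //.
- exact: (@cont_on_within R a b f).
- have cF x : a <= x <= b -> {for x, continuous F}.
    by move=> /dF/is_derive_continuous.
  split.
  + move=> x; rewrite in_itv/= => /andP[ax xb].
    by have [] := dF x ltac:(by rewrite !ltW).
  + by apply: cvg_at_right_filter; apply: cF; rewrite lexx ltW.
  + by apply: cvg_at_left_filter; apply: cF; rewrite lexx ltW.
- move=> x; rewrite in_itv/= => /andP[ax xb].
  have d := dF x ltac:(by rewrite !ltW).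
  by rewrite derive1E; case: d.
Qed.

(** The integrand may blow up at the ends, as the weight does on the bounding circle. Closed
    subintervals exhaust []a, b[]; monotone convergence handles the integrals and continuity of [F]
    the boundary values. *)
Lemma ge0_integral_FTC_oo (f F : R -> R) (a b : R) : a < b ->
  (forall x, a < x < b -> 0 <= f x) ->
  (forall x, a < x < b -> {for x, continuous f}) ->
  (forall x, a < x < b -> is_derive x 1 F (f x)) ->
  {for a, continuous F} -> {for b, continuous F} ->
  (\int[mu]_(x in `]a, b[) (f x)%:E = (F b - F a)%:E)%E.
Proof.
move=> ab f0 cf dF cFa cFb.
(* The factor [1 / 4] keeps [a + e n < b - e n] from the first index on. *)
pose e (n : nat) : R := (b - a) / 4 * (1 / 2) ^+ n.
have e0 n : 0 < e n by rewrite mulr_gt0 ?exprn_gt0//; lra.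
have e4 n : e n <= (b - a) / 4.
  by rewrite ler_piMr ?exprn_ile1//; lra.
have eS n m : (n <= m)%N -> e m <= e n.
  by move=> nm; rewrite ler_wpM2l ?ler_wiXn2l//; lra.
have ecvg : e n @[n --> \oo] --> (0 : R).
  by apply: (@cvg_geometric R ((b - a) / 4)); rewrite ger0_norm; lra.
pose A n : set (measurableTypeR R) := `[a + e n, b - e n]%classic.
have mA n : measurable (A n) by exact: measurable_itv.
have AS : {homo A : n m / (n <= m)%N >-> (n <= m)%O}.
  move=> n m nm; apply/subsetPset => x; rewrite /A/= !in_itv/=.
  by have := eS _ _ nm; lra.
have UA : \bigcup_n A n = `]a, b[%classic.
  apply/seteqP; split=> x.
    by move=> [n _]; rewrite /A/= !in_itv/=; have := e0 n; lra.
  rewrite /= in_itv/= => /andP[ax xb].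
  have d0 : 0 < Num.min (x - a) (b - x) by rewrite lt_min !subr_gt0 ax.
  have /cvgrPdist_lt/(_ _ d0)[N _ /(_ N (leqnn N))] := ecvg.
  rewrite sub0r normrN lt_min gtr0_norm// => /andP[h1 h2].
  by exists N => //; rewrite /A/= in_itv/=; lra.
have mf : measurable_fun `]a, b[%classic f.
  apply: open_continuous_measurable_fun; first exact: interval_open.
  by move=> x; rewrite inE/= in_itv/=; exact: cf.
have Asub n : A n `<=` `]a, b[%classic.
  by move=> x Ax; rewrite -UA; exists n.
have H := @ge0_nondecreasing_set_cvg_integral _ (measurableTypeR R) R A (EFin \o f) mu AS mA.
rewrite UA in H.
have {}H : (\int[mu]_(x in A n) (f x)%:E)%E @[n --> \oo] --> (\int[mu]_(x in `]a, b[%classic) (f x)%:E)%E.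
  apply: H.
  - move=> n; apply/measurable_EFinP; apply: measurable_funS mf => //.
  - by move=> n x /Asub; rewrite /= in_itv/= => /f0; rewrite lee_fin.
have E n : (\int[mu]_(x in A n) (f x)%:E)%E = (F (b - e n) - F (a + e n))%:E.
  apply: integral_FTC; first by have := e4 n; lra.
  - by move=> x hx; apply: cf; have := e0 n; lra.
  - by move=> x hx; apply: dF; have := e0 n; lra.
have {}H : (F (b - e n) - F (a + e n))%:E @[n --> \oo] --> (\int[mu]_(x in `]a, b[%classic) (f x)%:E)%E.
  by move: H; under eq_fun do rewrite E.
have H2 : (F (b - e n) - F (a + e n))%:E @[n --> \oo] --> (F b - F a)%:E.
  apply: cvg_EFin; first by near=> n.
  apply: cvgB.
  - apply: (@cvg_comp _ _ _ (fun n => b - e n) F _ (nbhs b)) => //.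
    have : (fun n => b - e n) @ \oo --> b - 0 by apply: cvgB => //; exact: cvg_cst.
    by rewrite subr0.
  - apply: (@cvg_comp _ _ _ (fun n => a + e n) F _ (nbhs a)) => //.
    have : (fun n => a + e n) @ \oo --> a + 0 by apply: cvgD => //; exact: cvg_cst.
    by rewrite addr0.
exact: (cvg_unique _ H H2).
Unshelve. all: by end_near. Qed.

(** A function of [t = |z - x|^2], with an integrable singularity on the circle [2 t = x^2]. It is 0
    from there on, so that integrals over the disc become integrals over the plane. *)
Definition wt (x t : R) : R := if 2 * t < x ^+ 2 then (Num.sqrt (x ^+ 2 - 2 * t))^-1 else 0.

Lemma wt_ge0 x t : 0 <= wt x t.
Proof. by rewrite /wt; case: ifP => // _; rewrite invr_ge0 sqrtr_ge0. Qed.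

Definition cn (n : nat) : R := 2 ^+ n / ((2 * n).+1)`!%:R.

Lemma cn_gt0 n : 0 < cn n.
Proof. by rewrite divr_gt0 ?exprn_gt0// ltr0n fact_gt0. Qed.

Lemma cnS n : cn n.+1 = cn n / ((2 * n + 3)%:R * n.+1%:R).
Proof.
rewrite /cn mulnS exprS.
have -> : (2 + 2 * n).+1 = (2 * n).+3 by rewrite addnC addn2.
rewrite (factS (2 * n).+2) (factS (2 * n).+1).
have : ((2 * n).+1)`!%:R != 0 :> R by rewrite pnatr_eq0 -lt0n fact_gt0.
move: ((2 * n).+1`!) => F1 F0; rewrite !natrM.
have -> : (2 * n).+2%:R = 2 * n.+1%:R :> R by rewrite -natrM mulnS add2n.
have -> : (2 * n).+3%:R = (2 * n + 3)%:R :> R by rewrite addn3.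
have n1 : n.+1%:R != 0 :> R by rewrite pnatr_eq0.
have n3 : (2 * n + 3)%:R != 0 :> R by rewrite pnatr_eq0 addn3.
move: (n.+1%:R) ((2 * n + 3)%:R) (F1%:R) n1 n3 F0 => p q F p0 q0 F0.
by field; rewrite ?p0 ?q0 ?F0.
Qed.

(** A primitive of [t ^+ n / sqrt (x^2 - 2 t)]; the recursion is integration by parts, read off the
    derivative of [t ^+ m.+1 * sqrt (x^2 - 2 t)]. *)
Fixpoint wprim (x : R) (n : nat) (t : R) : R :=
  if n is m.+1 then
    (m.+1%:R * x ^+ 2 * wprim x m t - t ^+ m.+1 * Num.sqrt (x ^+ 2 - 2 * t)) / (2 * m + 3)%:R
  else - Num.sqrt (x ^+ 2 - 2 * t).

Lemma continuous_wsqrt (x t : R) : {for t, continuous (fun u : R => Num.sqrt (x ^+ 2 - 2 * u))}.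
Proof.
apply: (@continuous_comp _ _ _ (fun u : R => x ^+ 2 - 2 * u) (fun y : R => Num.sqrt y)); last exact: sqrt_continuous.
apply: cvgB; first exact: cvg_cst.
by apply: cvgM; [exact: cvg_cst|exact: cvg_id].
Qed.

Lemma is_derive_wsqrt (x t : R) : 2 * t < x ^+ 2 ->
  is_derive t 1 (fun u : R => Num.sqrt (x ^+ 2 - 2 * u)) (- (Num.sqrt (x ^+ 2 - 2 * t))^-1).
Proof.
move=> xt; have h : 0 < x ^+ 2 - 2 * t by lra.
have d1 : is_derive t 1 (fun t : R => x ^+ 2 - 2 * t) (- 2).
  have D := is_deriveB (is_derive_cst (x ^+ 2) t 1) (is_deriveZ 2 (is_derive_id t (1 : R))).
  by move: D; rewrite sub0r [2 *: 1]mulr1.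
have := @is_derive1_comp R _ (fun u : R => x ^+ 2 - 2 * u) t _ _ (is_derive1_sqrt h) d1.
have -> : (2 * Num.sqrt (x ^+ 2 - 2 * t))^-1 * - 2 = - (Num.sqrt (x ^+ 2 - 2 * t))^-1.
  by field; rewrite gt_eqF// sqrtr_gt0.
exact.
Qed.

Lemma is_derive_expn (n : nat) (t : R) : is_derive t 1 (fun u : R => u ^+ n.+1) (n.+1%:R * t ^+ n).
Proof.
apply: DeriveDef; first exact: exprn_derivable.
by rewrite exp_derive/= [LHS]mulr1.
Qed.

Lemma continuous_wprim (x : R) n (t : R) : {for t, continuous (wprim x n)}.
Proof.
elim: n => [|n IH] /=; first by apply: cvgN; exact: continuous_wsqrt.
apply: cvgM; last exact: cvg_cst.
apply: cvgB; first by apply: cvgM; [exact: cvg_cst|exact: IH].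
apply: cvgM; last exact: continuous_wsqrt.
exact: exprn_continuous.
Qed.

Lemma is_derive_wprim (x : R) n (t : R) : 2 * t < x ^+ 2 ->
  is_derive t 1 (wprim x n) (t ^+ n / Num.sqrt (x ^+ 2 - 2 * t)).
Proof.
move=> xt; have ds := is_derive_wsqrt xt.
have s0 : 0 < Num.sqrt (x ^+ 2 - 2 * t) by rewrite sqrtr_gt0; lra.
have sq : x ^+ 2 = Num.sqrt (x ^+ 2 - 2 * t) ^+ 2 + 2 * t by rewrite sqr_sqrtr; lra.
elim: n => [|n IH].
  have -> : wprim x 0 = - (fun u : R => Num.sqrt (x ^+ 2 - 2 * u)) by apply/funext.
  by have := is_deriveN ds; rewrite opprK expr0 mul1r.
have dn := is_derive_expn n t.
set s := Num.sqrt _ in s0 sq ds IH *.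
have D : is_derive t 1 (wprim x n.+1)
  ((2 * n + 3)%:R^-1 * (n.+1%:R * x ^+ 2 * (t ^+ n / s) - (t ^+ n.+1 * - s^-1 + s * (n.+1%:R * t ^+ n)))).
  have -> : wprim x n.+1 = (2 * n + 3)%:R^-1 \*: ((n.+1%:R * x ^+ 2) \*: (wprim x n) -
     (fun u : R => u ^+ n.+1) * (fun u : R => Num.sqrt (x ^+ 2 - 2 * u))).
    by apply/funext => u /=; rewrite mulrC.
  exact: (is_deriveZ _ (is_deriveB (is_deriveZ _ IH) (is_deriveM dn ds))).
apply: (is_derive_eq D); rewrite sq [t ^+ n.+1]exprS; clearbody s.
have n3 : (2 * n + 3)%:R != 0 :> R by rewrite pnatr_eq0 addn3.
have E3 : (2 * n + 3)%:R = 2 * n.+1%:R + 1 :> R.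
  by rewrite -natrM natr1 mulnS add2n addn3.
move: n3; rewrite E3; move: (t ^+ n) (n.+1%:R) s0 => T N s0 n3; field.
by rewrite ?n3 ?(gt_eqF s0).
Qed.

(** At [t = 0] the recursion loses its boundary term and becomes the one of [cnS]; this is how the
    coefficient [2^n / (2n+1)!] arises as a moment. *)
Lemma wprim0 (x : R) n : 0 < x -> wprim x n 0 = - (cn n * n`!%:R ^+ 2 * x ^+ (2 * n).+1).
Proof.
move=> x0; elim: n => [|n IH] /=.
  rewrite mulr0 subr0 sqrtr_sqr gtr0_norm//.
  by rewrite /cn muln0 expr0 fact0 (_ : 1`! = 1%N)// divr1 expr1n !mul1r expr1.
rewrite IH expr0n/= mul0r subr0 cnS (factS n); move: (n`!) => Fn; rewrite natrM.
have n3 : (2 * n + 3)%:R != 0 :> R by rewrite pnatr_eq0 addn3.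
have n1 : n.+1%:R != 0 :> R by rewrite pnatr_eq0.
rewrite mulnS add2n (_ : x ^+ (2 * n).+3 = x ^+ 2 * x ^+ (2 * n).+1); last first.
  by rewrite -exprD add2n.
move: n1 n3; move: (n.+1%:R) ((2 * n + 3)%:R) (cn n) (Fn%:R) (x ^+ (2 * n).+1) => p q c F X p0 q0.
by field; rewrite ?p0 ?q0.
Qed.

Lemma wprim_end (x : R) n : wprim x n (x ^+ 2 / 2) = 0.
Proof.
have z : Num.sqrt (x ^+ 2 - 2 * (x ^+ 2 / 2)) = 0.
  by rewrite (_ : _ - _ = 0) ?sqrtr0//; field.
elim: n => [|n IH] /=; first by rewrite z oppr0.
by rewrite z IH !mulr0 subrr mul0r.
Qed.

Lemma measurable_fun_inv : measurable_fun setT (fun x : R => x^-1).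
Proof.
have -> : setT = [set 0 : R] `|` ~` [set 0] by rewrite setUv.
have o : open (~` [set (0 : R)]) by apply: closed_openC; exact: closed_eq.
apply/measurable_funU; [by []|exact: open_measurable|split].
  exact: measurable_fun_set1.
apply: open_continuous_measurable_fun => // x; rewrite inE/= => /eqP x0.
exact: inv_continuous.
Qed.

Lemma measurable_wt d (T : measurableType d) (g h : T -> R) :
  measurable_fun setT g -> measurable_fun setT h ->
  measurable_fun setT (fun t => wt (g t) (h t)).
Proof.
move=> mg mh.
have mh2 : measurable_fun setT (fun t => 2 * h t) by apply: measurable_funM => //; exact: measurable_cst.
have mg2 : measurable_fun setT (fun t => g t ^+ 2) by exact: measurable_funX.
apply: measurable_fun_ifT; [exact: measurable_fun_ltr| |exact: measurable_cst].
have ms : measurable_fun setT (fun t => Num.sqrt (g t ^+ 2 - 2 * h t)).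
  have := @continuous_measurable_fun R _ (@sqrt_continuous R).
  by move=> /measurableT_comp; apply; exact: measurable_funB.
have mi : measurable_fun setT (fun x : R => x^-1) by exact: measurable_fun_inv.
exact: (measurableT_comp mi ms).
Qed.

Lemma wt_moment (x : R) n : 0 < x ->
  (\int[mu]_(t in `]0%R, +oo[) (t ^+ n * wt x t)%:E =
   (cn n * n`!%:R ^+ 2 * x ^+ (2 * n).+1)%:E)%E.
Proof.
move=> x0; have b0 : 0 < x ^+ 2 / 2 by rewrite divr_gt0// exprn_gt0.
transitivity (\int[mu]_(t in `]0%R, (x ^+ 2 / 2)%R[) (t ^+ n / Num.sqrt (x ^+ 2 - 2 * t))%:E)%E.
  rewrite [LHS]integral_mkcond [RHS]integral_mkcond; apply: eq_integral => t _.
  rewrite /patch !mem_setE !in_itv/= andbT /wt.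
  have [t0|//] := ltP 0 t; rewrite ltr_pdivlMr// (mulrC t 2).
  by case: (2 * t < x ^+ 2) => //=; rewrite mulr0.
have -> : cn n * n`!%:R ^+ 2 * x ^+ (2 * n).+1 = wprim x n (x ^+ 2 / 2) - wprim x n 0.
  by rewrite wprim_end wprim0// opprK add0r.
apply: (@ge0_integral_FTC_oo (fun t => t ^+ n / Num.sqrt (x ^+ 2 - 2 * t)) (wprim x n)) => //.
- by move=> t /andP[t0 _]; rewrite divr_ge0 ?sqrtr_ge0// exprn_ge0// ltW.
- move=> t /andP[t0]; rewrite ltr_pdivlMr// (mulrC t 2) => tx.
  apply: cvgM; first exact: exprn_continuous.
  apply: cvgV; last exact: continuous_wsqrt.
  by rewrite gt_eqF// sqrtr_gt0; lra.
- by move=> t /andP[t0]; rewrite ltr_pdivlMr// (mulrC t 2) => tx; exact: is_derive_wprim.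
- exact: continuous_wprim.
- exact: continuous_wprim.
Qed.

Lemma integral_patch_le (A B : set R) (f g : R -> R) : measurable A -> measurable B ->
  measurable_fun A f -> measurable_fun B g ->
  (forall x, A x -> 0 <= f x) -> (forall x, B x -> 0 <= g x) ->
  (forall x, A x -> f x != 0 -> B x /\ f x <= g x) ->
  (\int[mu]_(x in A) (f x)%:E <= \int[mu]_(x in B) (g x)%:E)%E.
Proof.
move=> mA mB mf mg f0 g0 fg.
rewrite integral_mkcond [leRHS]integral_mkcond.
apply: ge0_le_integral => //.
- by move=> x _; rewrite /patch; case: ifPn => // /[!inE] /f0; rewrite lee_fin.
- by apply/(measurable_restrictT _ _).1 => //; apply/measurable_EFinP.
- by apply/(measurable_restrictT _ _).1 => //; apply/measurable_EFinP.
move=> x _; rewrite /patch; case: ifPn => [/[!inE] Ax|_]; last first.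
  by case: ifPn => // /[!inE] /g0; rewrite lee_fin.
have [fx0|fx0] := eqVneq (f x) 0.
  by rewrite fx0; case: ifPn => // /[!inE] /g0; rewrite lee_fin.
by have [Bx le] := fg x Ax fx0; rewrite ifT ?inE// lee_fin.
Qed.

(* The point [x - a + ib] lies in the disc of center [x] and radius [x / sqrt 2] iff [x] is
   within [s] of [2a], where [s^2 = 2 (a^2 - b^2)]. *)
Definition ker (p : R * R) : \bar R :=
  (\int[mu]_(x in `]0%R, 2^-1%R[) (wt x ((p.1 - x) ^+ 2 + p.2 ^+ 2))%:E)%E.

Lemma wt_ker (a b x : R) :
  x ^+ 2 - 2 * ((a - x) ^+ 2 + b ^+ 2) = 2 * (a ^+ 2 - b ^+ 2) - (x - 2 * a) ^+ 2.
Proof. by ring. Qed.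

Lemma measurable_wt_sec (p : R * R) : measurable_fun setT (fun x : R => wt x ((p.1 - x) ^+ 2 + p.2 ^+ 2)).
Proof.
apply: measurable_wt; first exact: measurable_id.
apply: measurable_funD; last exact: measurable_cst.
apply: measurable_funX; apply: measurable_funB; first exact: measurable_cst.
exact: measurable_id.
Qed.

(** With [y = x - 2a] and [q = s^2] the integrand is [1 / sqrt (s^2 - y^2)] for [|y| < s]. One of
    the factors of [(s - y)(s + y)] is at least [s], so [g] dominates; its primitive [G] is
    elementary, and its integral over the whole interval is [4 sqrt 2], whatever [s]. The estimate
    [sqrt 2 <= 3 / 2] then gives 6. *)
Lemma ker_le (p : R * R) : (ker p <= 6%:E)%E.
Proof.
case: p => a b; rewrite /ker/=; set q := 2 * (a ^+ 2 - b ^+ 2).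
have [q0|q0] := leP q 0.
  rewrite integral0_eq// => x _; rewrite /wt ifF//.
  by apply/negbTE; rewrite -leNgt -subr_le0 wt_ker -/q; have := sqr_ge0 (x - 2 * a); lra.
pose s := Num.sqrt q; have s0 : 0 < s by rewrite sqrtr_gt0.
have sq : s ^+ 2 = q by rewrite sqr_sqrtr// ltW.
pose u (x : R) := s * (s - (x - 2 * a)); pose v (x : R) := s * (s + (x - 2 * a)).
pose g x := (Num.sqrt (u x))^-1 + (Num.sqrt (v x))^-1.
pose G x := (Num.sqrt (v x) - Num.sqrt (u x)) * (2 / s).
have cu x : {for x, continuous u}.
  apply: cvgM; first exact: cvg_cst.
  by apply: cvgB; [exact: cvg_cst|apply: cvgB; [exact: cvg_id|exact: cvg_cst]].
have cv x : {for x, continuous v}.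
  apply: cvgM; first exact: cvg_cst.
  by apply: cvgD; [exact: cvg_cst|apply: cvgB; [exact: cvg_id|exact: cvg_cst]].
have csu x : {for x, continuous (fun x => Num.sqrt (u x))}.
  by apply: (@continuous_comp _ _ _ u (fun y : R => Num.sqrt y)) => //; exact: sqrt_continuous.
have csv x : {for x, continuous (fun x => Num.sqrt (v x))}.
  by apply: (@continuous_comp _ _ _ v (fun y : R => Num.sqrt y)) => //; exact: sqrt_continuous.
have pos x : 2 * a - s < x < 2 * a + s -> 0 < u x /\ 0 < v x.
  by move=> hx; split; rewrite mulr_gt0//; lra.
have lt2 : 2 * a - s < 2 * a + s by lra.
have cg x : 2 * a - s < x < 2 * a + s -> {for x, continuous g}.
  move=> /pos[u0 v0]; apply: cvgD; apply: cvgV; rewrite ?gt_eqF ?sqrtr_gt0//.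
  - exact: csu.
  - exact: csv.
have g0 x : 0 <= g x by rewrite addr_ge0// invr_ge0 sqrtr_ge0.
have key : (\int[mu]_(x in `](2 * a - s)%R, (2 * a + s)%R[) (g x)%:E = (G (2 * a + s) - G (2 * a - s))%:E)%E.
  apply: ge0_integral_FTC_oo => //.
  - move=> x /pos[u0 v0].
    have du : is_derive x 1 u (- s).
      have D := is_deriveZ s (is_deriveB (is_derive_cst s x 1) (is_deriveB (is_derive_id x (1 : R)) (is_derive_cst (2 * a) x 1))).
      by apply: (is_derive_eq D); rewrite subr0 sub0r [_ *: _]mulrN mulr1.
    have dv : is_derive x 1 v s.
      have D := is_deriveZ s (is_deriveD (is_derive_cst s x 1) (is_deriveB (is_derive_id x (1 : R)) (is_derive_cst (2 * a) x 1))).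
      by apply: (is_derive_eq D); rewrite subr0 add0r [_ *: _]mulr1.
    have dsu := @is_derive1_comp R _ u x _ _ (is_derive1_sqrt u0) du.
    have dsv := @is_derive1_comp R _ v x _ _ (is_derive1_sqrt v0) dv.
    have D := is_deriveZ (2 / s) (is_deriveB dsv dsu).
    have -> : G = (2 / s) \*: ((fun x => Num.sqrt (v x)) - (fun x => Num.sqrt (u x))).
      by apply/funext => y; rewrite /G mulrC.
    apply: (is_derive_eq D); rewrite /g.
    change (2 / s * ((2 * Num.sqrt (v x))^-1 * s - (2 * Num.sqrt (u x))^-1 * - s) =
      (Num.sqrt (u x))^-1 + (Num.sqrt (v x))^-1).
    have su0 : 0 < Num.sqrt (u x) by rewrite sqrtr_gt0.
    have sv0 : 0 < Num.sqrt (v x) by rewrite sqrtr_gt0.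
    move: (Num.sqrt (u x)) (Num.sqrt (v x)) su0 sv0 => U V U0 V0.
    clearbody s; clear -s0 U0 V0; field.
    by rewrite ?(gt_eqF s0) ?(gt_eqF U0) ?(gt_eqF V0).
  - by apply: cvgM; [apply: cvgB; [exact: csv|exact: csu]|exact: cvg_cst].
  - by apply: cvgM; [apply: cvgB; [exact: csv|exact: csu]|exact: cvg_cst].
apply: (@le_trans _ _ (\int[mu]_(x in `](2 * a - s)%R, (2 * a + s)%R[) (g x)%:E)%E).
  apply: integral_patch_le => //.
  - apply: measurable_funS (measurable_wt_sec (a, b)) => //.
  - apply: open_continuous_measurable_fun; first exact: interval_open.
    by move=> x; rewrite inE/= in_itv/=; exact: cg.
  - by move=> x _; exact: wt_ge0.
  move=> x _; rewrite {1}/wt; case: ifPn; last by rewrite eqxx.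
  rewrite -subr_gt0 wt_ker -/q -sq => h _.
  have h2 : 2 * a - s < x < 2 * a + s.
    have : (s - (x - 2 * a)) * (s + (x - 2 * a)) > 0 by move: h; rewrite !expr2; lra.
    by move=> h1; apply/andP; split; rewrite ltNge; apply/negP => h3; nra.
  split; first by rewrite /= in_itv.
  rewrite /wt ifT; last by rewrite -subr_gt0 wt_ker -/q -sq.
  rewrite wt_ker -/q -sq /g; have [u0 v0] := pos x h2.
  have su0 : 0 < Num.sqrt (u x) by rewrite sqrtr_gt0.
  have sv0 : 0 < Num.sqrt (v x) by rewrite sqrtr_gt0.
  have w0 : 0 < Num.sqrt (s ^+ 2 - (x - 2 * a) ^+ 2) by rewrite sqrtr_gt0.
  have [x2|x2] := leP 0 (x - 2 * a).
    apply: (@le_trans _ _ (Num.sqrt (u x))^-1); last by rewrite lerDl invr_ge0 ltW.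
    by rewrite lef_pV2 ?posrE// ler_wsqrtr// /u; nra.
  apply: (@le_trans _ _ (Num.sqrt (v x))^-1); last by rewrite lerDr invr_ge0 ltW.
  by rewrite lef_pV2 ?posrE// ler_wsqrtr// /v; nra.
rewrite key lee_fin /G.
have -> : v (2 * a + s) = 2 * s ^+ 2 by rewrite /v; ring.
have -> : u (2 * a + s) = 0 by rewrite /u; ring.
have -> : v (2 * a - s) = 0 by rewrite /v; ring.
have -> : u (2 * a - s) = 2 * s ^+ 2 by rewrite /u; ring.
rewrite sqrtr0 sqrtrM// sqrtr_sqr gtr0_norm//.
have h2 : Num.sqrt (2 : R) <= 3 / 2.
  by rewrite -[leRHS]ger0_norm ?divr_ge0// -sqrtr_sqr ler_wsqrtr//; lra.
have -> : (Num.sqrt 2 * s - 0) * (2 / s) - (0 - Num.sqrt 2 * s) * (2 / s) = 4 * Num.sqrt 2.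
  by field; rewrite gt_eqF.
lra.
Qed.

(** The integrand is at least [1 / s] wherever it is not 0. It remains to see that the part of []2a
    - s, 2a + s[] inside []0, 1/2[] has length at least [s / 6]; the part to the left of [m] is
    enough. *)
Lemma ker_ge (a b : R) : `|a - 2^-1| + `|b| < 2^-1 -> a <= 2^-1 -> `|b| <= 4^-1 ->
  (6^-1%:E <= ker (a, b))%E.
Proof.
move=> hD ha hb.
have ab : `|b| < a by move: hD; rewrite ler0_norm; lra.
have b0 := normr_ge0 b.
have bb : b ^+ 2 = `|b| ^+ 2 by rewrite real_normK ?num_real.
set q := 2 * (a ^+ 2 - b ^+ 2).
have q0 : 0 < q by rewrite /q bb !expr2; nra.
pose s := Num.sqrt q; have s0 : 0 < s by rewrite sqrtr_gt0.
have sq : s ^+ 2 = q by rewrite sqr_sqrtr// ltW.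
have s2a : s <= 2 * a.
  rewrite -(@ler_pXn2r _ 2)// ?nnegrE; [|lra|lra].
  by rewrite sq /q !expr2 -(expr2 b); have := sqr_ge0 b; have := sqr_ge0 a; rewrite !expr2; lra.
(* The quotient of [2a - 1/2] by [s] is largest at [a = 1/2], [|b| = 1/4], where its square is
   [2/3], below [25/36]. *)
have s56 : 2 * a - 2^-1 <= 5 / 6 * s.
  have [a4|a4] := leP (2 * a) (2^-1); first by lra.
  rewrite -(@ler_pXn2r _ 2)// ?nnegrE; [|lra|lra].
  rewrite exprMn sq /q bb; have : `|b| ^+ 2 <= 4^-1 ^+ 2 by rewrite lerXn2r// nnegrE; lra.
  by rewrite !expr2; nra.
pose m := Num.min (2 * a) 2^-1.
have m1 : m <= 2 * a by rewrite ge_min lexx.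
have m2 : m <= 2^-1 by rewrite ge_min lexx orbT.
have m3 : s / 6 <= m - (2 * a - s) by rewrite /m; case: (leP (2 * a) 2^-1) => _; lra.
apply: (@le_trans _ _ (\int[mu]_(x in `](2 * a - s)%R, m[) (s^-1)%R%:E)%E).
  pose J : set (measurableTypeR R) := `](2 * a - s), m[%classic.
  have -> : (\int[mu]_(x in J) (s^-1)%R%:E = (s^-1)%R%:E * mu J)%E by apply: integral_cst; exact: measurable_itv.
  rewrite lebesgue_measure_itv/= lte_fin ifT; last by lra.
  rewrite -EFinB -EFinM lee_fin.
  rewrite mulrC ler_pdivlMr//; lra.
apply: (@integral_patch_le _ _ (fun=> s^-1)) => //.
- by apply: measurable_funS (measurable_wt_sec (a, b)).
- by move=> x _; rewrite invr_ge0 ltW.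
- by move=> x _; exact: wt_ge0.
move=> x; rewrite /= !in_itv/= => /andP[x1 x2] _; split; first by apply/andP; split; lra.
have h : 0 < s ^+ 2 - (x - 2 * a) ^+ 2.
  have -> : s ^+ 2 - (x - 2 * a) ^+ 2 = (s - (x - 2 * a)) * (s + (x - 2 * a)) by ring.
  by rewrite mulr_gt0//; lra.
rewrite /wt ifT; last by rewrite -subr_gt0 wt_ker -/q -sq.
rewrite wt_ker -/q -sq lef_pV2 ?posrE ?sqrtr_gt0//.
rewrite -[leRHS]ger0_norm ?(ltW s0)// -sqrtr_sqr ler_wsqrtr// gerBl.
exact: sqr_ge0.
Qed.

End Moments.

(** * Averages over roots of unity *)

Section Plane.
Variable R : realType.
Local Notation C := (R[i]^o).
Local Notation RR := (R * R)%type.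
Local Notation normc := (@Normc.normc R).
Local Notation mu := (@lebesgue_measure R).
Local Notation mu2 := (mu \x mu)%E.

(** * Measurability of continuous functions on open subsets of the plane *)

Definition popen (U : set RR) := forall p, U p -> exists2 r : R, 0 < r &
  forall q : RR, `|q.1 - p.1| < r -> `|q.2 - p.2| < r -> U q.

(** The sigma-algebra is that of the product, so the open set is exhibited as the union of the
    countably many rational boxes it contains. *)
Lemma popen_measurable (U : set RR) : popen U -> measurable U.
Proof.
move=> oU.
pose box (q : rat * rat * rat) : set RR :=
  `](ratr q.1.1 - ratr q.2), (ratr q.1.1 + ratr q.2)[%classic `*`
  `](ratr q.1.2 - ratr q.2), (ratr q.1.2 + ratr q.2)[%classic.
pose B q : set RR := if `[< box q `<=` U >] then box q else set0.
have -> : U = \bigcup_q B q.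
  apply/seteqP; split=> p; last first.
    by move=> [q _]; rewrite /B; case: asboolP => // qU; exact: qU.
  move=> Up; have [r r0 rU] := oU _ Up.
  have r30 : r / 4 < r / 2 by lra.
  have [q /andP[q1 q2]] : exists q : rat, (r / 4 < ratr q) && (ratr q < r / 2).
    by have [q] := rat_in_itvoo r30; rewrite in_itv /=; exists q.
  have near (a : R) : exists s : rat, `|a - ratr s| < r / 4.
    have [|s] := @rat_in_itvoo _ (a - r / 4) (a + r / 4); first by lra.
    rewrite in_itv/= => /andP[s1 s2]; exists s; rewrite ltr_norml; lra.
  have [s1 ps1] := near p.1; have [s2 ps2] := near p.2.
  exists (s1, s2, q) => //; rewrite /B; case: asboolP => [_|]; last first.
    case=> w; rewrite /box/= !in_itv/= => -[/andP[w1 w2] /andP[w3 w4]].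
    move: ps1 ps2; rewrite !ltr_norml => /andP[p1 p2] /andP[p3 p4].
    by apply: rU; rewrite ltr_norml; lra.
  move: ps1 ps2; rewrite /box/= !in_itv/= !ltr_norml => /andP[p1 p2] /andP[p3 p4].
  by split; lra.
apply: countable_bigcupT_measurable => [|q]; first exact: countableP.
by rewrite /B; case: asboolP => _ //; exact: measurableX.
Qed.

Lemma popen_measurable_fun (U : set RR) (g : RR -> R) : popen U ->
  (forall p (e : R), U p -> 0 < e -> exists2 r : R, 0 < r &
    forall q : RR, `|q.1 - p.1| < r -> `|q.2 - p.2| < r -> `|g q - g p| < e) ->
  measurable_fun U g.
Proof.
move=> oU cg.
apply: (measurability _ (RGenOInfty.measurableE R)).
move=> _ [_ [a ->] <-]; apply: popen_measurable => p [Up].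
rewrite /= in_itv/= andbT => agp.
have [r r0 rU] := oU _ Up.
have [|s s0 sg] := cg p (g p - a) Up; first by rewrite subr_gt0.
exists (Num.min r s); first by rewrite lt_min r0.
move=> q; rewrite !lt_min => /andP[q1 q2] /andP[q3 q4]; split; first exact: rU.
rewrite /= in_itv/= andbT; have := sg q q2 q4; rewrite ltr_norml; lra.
Qed.

Definition toC (p : RR) : C := p.1 +i* p.2.

Lemma normc_toC p : normc (toC p) ^+ 2 = sqn p.
Proof. by rewrite sqr_normc. Qed.

Lemma normc_toCB p q : normc (toC q - toC p) <= `|q.1 - p.1| + `|q.2 - p.2|.
Proof. exact: normc_le_ReIm. Qed.

Lemma popen_copen (U : set C) : copen U -> popen [set p | U (toC p)].
Proof.
move=> oU p /oU[r r0 rU]; exists (r / 2) => [|q q1 q2 /=]; first by rewrite divr_gt0.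
have -> : toC q = toC p + (toC q - toC p) by rewrite addrC subrK.
by apply: rU; apply: le_lt_trans (normc_toCB _ _) _; lra.
Qed.

Lemma measurable_sqnormf (U : set C) (f : C -> C) : copen U -> holomorphic U f ->
  measurable_fun setT
    (fun p => (\1_([set p | U (toC p)]) p * normc (f (toC p)) ^+ 2 : R)).
Proof.
move=> oU hf; have pU := popen_copen oU.
have mU := popen_measurable pU.
have -> : (fun p => (\1_([set p | U (toC p)]) p * normc (f (toC p)) ^+ 2 : R)) =
          (fun p => normc (f (toC p)) ^+ 2) \_ [set p | U (toC p)].
  apply/funext => p; rewrite /patch indicE; case: ifP => _; first by rewrite mul1r.
  by rewrite mul0r.
apply/(measurable_restrictT _ mU).
apply: measurable_funX; apply: popen_measurable_fun => // p e Up e0.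
have [d d0 dP] := cdiff_continuous (derivable_cdiff (hf _ Up)) e0.
exists (d / 2) => [|q q1 q2]; first by rewrite divr_gt0.
have : normc (f (toC q) - f (toC p)) < e.
  by apply: dP; apply: le_lt_trans (normc_toCB _ _) _; lra.
apply: le_lt_trans; rewrite ler_norml; apply/andP; split.
  rewrite lerNl opprB lerBlDr normcB -{1}(subrK (f (toC q)) (f (toC p))).
  exact: normcD.
by rewrite lerBlDr -{1}(subrK (f (toC p)) (f (toC q))); exact: normcD.
Qed.

(** * Rotations of the plane and orthogonality over roots of unity *)

Definition rot (t : R) (p : RR) : RR :=
  (cos t * p.1 - sin t * p.2, sin t * p.1 + cos t * p.2).

Lemma toC_rot t p : toC (rot t p) = cis t * toC p.
Proof. by apply/eqP; rewrite eq_complex /= eqxx /= addrC. Qed.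

Lemma rotD s t p : rot s (rot t p) = rot (s + t) p.
Proof. by rewrite /rot/= cosD sinD; congr (_, _); ring. Qed.

Lemma ipres_rot t : ipres (rot t).
Proof.
have base s : cos s != -1 -> ipres (rot s).
  by apply: ipres_rotation; exact: cos2Dsin2.
have [c1|/base//] := eqVneq (cos t) (-1).
have -> : rot t = rot (t / 2) \o rot (t / 2).
  by apply/funext => p; rewrite /= rotD -splitr.
have h : cos (t / 2) != -1.
  apply/eqP => c2; have := cosD (t / 2) (t / 2); rewrite -splitr.
  have := cos2Dsin2 (t / 2); rewrite c1 c2; nra.
by apply: ipres_comp; exact: base.
Qed.

Lemma sqn_rot t p : sqn (rot t p) = sqn p.
Proof.
have := cos2Dsin2 t; rewrite /sqn/rot/= => h.
transitivity ((cos t ^+ 2 + sin t ^+ 2) * (p.1 ^+ 2 + p.2 ^+ 2)); first by ring.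
by rewrite h mul1r.
Qed.

Lemma cis_neq1 (t : R) : 0 < t -> t < pi *+ 2 -> cis t != 1.
Proof.
move=> t0 t2; apply/eqP => /(congr1 (@complex.Re R)) /=.
have s0 : 0 < sin (t / 2).
  by apply: sin_gt0_pi; apply/andP; split; rewrite ?divr_gt0//; move: t2; rewrite mulr2n; lra.
have := cosD (t / 2) (t / 2); rewrite -splitr.
have := cos2Dsin2 (t / 2) => h1 h2 h3.
have : 2 * sin (t / 2) ^+ 2 = 0 by lra.
have : 0 < sin (t / 2) ^+ 2 by rewrite exprn_gt0.
lra.
Qed.

Lemma cis0 : cis (0 : R) = 1. Proof. by rewrite /cis cos0 sin0. Qed.

Lemma cisX (t : R) n : cis t ^+ n = cis (n%:R * t).
Proof.
elim: n => [|n IH]; first by rewrite mul0r cis0.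
by rewrite [_ ^+ n.+1]exprS IH -cisD -natr1 mulrDl mul1r addrC.
Qed.

Lemma mulc_conj (z : C) : (normc z ^+ 2)%:C = z * conjc z.
Proof. by rewrite sqr_normc; case: z => a b; apply/eqP; rewrite eq_complex /=; apply/andP; split; apply/eqP; ring. Qed.

Lemma cis_conj (t : R) : conjc (cis t) = cis (- t).
Proof. by rewrite /cis cosN sinN. Qed.

Lemma roots_sum (M m n : nat) : (m < M)%N -> (n < M)%N -> m != n ->
  \sum_(k < M) cis (k%:R * (pi *+ 2 / M%:R)) ^+ m *
     conjc (cis (k%:R * (pi *+ 2 / M%:R)) ^+ n) = 0 :> C.
Proof.
move=> mM nM mn; have M0 : (0 < M)%N by apply: leq_ltn_trans mM.
have MR0 : 0 < M%:R :> R by rewrite ltr0n.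
set t := pi *+ 2 / M%:R.
pose w : C := cis ((m%:R - n%:R) * t).
have -> : \sum_(k < M) cis (k%:R * t) ^+ m * conjc (cis (k%:R * t) ^+ n) =
   \sum_(k < M) w ^+ k.
  apply: eq_bigr => k _; rewrite !cisX cis_conj -cisD; congr cis; ring.
have pi2 : 0 < pi *+ 2 :> R by rewrite mulr2n addr_gt0 ?pi_gt0.
have angle k l : (k < l)%N -> (l < M)%N -> cis ((l%:R - k%:R) * t) != 1 :> C.
  move=> kl lM; apply: cis_neq1.
    by rewrite mulr_gt0 ?subr_gt0 ?ltr_nat// divr_gt0.
  rewrite /t mulrCA gtr_pMr// ltr_pdivrMr// mul1r.
  by apply: (@le_lt_trans _ _ (l%:R : R)); rewrite ?ltr_nat// gerBl.
have w1 : w != 1.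
  have [lt_mn|lt_nm] : (m < n)%N \/ (n < m)%N by apply/orP; rewrite -neq_ltn.
    apply: contra_neq (angle _ _ lt_mn nM) => w1.
    have : w * cis ((n%:R - m%:R) * t) = 1.
      by rewrite /w -cisD -mulrDl addrA subrK subrr mul0r cis0.
    by rewrite w1 mul1r.
  exact: angle.
apply/(mulfI (x := w - 1)); first by rewrite subr_eq0.
rewrite -subrX1 mulr0 /w cisX.
have -> : M%:R * ((m%:R - n%:R) * t) = m%:R * (pi *+ 2) - n%:R * (pi *+ 2).
  by rewrite -mulrBl /t mulrCA; congr (_ * _); rewrite mulrC divfK// gt_eqF.
have per k : cis (k%:R * (pi *+ 2)) = 1 :> C.
  rewrite -cisX; have -> : cis (pi *+ 2) = 1 :> C; last by rewrite expr1n.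
  by rewrite /cis cos2pi sin2pi.
rewrite cisD per mul1r -cis_conj per.
by rewrite /= oppr0 subrr.
Qed.

(** A discrete Parseval identity, exact for fewer than [M] coefficients: two different exponents
    below [M] are incongruent modulo [M], so the cross terms are full geometric sums of a root of
    unity other than 1. *)
Lemma roots_mean (M : nat) (b : nat -> C) : (0 < M)%N ->
  \sum_(k < M) normc (\sum_(n < M) b n * cis (k%:R * (pi *+ 2 / M%:R)) ^+ n) ^+ 2 =
  M%:R * \sum_(n < M) normc (b n) ^+ 2.
Proof.
move=> M0; apply: (@complexI R).
have sumC (F : 'I_M -> R) : (\sum_i F i)%:C = \sum_i (F i)%:C by exact: rmorph_sum.
have conjS (F : 'I_M -> C) : conjc (\sum_i F i) = \sum_i conjc (F i) by exact: rmorph_sum.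
have conjM (z w : C) : conjc (z * w) = conjc z * conjc w by exact: rmorphM.
have MC (x y : R) : (x * y)%:C = x%:C * y%:C by exact: rmorphM.
have natC (k : nat) : (k%:R : R)%:C = k%:R by exact: rmorph_nat.
rewrite MC !sumC natC mulr_sumr.
under eq_bigr => k _.
  rewrite mulc_conj conjS mulr_suml.
  under eq_bigr => m _.
    rewrite mulr_sumr.
    under eq_bigr => n _ do rewrite conjM mulrACA.
    over.
  over.
rewrite exchange_big /=; apply: eq_bigr => m _.
rewrite exchange_big /= (bigD1 m)//= [X in _ + X]big1 ?addr0 => [|n nm].
  rewrite -mulr_sumr -mulc_conj mulrC; congr (_ * _).
  rewrite (eq_bigr (fun=> 1)) ?sumr_const ?card_ord// => k _.
  by rewrite -mulc_conj normcX normc_cis !expr1n.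
by rewrite -mulr_sumr roots_sum ?mulr0// eq_sym.
Qed.

Lemma psum_rot (a : nat -> C) (p : RR) M : (0 < M)%N ->
  \sum_(k < M) normc (psum a (toC (rot (k%:R * (pi *+ 2 / M%:R)) p)) M) ^+ 2 =
  M%:R * \sum_(n < M) normc (a n) ^+ 2 * sqn p ^+ n.
Proof.
move=> M0.
transitivity (\sum_(k < M) normc (\sum_(n < M) (a n * toC p ^+ n) *
    cis (k%:R * (pi *+ 2 / M%:R)) ^+ n) ^+ 2).
  have E t : psum a (toC (rot t p)) M = \sum_(n < M) (a n * toC p ^+ n) * cis t ^+ n.
    apply: eq_bigr => n _.
    by rewrite toC_rot exprMn_comm; [rewrite mulrCA mulrC|exact: mulrC].
  by apply: eq_bigr => k _; rewrite E.
rewrite (@roots_mean M (fun n => a n * toC p ^+ n))//; congr (_ * _).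
apply: eq_bigr => n _.
by rewrite normcM normcX exprMn -exprM mulnC exprM normc_toC.
Qed.

Lemma derivable_psum (a : nat -> C) N (w : C) : derivable (fun z => psum a z N : C) w 1.
Proof.
pose b n := if (n < N)%N then a n else 0.
have bser : pser (fun z => psum a z N) 0 (normc w + 1) b.
  move=> z _; rewrite add0r; apply/cvg_normc_seqP => e e0.
  exists N => M NM; rewrite (_ : psum b z M = psum a z N) ?subrr ?normc0//.
  rewrite /psum (big_ord_widen _ (fun n => a n * z ^+ n) NM) [RHS]big_mkcond /=.
  by apply: eq_bigr => n _; rewrite /b; case: ifP => // _; rewrite mul0r.
rewrite -[w]add0r; apply: (pser_derivable bser).
by rewrite ltrDl.
Qed.

Lemma measurable_psum_toC (a : nat -> C) N :
  measurable_fun setT (fun p => normc (psum a (toC p) N) ^+ 2).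
Proof.
have := @measurable_sqnormf setT (fun z => psum a z N).
have -> : [set p | (setT : set C) (toC p)] = setT by exact/seteqP.
move=> h; rewrite (_ : (fun p => _) = (fun p => (\1_setT p * normc (psum a (toC p) N) ^+ 2 : R))).
  by apply: h => z _; [exists 1|exact: derivable_psum].
by apply/funext => p; rewrite indicT mul1r.
Qed.

(** Rotations preserve plane measure, so the integral is the mean of its [N] rotated copies; summing
    under the integral, [psum_rot] leaves a function of [sqn p] alone. [Num.max 0] provides the
    nonnegativity for [t < 0] that [integral_radial] asks for. *)
Lemma integral_psum (a : nat -> C) N (V : R -> R) : (0 < N)%N -> measurable_fun setT V ->
  (forall t, 0 <= V t) ->
  (\int[mu2]_p (normc (psum a (toC p) N) ^+ 2 * V (sqn p))%:E =
   (kappa R)%:E * \int[mu]_(t in `]0%R, +oo[)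
     (Num.max 0 (\sum_(n < N) normc (a n) ^+ 2 * t ^+ n) * V t)%:E)%E.
Proof.
move=> N0 mV V0.
pose F p := (normc (psum a (toC p) N) ^+ 2 * V (sqn p))%:E.
have mVs : measurable_fun setT (V \o @sqn R).
  by apply: measurableT_comp => //; exact: measurable_sqn.
have mF : measurable_fun setT F.
  by apply/measurable_EFinP; apply: measurable_funM => //; exact: measurable_psum_toC.
have F0 p : (0 <= F p)%E by rewrite lee_fin mulr_ge0// sqr_ge0.
pose G t : R := Num.max 0 (\sum_(n < N) normc (a n) ^+ 2 * t ^+ n) * V t.
have mP : measurable_fun setT (fun t : R => \sum_(n < N) normc (a n) ^+ 2 * t ^+ n).
  by apply: measurable_sum => n; apply: measurable_funM; [exact: measurable_cst|exact: measurable_funX].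
have mG : measurable_fun setT G.
  by apply: measurable_funM => //; apply: measurable_maxr => //; exact: measurable_cst.
have G0 t : 0 <= G t by rewrite mulr_ge0// le_max lexx.
transitivity (\int[mu2]_p (G (sqn p))%:E)%E; last first.
  rewrite (@integral_radial R (fun t => (G t)%:E))//.
  exact/measurable_EFinP.
have M0 : (N%:R : R) != 0 by rewrite pnatr_eq0 -lt0n.
have key : (N%:R%:E * \int[mu2]_p F p = N%:R%:E * \int[mu2]_p (G (sqn p))%:E)%E.
  transitivity (\sum_(k < N) \int[mu2]_p F (rot (k%:R * (pi *+ 2 / N%:R)) p))%E.
    transitivity (\sum_(k < N) \int[mu2]_p F p)%E.
      by rewrite mule_natl sumr_const card_ord.
    apply: eq_bigr => k _.
    by have [_ ->] := ipres_rot (k%:R * (pi *+ 2 / N%:R)).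
  have mGs : measurable_fun setT (fun p => (G (sqn p))%:E).
    by apply/measurable_EFinP; apply: measurableT_comp => //; exact: measurable_sqn.
  rewrite -ge0_integralZl//; last first.
    by move=> p _; rewrite lee_fin.
  rewrite -ge0_integral_sum//; last first.
    by move=> k; apply: measurableT_comp => //; have [] := ipres_rot (k%:R * (pi *+ 2 / N%:R)).
  apply: eq_integral => p _.
  rewrite /F; under eq_bigr do rewrite sqn_rot.
  rewrite -EFinM sumEFin -mulr_suml psum_rot// /G -mulrA; congr (_ * (_ * _))%:E.
  by apply/esym/max_idPr; apply: sumr_ge0 => n _; rewrite mulr_ge0 ?sqr_ge0// exprn_ge0// sqn_ge0.
have := congr1 (fun x => (N%:R^-1)%:E * x)%E key.
by rewrite !muleA -!EFinM mulVf// !mul1e.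
Qed.

End Plane.

(** * The disc identity *)

Section Disc.
Variable R : realType.
Local Notation C := (R[i]^o).
Local Notation RR := (R * R)%type.
Local Notation normc := (@Normc.normc R).
Local Notation mu := (@lebesgue_measure R).
Local Notation mu2 := (mu \x mu)%E.

Lemma normc_dist (z w : C) : `|normc z - normc w| <= normc (z - w).
Proof.
rewrite ler_norml; apply/andP; split.
  by rewrite lerNl opprB lerBlDr normcB -{1}(subrK z w); exact: normcD.
by rewrite lerBlDr -{1}(subrK w z); exact: normcD.
Qed.

Lemma cvg_normc (u : nat -> C) (l : C) : u @ \oo --> l ->
  (fun n => normc (u n)) @ \oo --> normc l.
Proof.
move=> /cvg_normc_seqP ul; apply/cvgrPdist_lt => e e0.
have [N0 N0P] := ul e e0; exists N0 => // n /= N0n.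
by rewrite distrC; apply: le_lt_trans (normc_dist _ _) (N0P _ N0n).
Qed.

Lemma ecvg_unique (u : nat -> \bar R) (l m : \bar R) : u @ \oo --> l -> u @ \oo --> m -> l = m.
Proof. by move=> ul um; rewrite -(cvg_lim _ ul)// (cvg_lim _ um). Qed.

Lemma psum_cvg_weight f c rho a (V : R -> R) (p : RR) : pser f c rho a -> 0 <= rho ->
  (forall t, rho ^+ 2 <= t -> V t = 0) ->
  (fun N => (normc (psum a (toC p) N.+1) ^+ 2 * V (sqn p))%:E) @ \oo -->
    (normc (f (c + toC p)) ^+ 2 * V (sqn p))%:E.
Proof.
move=> fa rho0 V0.
have [pr|rp] := ltP (normc (toC p)) rho.
  apply: cvg_EFin; first exact: nearW.
  apply: cvgM; last exact: cvg_cst.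
  have h := cvg_normc (proj2 (@ccvg_shiftS _ _ _) (fa _ pr)).
  by apply: cvgM; exact: h.
rewrite V0; last by rewrite -normc_toC lerXn2r// nnegrE// normc_ge0.
rewrite mulr0; under eq_fun do rewrite mulr0; exact: cvg_cst.
Qed.

Lemma measurable_psum_weight (a : nat -> C) N (V : R -> R) : measurable_fun setT V ->
  measurable_fun setT (fun p => (normc (psum a (toC p) N) ^+ 2 * V (sqn p))%:E).
Proof.
move=> mV; apply/measurable_EFinP; apply: measurable_funM; first exact: measurable_psum_toC.
by apply: measurableT_comp => //; exact: measurable_sqn.
Qed.

Lemma measurable_pser_weight f c rho a (V : R -> R) : pser f c rho a -> 0 <= rho ->
  measurable_fun setT V -> (forall t, rho ^+ 2 <= t -> V t = 0) ->
  measurable_fun setT (fun p => (normc (f (c + toC p)) ^+ 2 * V (sqn p))%:E).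
Proof.
move=> fa rho0 mV V0.
apply: (@emeasurable_fun_cvg _ _ _ setT
  (fun N p => (normc (psum a (toC p) N.+1) ^+ 2 * V (sqn p))%:E)).
  by move=> N; exact: measurable_psum_weight.
by move=> p _; exact: (psum_cvg_weight fa rho0 V0).
Qed.

Lemma psum_bounded f c rho a r : pser f c rho a -> 0 <= r -> r < rho ->
  exists2 B, 0 <= B & forall w N, normc w <= r -> normc (psum a w N) <= B.
Proof.
move=> fa r0 rr.
pose s := (r + rho) / 2.
have [s0 rs srho] : [/\ 0 < s, r < s & s < rho] by rewrite /s; split; lra.
have [K KP] := pser_bound fa (ltW s0) srho.
pose q := r / s.
have q0 : 0 <= q by rewrite divr_ge0 // ltW.
have q1 : q < 1 by rewrite ltr_pdivrMr// mul1r.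
have K0 : 0 <= K by apply: le_trans (KP 0%N); rewrite expr0 mulr1 normc_ge0.
exists (K / (1 - q)) => [|w N wr]; first by rewrite divr_ge0// subr_ge0 ltW.
apply: le_trans (normc_sum _ _ _) _.
apply: (@le_trans _ _ (\sum_(n < N) K * q ^+ n)).
  apply: ler_sum => n _; rewrite normcM normcX.
  apply: (@le_trans _ _ (normc (a n) * r ^+ n)).
    by rewrite ler_wpM2l ?normc_ge0// lerXn2r// nnegrE// normc_ge0.
  have -> : r = s * q by rewrite /q mulrC divfK// gt_eqF.
  by rewrite exprMn mulrA ler_wpM2r// exprn_ge0.
rewrite -mulr_sumr ler_wpM2l//.
have q1' : 0 < 1 - q by rewrite subr_gt0.
rewrite -[leRHS]div1r ler_pdivlMr//.
have := subrX1 q N; have := exprn_ge0 N q0.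
by move: (q ^+ N) (\sum_(i < N) q ^+ i) => u v; lra.
Qed.

(* The cutoff [V = 0] beyond [r < rho] keeps the partial sums bounded, so that dominated
   convergence applies. *)
Lemma disc_cut f c rho a r (V : R -> R) : pser f c rho a -> 0 <= r -> r < rho ->
  measurable_fun setT V -> (forall t, 0 <= V t) ->
  (forall t, r ^+ 2 <= t -> V t = 0) ->
  (\int[mu]_(t in `]0%R, +oo[) (V t)%:E < +oo)%E ->
  (\int[mu2]_p (normc (f (c + toC p)) ^+ 2 * V (sqn p))%:E =
   (kappa R)%:E * \sum_(0 <= n <oo) \int[mu]_(t in `]0%R, +oo[)
     (normc (a n) ^+ 2 * t ^+ n * V t)%:E)%E.
Proof.
move=> fa r0 rr mV V0 Vr Vfin.
have rho0 : 0 <= rho by apply: ltW; apply: le_lt_trans rr.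
have Vrho t : rho ^+ 2 <= t -> V t = 0.
  by move=> h; apply: Vr; apply: le_trans h; rewrite lerXn2r// ?nnegrE// ltW.
have [B B0 BP] := psum_bounded fa r0 rr.
have mVs : measurable_fun setT (V \o @sqn R).
  by apply: measurableT_comp => //; exact: measurable_sqn.
pose F N p := (normc (psum a (toC p) N.+1) ^+ 2 * V (sqn p))%:E.
have lhs : (fun N => \int[mu2]_p F N p)%E @ \oo -->
    (\int[mu2]_p (normc (f (c + toC p)) ^+ 2 * V (sqn p))%:E)%E.
  have dct := @dominated_cvg _ _ R mu2 setT measurableT F
    (fun p => (normc (f (c + toC p)) ^+ 2 * V (sqn p))%:E) (fun p => (B ^+ 2 * V (sqn p))%:E).
  apply: dct => //.
  - by move=> N; exact: (measurable_psum_weight a N.+1 mV).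
  - by move=> p _; exact: (psum_cvg_weight fa rho0 Vrho).
  - apply/integrableP; split.
      by apply/measurable_EFinP; apply: measurable_funM => //; exact: measurable_cst.
    under eq_integral do rewrite gee0_abs ?lee_fin ?mulr_ge0 ?sqr_ge0// EFinM.
    rewrite ge0_integralZl//; last 3 first.
    + exact/measurable_EFinP.
    + by move=> p _; rewrite lee_fin.
    + by rewrite lee_fin sqr_ge0.
    rewrite (@integral_radial R (fun t => (V t)%:E))//; last exact/measurable_EFinP.
    by rewrite lte_mul_pinfty// ?lee_fin ?sqr_ge0// lte_mul_pinfty// lee_fin ltW// kappa_gt0.
  - move=> N p _; rewrite /F gee0_abs lee_fin; last by apply: mulr_ge0 => //; exact: sqr_ge0.
    have [pr|rp] := leP (normc (toC p)) r.
      by rewrite ler_wpM2r// lerXn2r ?nnegrE ?normc_ge0// BP.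
    by rewrite Vr ?mulr0// -normc_toC lerXn2r ?nnegrE ?normc_ge0// ltW.
pose I n := (\int[mu]_(t in `]0%R, +oo[) (normc (a n) ^+ 2 * t ^+ n * V t)%:E)%E.
have mI n : measurable_fun setT (fun t : R => normc (a n) ^+ 2 * t ^+ n * V t).
  apply: measurable_funM => //; apply: measurable_funM; first exact: measurable_cst.
  exact: measurable_funX.
have I0 n (t : R) : `]0%R, +oo[%classic t -> (0 <= (normc (a n) ^+ 2 * t ^+ n * V t)%:E)%E.
  rewrite /= in_itv/= andbT => t0; rewrite lee_fin; apply: mulr_ge0 => //.
  by apply: mulr_ge0; [exact: sqr_ge0|exact/exprn_ge0/ltW].
have FI N : (\int[mu2]_p F N p = (kappa R)%:E * \sum_(0 <= n < N.+1) I n)%E.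
  rewrite /F integral_psum//; congr (_ * _)%E.
  have mIE n : measurable_fun (`]0, +oo[%classic : set R) (fun t : R => (normc (a n) ^+ 2 * t ^+ n * V t)%:E).
    by apply: measurable_funTS; apply/measurable_EFinP.
  rewrite big_mkord -ge0_integral_sum//; last by move=> n t; exact: I0.
  apply: eq_integral => t; rewrite inE => t0; rewrite sumEFin -mulr_suml.
  congr (_ * _)%:E; apply/max_idPr; apply: sumr_ge0 => n _.
  move: t0; rewrite /= in_itv/= andbT => t0.
    by apply: mulr_ge0; [exact: sqr_ge0|exact/exprn_ge0/ltW].
  by move=> n; exact: mIE.
have rhs : (fun N => \int[mu2]_p F N p)%E @ \oo --> ((kappa R)%:E * \sum_(0 <= n <oo) I n)%E.
  under eq_fun do rewrite FI.
  apply: cvgeZl => //; rewrite (cvg_shiftS (fun N => \sum_(0 <= n < N) I n)%E).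
  by apply: is_cvg_nneseries => n _ _; apply: integral_ge0 => t; exact: I0.
exact: (ecvg_unique lhs rhs).
Qed.

(** Monotone convergence along growing sublevel sets of [s]. It removes the cutoff on both sides of
    the disc identity: in the plane with [s] the squared norm, on the half-line with [s] the
    identity. *)
Lemma cut_cvg d (T : measurableType d) (m : {measure set T -> \bar R}) (D : set T)
    (h : T -> \bar R) (s : T -> R) (b : nat -> R) : measurable D ->
  measurable_fun setT h -> measurable_fun setT s -> (forall x, D x -> 0 <= h x)%E ->
  {homo b : n m / (n <= m)%N >-> n <= m} ->
  (forall x, D x -> h x != 0%E -> exists k, s x < b k) ->
  (fun k => \int[m]_(x in D) (if (s x < b k)%R then h x else 0))%E @ \oo -->
    (\int[m]_(x in D) h x)%E.
Proof.
move=> mD mh ms h0 ndb hb.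
pose g k x := (if (s x < b k)%R then h x else 0)%E.
have mg k : measurable_fun D (g k).
  apply: measurable_funTS; apply: measurable_fun_ifT => //.
  by apply: measurable_fun_ltr => //; exact: measurable_cst.
have g0 k x : D x -> (0 <= g k x)%E by rewrite /g => Dx; case: ifP => // _; exact: h0.
have ndg x : D x -> {homo g^~ x : n m / (n <= m)%N >-> (n <= m)%E}.
  move=> Dx k l kl; rewrite /g; case: ltP => [sk|_].
    by rewrite (lt_le_trans sk (ndb _ _ kl)).
  by case: ifP => // _; exact: h0.
have := @cvg_monotone_convergence _ _ R m D mD g mg g0 ndg.
rewrite (_ : \int[m]_(x in D) (fun x0 : T => limn (g^~ x0)) x = \int[m]_(x in D) h x)%E //.
apply: eq_integral => x; rewrite inE => Dx.
apply: cvg_lim => //; apply: cvg_near_cst.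
have [hx0|/(hb _ Dx)[k sk]] := eqVneq (h x) 0%E.
  by apply: nearW => k; rewrite /g hx0; case: ifP.
by exists k => // l /= kl; rewrite /g (lt_le_trans sk (ndb _ _ kl)).
Qed.

Lemma wt_eq0 (x t : R) : x ^+ 2 <= 2 * t -> wt x t = 0.
Proof. by rewrite /wt leNgt => /negbTE ->. Qed.

(** [disc_cut] applies to the weight restricted to [t < b k], whose support stays away from the
    bounding circle. Both sides then increase to their limits, and [wt_moment] evaluates the
    moments; the factor [n!^2] cancels against the Taylor coefficients. *)
Theorem disc_identity (f : C -> C) (c : C) (x : R) : 0 < x ->
  (forall w, 2 * normc w ^+ 2 < x ^+ 2 -> derivable f (c + w) 1) ->
  (\int[mu2]_p (normc (f (c + toC p)) ^+ 2 * wt x (sqn p))%:E =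
   (kappa R)%:E * \sum_(0 <= n <oo)
     (cn R n * x ^+ (2 * n).+1 * normc (derive1n n f c) ^+ 2)%:E)%E.
Proof.
move=> x0 df.
pose rho := Num.sqrt (x ^+ 2 / 2).
have x20 : 0 < x ^+ 2 / 2 by rewrite divr_gt0// exprn_gt0.
have rho0 : 0 < rho by rewrite sqrtr_gt0.
have rho2 : rho ^+ 2 = x ^+ 2 / 2 by rewrite sqr_sqrtr// ltW.
pose a n : C := derive1n n f c / n`!%:R.
have fa : pser f c rho a.
  apply: taylor_series => // w wrho; apply: df.
  have : normc w ^+ 2 < rho ^+ 2 by rewrite ltrXn2r ?nnegrE ?normc_ge0 ?ltW.
  rewrite rho2; lra.
have mwt : measurable_fun setT (wt x) by apply: measurable_wt; [exact: measurable_cst|exact: measurable_id].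
have wt0 t : rho ^+ 2 <= t -> wt x t = 0 by move=> h; apply: wt_eq0; move: h; rewrite rho2; lra.
(* [b k] rises to [rho ^+ 2]. It may be negative for small [k]; then [Num.sqrt (b k)] is 0 and [V k]
   vanishes for [t >= 0]. *)
pose b k : R := rho ^+ 2 - k.+1%:R^-1.
have ndb : {homo b : n m / (n <= m)%N >-> n <= m}.
  by move=> n m nm; rewrite lerD2l lerN2 lef_pV2 ?posrE ?ltr0n// ler_nat.
have bex t : wt x t != 0 -> exists k, t < b k.
  move=> tw; have : t < rho ^+ 2 by rewrite ltNge; apply: contra_neqN tw => /wt0.
  by move=> /ltr_add_invr[k kP]; exists k; rewrite ltrBrDr.
pose V k t := if t < b k then wt x t else 0.
have mV k : measurable_fun setT (V k).
  apply: measurable_fun_ifT => //; apply: measurable_fun_ltr => //; exact: measurable_cst.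
have V0 k t : 0 <= V k t by rewrite /V; case: ifP => // _; exact: wt_ge0.
have Vwt k t : V k t <= wt x t by rewrite /V; case: ifP => // _; exact: wt_ge0.
have fin k : (\int[mu]_(t in `]0%R, +oo[) (V k t)%:E < +oo)%E.
  apply: (@le_lt_trans _ _ (\int[mu]_(t in `]0%R, +oo[) (t ^+ 0 * wt x t)%:E)%E); last by rewrite wt_moment// ltry.
  apply: ge0_le_integral => //.
  - by move=> t _; rewrite lee_fin.
  - by apply: measurable_funTS; apply/measurable_EFinP; exact: mV.
  - by apply: measurable_funTS; apply/measurable_EFinP; apply: measurable_funM.
  - by move=> t _; rewrite expr0 mul1r lee_fin.
have cut k : (\int[mu2]_p (normc (f (c + toC p)) ^+ 2 * V k (sqn p))%:E =
   (kappa R)%:E * \sum_(0 <= n <oo) \int[mu]_(t in `]0%R, +oo[)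
     (normc (a n) ^+ 2 * t ^+ n * V k t)%:E)%E.
  apply: (@disc_cut _ _ _ _ (Num.sqrt (b k)) _ fa) => //.
    by rewrite ltr_sqrt// /b rho2 gtrDl oppr_lt0 invr_gt0.
  move=> t bt; rewrite /V ltNge; have -> // : b k <= t.
  have [b0|/ltW b0] := leP 0 (b k); first by rewrite -(sqr_sqrtr b0).
  by apply: le_trans bt; apply: le_trans b0 _; exact: sqr_ge0.
pose h p := (normc (f (c + toC p)) ^+ 2 * wt x (sqn p))%:E.
have mh : measurable_fun setT h by exact: (measurable_pser_weight fa (ltW rho0) mwt wt0).
have lhs : (fun k => \int[mu2]_p (normc (f (c + toC p)) ^+ 2 * V k (sqn p))%:E)%E @ \oo -->
    (\int[mu2]_p h p)%E.
  have L := @cut_cvg _ _ mu2 setT h (@sqn R) b measurableT mh (@measurable_sqn R).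
  rewrite (_ : (fun k => _) = (fun k => \int[mu2]_p (if (sqn p < b k)%R then h p else 0))%E); last first.
    apply/funext => k; apply: eq_integral => p _; rewrite /V /h; case: ifP => // _.
    by rewrite mulr0.
  apply: L => // [p _|p _ hp].
    by rewrite lee_fin; apply: mulr_ge0; [exact: sqr_ge0|exact: wt_ge0].
  by apply: bex; apply: contra_neq hp => w0; rewrite /h w0 mulr0.
(* The absolute value makes [G n] nonnegative on the whole line; on the domain of integration
   [t > 0] it changes nothing. *)
pose G n (t : R) := (normc (a n) ^+ 2 * `|t| ^+ n * wt x t)%:E.
have mabs (n : nat) : measurable_fun setT (fun t : R => normc (a n) ^+ 2 * `|t| ^+ n : R).
  apply: measurable_funM; first exact: measurable_cst.
  by apply: measurable_funX; exact: (@normr_measurable R setT).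
have mG n : measurable_fun setT (G n) by apply/measurable_EFinP; apply: (measurable_funM (mabs n) mwt).
have G0 n t : (0 <= G n t)%E.
  rewrite lee_fin; apply: mulr_ge0; last exact: wt_ge0.
  by apply: mulr_ge0; [exact: sqr_ge0|exact: exprn_ge0].
pose H t := (\sum_(0 <= n <oo) G n t)%E.
have mH : measurable_fun setT H.
  by apply: ge0_emeasurable_sum.
have H0 t : (0 <= H t)%E by apply: nneseries_ge0 => n _ _; exact: G0.
have mI : measurable (`]0, +oo[%classic : set R) by exact: (measurable_itv (R := R)).
have mpow n (W : R -> R) : measurable_fun setT W ->
    measurable_fun setT (fun t : R => normc (a n) ^+ 2 * t ^+ n * W t).
  move=> mW; apply: measurable_funM => //; apply: measurable_funM; first exact: measurable_cst.
  exact: measurable_funX.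
have mpow0 n : measurable_fun setT (fun t : R => t ^+ n * wt x t).
  by apply: measurable_funM => //; exact: measurable_funX.
have rhs : (fun k => (kappa R)%:E * \sum_(0 <= n <oo) \int[mu]_(t in `]0%R, +oo[)
     (normc (a n) ^+ 2 * t ^+ n * V k t)%:E)%E @ \oo -->
   ((kappa R)%:E * \sum_(0 <= n <oo)
     (cn R n * x ^+ (2 * n).+1 * normc (derive1n n f c) ^+ 2)%:E)%E.
  apply: cvgeZl => //.
  have E k : (\sum_(0 <= n <oo) \int[mu]_(t in `]0%R, +oo[)
      (normc (a n) ^+ 2 * t ^+ n * V k t)%:E = \int[mu]_(t in `]0%R, +oo[)
      (if (t < b k)%R then H t else 0))%E.
    rewrite -integral_nneseries//; last 2 first.
    - move=> n; apply: measurable_funTS; apply/measurable_EFinP; exact: (mpow n _ (mV k)).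
    - move=> n t; rewrite /= in_itv/= andbT => t0; rewrite lee_fin; apply: mulr_ge0 => //.
      by apply: mulr_ge0; [exact: sqr_ge0|exact/exprn_ge0/ltW].
    apply: eq_integral => t; rewrite inE /= in_itv/= andbT => t0.
    rewrite /V; case: ifP => _.
      by apply: eq_eseriesr => n _; rewrite /G gtr0_norm.
    by apply: eseries0 => n _ _; rewrite mulr0.
  under eq_fun do rewrite E.
  have -> : (\sum_(0 <= n <oo) (cn R n * x ^+ (2 * n).+1 * normc (derive1n n f c) ^+ 2)%:E =
      \int[mu]_(t in `]0%R, +oo[) H t)%E.
    rewrite integral_nneseries//; last by move=> n; exact: (measurable_funTS (mG n)).
    apply: eq_eseriesr => n _.
    transitivity ((normc (a n) ^+ 2)%:E * \int[mu]_(t in `]0%R, +oo[) (t ^+ n * wt x t)%:E)%E.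
      rewrite wt_moment// -EFinM /a normcM normcV normc_nat; congr _%:E.
      have : (n`!%:R : R) != 0 by rewrite pnatr_eq0 -lt0n fact_gt0.
      by move: (n`!%:R : R) (cn R n) (x ^+ (2 * n).+1) => u v w u0; field.
    rewrite -ge0_integralZl//; last 3 first.
    - apply: measurable_funTS; apply/measurable_EFinP; exact: mpow0.
    - move=> t; rewrite /= in_itv/= andbT => t0; rewrite lee_fin.
      by apply: mulr_ge0; [exact/exprn_ge0/ltW|exact: wt_ge0].
    - by rewrite lee_fin sqr_ge0.
    apply: eq_integral => t; rewrite inE /= in_itv/= andbT => t0.
    by rewrite -EFinM /G gtr0_norm// mulrA.
  have L := @cut_cvg _ _ mu (`]0, +oo[%classic : set R) H id b mI mH (@measurable_id _ _ _).
  apply: L => // t t0 Ht; apply: bex; apply: contra_neq Ht => w0.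
  by apply: eseries0 => n _ _; rewrite /G w0 mulr0.
move: lhs; under eq_fun do rewrite cut; move=> lhs.
exact: (ecvg_unique lhs rhs).
Qed.

End Disc.

(** * The contribution of one corner *)

Section Corner.
Variable R : realType.
Local Notation C := (R[i]^o).
Local Notation RR := (R * R)%type.
Local Notation normc := (@Normc.normc R).
Local Notation mu := (@lebesgue_measure R).
Local Notation mu2 := (mu \x mu)%E.
Local Notation I := (`]0%R, 2^-1%R[%classic : set R).
Local Notation D := (@square R).

Lemma copen_square : copen D.
Proof.
move=> z zD; exists ((2^-1 - (`|complex.Re z - 2^-1| + `|complex.Im z|)) / 2).
  by rewrite divr_gt0// subr_gt0.
move=> w wr.
have h1 := le_lt_trans (normc_Re w) wr; have h2 := le_lt_trans (normc_Im w) wr.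
have h3 : complex.Re (z + w) = complex.Re z + complex.Re w by case: z w {zD wr h1 h2} => ? ? [].
have h4 : complex.Im (z + w) = complex.Im z + complex.Im w by case: z w {zD wr h1 h2 h3} => ? ? [].
rewrite /square /= h3 h4 addrAC.
have := ler_normD (complex.Re z - 2^-1) (complex.Re w).
have := ler_normD (complex.Im z) (complex.Im w).
move: h1 h2; move: (`|_|) (`|_|) (`|_|) (`|_|) (`|_|) (`|_|) => a b c d e f; lra.
Qed.

(** By the Cauchy-Schwarz inequality the Euclidean disc of radius [x / sqrt 2] lies in the diamond
    [|a| + |b| < x], a shrunken copy of the square with a vertex at the origin of the diagonal. *)
Lemma disc_bound (a b x : R) : 0 < x -> 2 * (a ^+ 2 + b ^+ 2) < x ^+ 2 -> `|a| + `|b| < x.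
Proof.
move=> x0 h; rewrite -(@ltr_pXn2r _ 2) ?nnegrE ?addr_ge0 ?(ltW x0)//; apply: le_lt_trans h.
rewrite -(real_normK (num_real a)) -(real_normK (num_real b)).
by have := sqr_ge0 (`|a| - `|b|); lra.
Qed.

Lemma square_disc (x : R) (w : C) : 0 < x -> x <= 2^-1 -> 2 * normc w ^+ 2 < x ^+ 2 ->
  D (hdiag x + w).
Proof.
move=> x0 x2; rewrite sqr_normc => /(disc_bound x0).
case: w => a b /=; rewrite /square /= add0r => h.
have := ler_normD (x - 2^-1) a; rewrite [x - 2^-1 + a]addrAC.
have -> : `|x - 2^-1| = 2^-1 - x by rewrite ler0_norm ?opprB// subr_le0.
move: h; move: (`|_|) (`|_|) (`|_|) => u v t; lra.
Qed.

Lemma square_hdiag (x : R) : I x -> D (hdiag x).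
Proof.
rewrite /= in_itv/= => /andP[x0 x2]; rewrite -[hdiag x]addr0.
by apply: square_disc => //; rewrite ?ltW// normc0 expr0n mulr0 exprn_gt0.
Qed.

Definition corner (f : C -> C) : \bar R :=
  (\sum_(0 <= n <oo) ((cn R n)%:E * \int[mu]_(x in `]0%R, 2^-1%R[)
     (x ^+ (2 * n).+1 * normc (derive1n n f (hdiag x)) ^+ 2)%:E))%E.

Definition dens (f : C -> C) (p : RR) : R :=
  \1_([set p | D (toC p)]) p * normc (f (toC p)) ^+ 2.

Lemma dens_ge0 f p : 0 <= dens f p.
Proof. by apply: mulr_ge0; [rewrite indicE|exact: sqr_ge0]. Qed.

Lemma measurable_dens f : holomorphic D f -> measurable_fun setT (dens f).
Proof. by move=> hf; apply: measurable_sqnormf => //; exact: copen_square. Qed.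

Lemma measurable_hdiag g : holomorphic D g ->
  measurable_fun I (fun x => normc (g (hdiag x)) ^+ 2).
Proof.
move=> hg; apply: (@eq_measurable_fun _ _ _ _ _ (fun x : R => dens g (x, 0))).
  move=> x; rewrite inE => xI; rewrite /dens indicE mem_set ?mul1r//.
  exact: square_hdiag.
apply: measurable_funTS; apply: (measurableT_comp (measurable_dens hg)).
by apply: measurable_pair2; [exact: measurable_id|exact: measurable_cst].
Qed.

Lemma sqnormL2_dens f : sqnormL2 D f = (\int[mu2]_p (dens f p)%:E)%E.
Proof.
rewrite /sqnormL2 integral_mkcond; apply: eq_integral => p _.
by rewrite /patch /dens indicE; case: ifPn => _; rewrite ?mul1r ?mul0r.
Qed.

(** The weight vanishes off the disc, and [square_disc] puts the disc inside the square; hence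
    extending [|f|^2] by 0 outside the square does not alter the integrand of [disc_identity]. *)
Lemma corner_inner f x : holomorphic D f -> I x ->
  (\int[mu2]_q (dens f q * wt x ((q.1 - x) ^+ 2 + q.2 ^+ 2))%:E =
   (kappa R)%:E * \sum_(0 <= n <oo)
     (cn R n * x ^+ (2 * n).+1 * normc (derive1n n f (hdiag x)) ^+ 2)%:E)%E.
Proof.
move=> hf /= xI; move: (xI); rewrite in_itv/= => /andP[x0 x2].
rewrite -disc_identity//; last by move=> w wx; apply: hf; apply: square_disc (ltW _) wx.
pose F q := (dens f q * wt x ((q.1 - x) ^+ 2 + q.2 ^+ 2))%:E.
have mF : measurable_fun setT F.
  apply/measurable_EFinP; apply: (measurable_funM (measurable_dens hf)).
  apply: (@measurable_wt _ _ _ (fun=> x) (fun q : RR => (q.1 - x) ^+ 2 + q.2 ^+ 2)).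
    exact: measurable_cst.
  apply: measurable_funD; apply: measurable_funX; last exact: measurable_snd.
  by apply: measurable_funB; [exact: measurable_fst|exact: measurable_cst].
have F0 q : (0 <= F q)%E.
  by rewrite lee_fin; apply: mulr_ge0; [exact: dens_ge0|exact: wt_ge0].
have [_ Tr] := ipres_translation x 0.
transitivity (\int[mu2]_p F (p.1 + x, p.2 + 0)%R)%E; first by rewrite Tr.
apply: eq_integral => p _; rewrite /F /= addr0 addrK -/(sqn p); congr _%:E.
have [w0|wn0] := eqVneq (wt x (sqn p)) 0; first by rewrite w0 !mulr0.
have E : toC (p.1 + x, p.2) = hdiag x + toC p.
  by apply/eqP; rewrite eq_complex/= add0r [x + _]addrC !eqxx.
rewrite /dens E indicE mem_set ?mul1r//= E; apply: square_disc => //; first exact: ltW.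
by rewrite normc_toC ltNge; apply: contra_neqN wn0; exact: wt_eq0.
Qed.

(** For Tonelli's theorem on the product of the line of centers [x] with the plane. *)
Lemma sigma_finite_mu2 : sigma_finite setT mu2.
Proof.
exists (fun n => [set p : RR | sqn p <= n%:R]).
  apply/seteqP; split=> p // _; exists (Num.truncn (sqn p)).+1 => //=.
  by apply: ltW; exact: truncnS_gt.
move=> n; split; first exact: measurable_sqn_le.
by rewrite mu2_disc ltry.
Qed.

Theorem corner_ker f : holomorphic D f ->
  ((kappa R)%:E * corner f = \int[mu2]_q ((dens f q)%:E * ker q))%E.
Proof.
move=> hf.
have hfn n : holomorphic D (derive1n n f).
  by apply: holomorphic_derive1n => //; exact: copen_square.
pose T := measurableTypeR R.
pose G (z : T * (T * T)) : \bar R :=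
  (\1_I z.1 * (dens f z.2 * wt z.1 ((z.2.1 - z.1) ^+ 2 + z.2.2 ^+ 2)))%:E.
have G0 z : (0 <= G z)%E.
  rewrite lee_fin; apply: mulr_ge0; first by rewrite indicE.
  by apply: mulr_ge0; [exact: dens_ge0|exact: wt_ge0].
have mI : measurable I by exact: (measurable_itv (R := R)).
have mG : measurable_fun setT G.
  apply/measurable_EFinP; apply: measurable_funM.
    by apply: (measurableT_comp (measurable_indic mI)); exact: measurable_fst.
  have m2 : measurable_fun setT (fun z : T * (T * T) => z.2) by exact: measurable_snd.
  apply: measurable_funM; first exact: (measurableT_comp (measurable_dens hf) m2).
  apply: measurable_wt; first exact: measurable_fst.
  apply: measurable_funD; apply: measurable_funX.
    apply: measurable_funB; last exact: measurable_fst.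
    by apply: measurableT_comp m2; exact: measurable_fst.
  by apply: measurableT_comp m2; exact: measurable_snd.
pose sfm := @Measure_isSigmaFinite.Build _ _ R mu2 sigma_finite_mu2.
pose m2 : {sigma_finite_measure set _ -> \bar R} := HB.pack mu2 sfm.
have swap : (\int[mu]_x \int[mu2]_q G (x, q) = \int[mu2]_q \int[mu]_x G (x, q))%E.
  exact: (@fubini_tonelli _ _ _ _ R mu m2 G mG G0).
transitivity (\int[mu]_x \int[mu2]_q G (x, q))%E; last first.
  rewrite swap; apply: eq_integral => q _.
  rewrite /ker -ge0_integralZl ?lee_fin ?dens_ge0//; last 2 first.
  - by apply: measurable_funTS; apply/measurable_EFinP; exact: measurable_wt_sec.
  - by move=> x _; rewrite lee_fin; exact: wt_ge0.
  rewrite [RHS]integral_mkcond; apply: eq_integral => x _; rewrite /patch /G indicE /=.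
  by case: ifP => _; rewrite ?mul1r ?mul0r// EFinM.
transitivity (\int[mu]_(x in `]0%R, 2^-1%R[) ((kappa R)%:E * \sum_(0 <= n <oo)
     (cn R n * x ^+ (2 * n).+1 * normc (derive1n n f (hdiag x)) ^+ 2)%:E))%E; last first.
  rewrite [LHS]integral_mkcond; apply: eq_integral => x _; rewrite /patch.
  case: ifPn => xI; last first.
    by rewrite integral0_eq// => q _; rewrite /G/= indicE (negbTE xI) mul0r.
  rewrite -corner_inner//; last by rewrite inE in xI.
  by apply: eq_integral => q _; rewrite /G/= indicE xI mul1r.
have mt n : measurable_fun I (fun x : R => x ^+ (2 * n).+1 * normc (derive1n n f (hdiag x)) ^+ 2).
  by apply: (measurable_funM _ (measurable_hdiag (hfn n))); exact: measurable_funX.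
have mct n : measurable_fun I (fun x : R =>
    (cn R n * x ^+ (2 * n).+1 * normc (derive1n n f (hdiag x)) ^+ 2)%:E).
  apply/measurable_EFinP.
  rewrite (_ : (fun x => _) = (fun x : R => cn R n * (x ^+ (2 * n).+1 * normc (derive1n n f (hdiag x)) ^+ 2))).
    by apply: (measurable_funM _ (mt n)); exact: measurable_cst.
  by apply/funext => x; rewrite mulrA.
have t0 n x : I x -> 0 <= x ^+ (2 * n).+1 * normc (derive1n n f (hdiag x)) ^+ 2.
  rewrite /= in_itv/= => /andP[x0 _].
  by apply: mulr_ge0; [exact/exprn_ge0/ltW|exact: sqr_ge0].
have ct0 n x : I x -> (0 <= (cn R n * x ^+ (2 * n).+1 * normc (derive1n n f (hdiag x)) ^+ 2)%:E)%E.
  by move=> /(t0 n) h; rewrite lee_fin -mulrA mulr_ge0// ltW// cn_gt0.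
have S0 x : I x -> (0 <= \sum_(0 <= n <oo)
    (cn R n * x ^+ (2 * n).+1 * normc (derive1n n f (hdiag x)) ^+ 2)%:E)%E.
  by move=> xI; apply: nneseries_ge0 => n _ _; exact: ct0.
have mS : measurable_fun I (fun x => \sum_(0 <= n <oo)
    (cn R n * x ^+ (2 * n).+1 * normc (derive1n n f (hdiag x)) ^+ 2)%:E)%E.
  by apply: (ge0_emeasurable_sum (P := xpredT)) => // n x xI _; exact: ct0.
have k0 : (0 <= (kappa R)%:E)%E by rewrite lee_fin ltW// kappa_gt0.
rewrite ge0_integralZl//; congr (_ * _)%E.
rewrite integral_nneseries//; apply: eq_eseriesr => n _.
have c0 : (0 <= (cn R n)%:E)%E by rewrite lee_fin ltW// cn_gt0.
have mtE : measurable_fun I (fun x : R => (x ^+ (2 * n).+1 * normc (derive1n n f (hdiag x)) ^+ 2)%:E).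
  by apply/measurable_EFinP.
have tE0 x : I x -> (0 <= (x ^+ (2 * n).+1 * normc (derive1n n f (hdiag x)) ^+ 2)%:E)%E.
  by move=> xI; rewrite lee_fin; exact: t0.
rewrite -ge0_integralZl//.
by apply: eq_integral => x _; rewrite -EFinM mulrA.
Qed.

End Corner.

(** * The four corners *)

Section Estimate.
Variable R : realType.
Local Notation C := (R[i]^o).
Local Notation RR := (R * R)%type.
Local Notation normc := (@Normc.normc R).
Local Notation mu := (@lebesgue_measure R).
Local Notation mu2 := (mu \x mu)%E.
Local Notation I := (`]0%R, 2^-1%R[%classic : set R).
Local Notation D := (@square R).

Definition cser (A : nat -> R -> R) : \bar R :=
  (\sum_(0 <= n <oo) ((cn R n)%:E * \int[mu]_(x in `]0%R, 2^-1%R[)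
     (x ^+ (2 * n).+1 * A n x)%:E))%E.

Definition good (A : nat -> R -> R) :=
  (forall n x, 0 <= A n x) /\ (forall n, measurable_fun I (A n)).

Lemma cser_term_ge0 (A : nat -> R -> R) n x : good A -> I x ->
  (0 <= (x ^+ (2 * n).+1 * A n x)%:E)%E.
Proof.
move=> [A0 _]; rewrite /= in_itv/= => /andP[x0 _].
by rewrite lee_fin; apply: mulr_ge0 => //; exact/exprn_ge0/ltW.
Qed.

Lemma measurable_cser_term (A : nat -> R -> R) n : good A ->
  measurable_fun I (fun x : R => (x ^+ (2 * n).+1 * A n x)%:E).
Proof.
by move=> [_ mA]; apply/measurable_EFinP; apply: (measurable_funM _ (mA n)); exact: measurable_funX.
Qed.

Lemma cserD (A B : nat -> R -> R) : good A -> good B ->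
  cser (fun n x => A n x + B n x) = (cser A + cser B)%E.
Proof.
move=> gA gB.
have i0 E n : good E -> (0 <= (cn R n)%:E * \int[mu]_(x in `]0%R, 2^-1%R[)
     (x ^+ (2 * n).+1 * E n x)%:E)%E.
  move=> gE; apply: mule_ge0; first by rewrite lee_fin ltW// cn_gt0.
  by apply: integral_ge0 => x; exact: cser_term_ge0.
rewrite /cser -nneseriesD; last 2 first.
- by move=> n _ _; exact: i0.
- by move=> n _ _; exact: i0.
apply: eq_eseriesr => n _; rewrite -ge0_muleDr; last 2 first.
- by apply: integral_ge0 => x; exact: cser_term_ge0.
- by apply: integral_ge0 => x; exact: cser_term_ge0.
congr (_ * _)%E; rewrite -ge0_integralD//.
- by apply: eq_integral => x _; rewrite mulrDr EFinD.
- by move=> x; exact: cser_term_ge0.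
- exact: measurable_cser_term.
- by move=> x; exact: cser_term_ge0.
- exact: measurable_cser_term.
Qed.

Lemma goodD A B : good A -> good B -> good (fun n x => A n x + B n x).
Proof.
move=> [A0 mA] [B0 mB]; split=> [n x|n]; first by rewrite addr_ge0.
exact: measurable_funD.
Qed.

Lemma eq_cser A B : (forall n x, I x -> A n x = B n x) -> cser A = cser B.
Proof.
move=> AB; apply: eq_eseriesr => n _; congr (_ * _)%E.
by apply: eq_integral => x; rewrite inE => xI; rewrite AB.
Qed.

Lemma cser_ge0 A : good A -> (0 <= cser A)%E.
Proof.
move=> gA; apply: nneseries_ge0 => n _ _; apply: mule_ge0; first by rewrite lee_fin ltW// cn_gt0.
by apply: integral_ge0 => x; exact: cser_term_ge0.
Qed.

Definition nsq (u : nat -> R -> C) n x : R := normc (u n x) ^+ 2.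

Lemma diag_sum_cser (h v : nat -> R -> C) :
  let h' n x := h n (1 - x) in
  let v1 n x := v n (2^-1 - x) in let v2 n x := v n (x - 2^-1) in
  good (nsq h) -> good (nsq h') -> good (nsq v1) -> good (nsq v2) ->
  (diag_sum h v = cser (nsq h) + cser (nsq h') + cser (nsq v1) + cser (nsq v2))%E.
Proof.
move=> h' v1 v2 g1 g2 g3 g4; rewrite -cserD// -cserD//; last exact: goodD.
by rewrite -cserD//; apply: goodD => //; exact: goodD.
Qed.

(** * The quarter turn, which carries one vertex to the other three *)

Definition cI : C := 0 +i* 1.
Lemma normc_cI : normc cI = 1.
Proof. by rewrite /Normc.normc /= expr0n expr1n add0r sqrtr1. Qed.

(* The quarter turn about the center of the square. *)
Definition qt (z : C) : C := (2^-1 - complex.Im z) +i* (complex.Re z - 2^-1).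

Lemma qtD z h : qt (z + h) = qt z + cI * h.
Proof.
case: z h => a b [u v]; apply/eqP; rewrite eq_complex /=; apply/andP; split; apply/eqP; ring.
Qed.

Lemma cdiff_qt z : cdiff qt z cI.
Proof.
move=> e e0; exists 1 => // h _; rewrite qtD addrAC addrK subrr normc0.
by rewrite mulr_ge0 ?normc_ge0// ltW.
Qed.

Lemma square_qt z : D (qt z) <-> D z.
Proof. by rewrite /square /= addrAC subrr add0r normrN addrC. Qed.

Lemma square_iter_qt j z : D (iter j qt z) <-> D z.
Proof. by elim: j => //= j IH; rewrite square_qt. Qed.

Lemma qt4 z : qt (qt (qt (qt z))) = z.
Proof.
case: z => a b; apply/eqP; rewrite eq_complex /=; apply/andP; split; apply/eqP; ring.
Qed.

Lemma holomorphic_qt f : holomorphic D f -> holomorphic D (f \o qt).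
Proof.
move=> hf z zD; apply: cdiff_derivable (cdiff_comp (cdiff_qt z) (derivable_cdiff _)).
by apply: hf; apply/square_qt.
Qed.

Lemma holomorphic_iter_qt j f : holomorphic D f -> holomorphic D (f \o iter j qt).
Proof.
elim: j f => [|j IH] f hf; first exact: hf.
exact: (IH (f \o qt) (holomorphic_qt hf)).
Qed.

Lemma derive1n_qt n f z : holomorphic D f -> D z ->
  derive1n n (f \o qt) z = cI ^+ n * derive1n n f (qt z).
Proof.
move=> hf; elim: n z => [|n IH] z zD; first by rewrite mul1r.
have qD : D (qt z) by apply/square_qt.
have dn := derivable_cdiff (holomorphic_derive1n (n := n) (@copen_square R) hf qD).
have [r r0 rD] := @copen_square R z zD.
rewrite !derive1nS; apply: cdiff_derive1.
apply: (@cdiff_near _ (fun w => cI ^+ n * derive1n n f (qt w)) _ _ _ r r0).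
  by move=> w wr; rewrite IH// -(subrK z w) addrC; exact: rD.
have h := cdiff_comp (cdiff_qt z) dn.
move=> e e0; have [d d0 dP] := h e e0; exists d => // u ud.
have le := dP u ud.
rewrite [X in normc X](_ : _ = cI ^+ n * (derive1n n f (qt (z + u)) - derive1n n f (qt z)
  - derive1 (derive1n n f) (qt z) * cI * u)).
  by rewrite normcM normcX normc_cI expr1n mul1r.
by rewrite !mulrBr [cI ^+ n.+1]exprSr; congr (_ - _); rewrite !mulrA; congr (_ * _); exact: mulrAC.
Qed.

Lemma normc_derive1n_iter_qt j n f z : holomorphic D f -> D z ->
  normc (derive1n n (f \o iter j qt) z) = normc (derive1n n f (iter j qt z)).
Proof.
elim: j f => [//|j IH] f hf zD.
rewrite (IH (f \o qt) (holomorphic_qt hf) zD).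
by rewrite derive1n_qt ?normcM ?normcX ?normc_cI ?expr1n ?mul1r//; apply/square_iter_qt.
Qed.

Lemma qt_hdiag (x : R) : [/\ iter 1 qt (hdiag x) = vdiag (x - 2^-1),
  iter 2 qt (hdiag x) = hdiag (1 - x) & iter 3 qt (hdiag x) = vdiag (2^-1 - x)].
Proof.
by split; apply/eqP; rewrite eq_complex /=; apply/andP; split; apply/eqP; field.
Qed.

Lemma good_iter_qt j f : holomorphic D f ->
  good (nsq (fun n x => derive1n n f (iter j qt (hdiag x)))).
Proof.
move=> hf; split=> [n x|n]; first exact: sqr_ge0.
have hn : holomorphic D (derive1n n (f \o iter j qt)).
  by apply: holomorphic_derive1n; [exact: copen_square|exact: holomorphic_iter_qt].
apply: (eq_measurable_fun _ _ (measurable_hdiag hn)) => x; rewrite inE => xI.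
by rewrite /nsq normc_derive1n_iter_qt//; exact: square_hdiag.
Qed.

Lemma corner_iter_qt j f : holomorphic D f -> corner (f \o iter j qt) =
  cser (nsq (fun n x => derive1n n f (iter j qt (hdiag x)))).
Proof.
move=> hf; apply: (@eq_cser (nsq (fun n x => derive1n n (f \o iter j qt) (hdiag x)))) => n x xI.
by rewrite /nsq normc_derive1n_iter_qt//; exact: square_hdiag.
Qed.

Lemma sum_ord4 (k : nat -> \bar R) :
  (\sum_(j < 4) k j = k 0%N + k 1%N + k 2%N + k 3%N)%E.
Proof. by rewrite !big_ord_recr big_ord0 /= add0e. Qed.

Lemma S_hol_corner f : holomorphic D f ->
  S_hol f = (\sum_(j < 4) corner (f \o iter j qt))%E.
Proof.
move=> hf; rewrite /S_hol.
have E1 : (fun n x => derive1n n f (iter 1 qt (hdiag x))) =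
    (fun (n : nat) x => derive1n n f (vdiag (x - 2^-1))).
  by apply/funext => n; apply/funext => x; have [-> _ _] := qt_hdiag x.
have E2 : (fun n x => derive1n n f (iter 2 qt (hdiag x))) =
    (fun (n : nat) x => derive1n n f (hdiag (1 - x))).
  by apply/funext => n; apply/funext => x; have [_ -> _] := qt_hdiag x.
have E3 : (fun n x => derive1n n f (iter 3 qt (hdiag x))) =
    (fun (n : nat) x => derive1n n f (vdiag (2^-1 - x))).
  by apply/funext => n; apply/funext => x; have [_ _ ->] := qt_hdiag x.
have g0 := good_iter_qt 0 hf; have g1 := good_iter_qt 1 hf.
have g2 := good_iter_qt 2 hf; have g3 := good_iter_qt 3 hf.
rewrite E1 in g1; rewrite E2 in g2; rewrite E3 in g3.
pose c j := cser (nsq (fun n x => derive1n n f (iter j qt (hdiag x)))).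
have Ec j : corner (f \o iter j qt) = c j by exact: (@corner_iter_qt j f hf).
(* [diag_sum] lists the vertices in the order left, right, top, bottom, which are the quarter turns
   0, 2, 3, 1. *)
transitivity (c 0%N + c 2%N + c 3%N + c 1%N)%E.
  by rewrite /c E1 E2 E3; exact: (diag_sum_cser g0 g2 g3 g1).
rewrite (sum_ord4 (fun j => corner (f \o iter j qt))) !Ec.
move: (c 0%N) (c 1%N) (c 2%N) (c 3%N) => x y z t.
by rewrite (addeAC x y z) (addeAC (x + z)%E y t).
Qed.

Definition qtp (p : RR) : RR := (2^-1 - p.2, p.1 - 2^-1).

Lemma toC_iter_qtp j p : toC (iter j qtp p) = iter j qt (toC p).
Proof. by elim: j => //= j <-. Qed.

Lemma ipres_qtp : ipres qtp.
Proof.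
have h01 : (0 : R) ^+ 2 + 1 ^+ 2 = 1 by rewrite expr0n expr1n add0r.
have h1 : (0 : R) != -1 by rewrite eq_sym oppr_eq0 oner_eq0.
have := ipres_comp (ipres_translation 2^-1 0) (ipres_comp (ipres_rotation h01 h1) (ipres_translation (- 2^-1) 0)).
rewrite (_ : _ \o _ = qtp)//; apply/funext => p; rewrite /qtp /=.
by congr (_, _); rewrite !mul0r !mul1r !addr0 ?add0r// addrC.
Qed.

Lemma ipres_iter_qtp j : ipres (iter j qtp).
Proof. by elim: j => [|j IH]; [exact: ipres_id|exact: (ipres_comp ipres_qtp IH)]. Qed.

Lemma dens_iter_qtp j f p : dens (f \o iter j qt) p = dens f (iter j qtp p).
Proof.
rewrite /dens !indicE /= toC_iter_qtp; congr ((nat_of_bool _)%:R * _).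
by apply/idP/idP; rewrite !inE /= toC_iter_qtp square_iter_qt.
Qed.

Lemma sqnormL2_iter_qt j f : holomorphic D f -> sqnormL2 D (f \o iter j qt) = sqnormL2 D f.
Proof.
move=> hf; rewrite !sqnormL2_dens.
transitivity (\int[mu2]_p (dens f (iter j qtp p))%:E)%E.
  by apply: eq_integral => p _; rewrite dens_iter_qtp.
have [_ inv] := ipres_iter_qtp j; apply: (inv (fun p => (dens f p)%:E)).
  by apply/measurable_EFinP; exact: measurable_dens.
by move=> p; rewrite lee_fin dens_ge0.
Qed.

Lemma ker_ge0 (p : RR) : (0 <= ker p)%E.
Proof. by apply: integral_ge0 => x _; rewrite lee_fin wt_ge0. Qed.

Lemma measurable_ker : measurable_fun setT (@ker R).
Proof.
pose T := measurableTypeR R.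
pose F (z : (T * T) * T) : \bar R :=
  (\1_I z.2 * wt z.2 ((z.1.1 - z.2) ^+ 2 + z.1.2 ^+ 2))%:E.
have mI : measurable I by exact: (measurable_itv (R := R)).
have m1 : measurable_fun setT (fun z : (T * T) * T => z.1) by exact: measurable_fst.
have mF : measurable_fun setT F.
  apply/measurable_EFinP; apply: measurable_funM.
    by apply: (measurableT_comp (measurable_indic mI)); exact: measurable_snd.
  apply: measurable_wt; first exact: measurable_snd.
  apply: measurable_funD; apply: measurable_funX.
    apply: measurable_funB; last exact: measurable_snd.
    by apply: measurableT_comp m1; exact: measurable_fst.
  by apply: measurableT_comp m1; exact: measurable_snd.
have F0 z : (0 <= F z)%E by rewrite lee_fin; apply: mulr_ge0; [rewrite indicE|exact: wt_ge0].
have h := @measurable_fun_fubini_tonelli_F _ _ _ _ R mu F mF F0.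
have -> : @ker R = (fun q => \int[mu]_x F (q, x))%E; last exact: h.
apply/funext => q; rewrite /ker [LHS]integral_mkcond.
apply: eq_integral => x _; rewrite /patch /F/= indicE.
by case: ifP => _; rewrite ?mul1r ?mul0r.
Qed.

Lemma measurable_dens_ker f : holomorphic D f ->
  measurable_fun setT (fun p => (dens f p)%:E * ker p)%E.
Proof.
move=> hf; apply: emeasurable_funM; last exact: measurable_ker.
by apply/measurable_EFinP; exact: measurable_dens.
Qed.

Lemma corner_le f : holomorphic D f -> ((kappa R)%:E * corner f <= 6%:E * sqnormL2 D f)%E.
Proof.
move=> hf; rewrite corner_ker// sqnormL2_dens.
have mE : measurable_fun setT (fun p => (dens f p)%:E).
  by apply/measurable_EFinP; exact: measurable_dens.
have E0 p : (0 <= (dens f p)%:E)%E by rewrite lee_fin dens_ge0.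
have s6 : (0 <= (6 : R)%:E)%E by rewrite lee_fin.
rewrite -ge0_integralZl//.
apply: ge0_le_integral => //.
- by move=> p _; apply: mule_ge0; [rewrite lee_fin dens_ge0|exact: ker_ge0].
- exact: (measurable_dens_ker hf).
- by apply: measurable_funeM; apply/measurable_EFinP; exact: measurable_dens.
- move=> p _; rewrite muleC; apply: lee_wpmul2r; first by rewrite lee_fin dens_ge0.
  exact: ker_le.
Qed.

(* Where [ker_ge] applies. *)
Definition D0 : set RR := `]-oo, 2^-1%R]%classic `*` `[(- 4^-1)%R, 4^-1%R]%classic.

Lemma measurable_D0 : measurable D0.
Proof. by apply: measurableX; exact: measurable_itv. Qed.

Lemma measurable_D0_dens f : holomorphic D f ->
  measurable_fun setT (fun p => (\1_D0 p * dens f p)%:E).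
Proof.
move=> hf; apply/measurable_EFinP.
exact: (measurable_funM (measurable_indic measurable_D0) (measurable_dens hf)).
Qed.

Lemma D0_dens_ge0 f p : (0 <= (\1_D0 p * dens f p)%:E)%E.
Proof. by rewrite lee_fin; apply: mulr_ge0; [rewrite indicE|exact: dens_ge0]. Qed.

Lemma corner_ge f : holomorphic D f ->
  (\int[mu2]_p (\1_D0 p * dens f p)%:E <= (6 * kappa R)%:E * corner f)%E.
Proof.
move=> hf; rewrite EFinM -muleA corner_ker//.
have n0 p : (0 <= (dens f p)%:E * ker p)%E.
  by apply: mule_ge0; [rewrite lee_fin dens_ge0|exact: ker_ge0].
have mdk := measurable_dens_ker hf.
rewrite -ge0_integralZl//.
apply: ge0_le_integral => //.
- by move=> p _; exact: D0_dens_ge0.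
- exact: measurable_D0_dens.
- exact: measurable_funeM.
move=> [a b] _; rewrite indicE.
have [|_] := boolP ((a, b) \in D0); last by rewrite mul0r mule_ge0.
rewrite inE /D0 /= !in_itv/= => -[a2 b4]; rewrite mul1r.
have [d0|dn0] := eqVneq (dens f (a, b)) 0; first by rewrite d0 mul0e mule0.
have ab : D (toC (a, b)).
  by apply: contrapT => abD; move: dn0; rewrite /dens indicE memNset// mul0r eqxx.
have kge : (6^-1%:E <= ker (a, b))%E by apply: ker_ge => //; rewrite ler_norml.
have E : ((dens f (a, b))%:E = 6%:E * ((dens f (a, b))%:E * 6^-1%:E))%E.
  by rewrite -!EFinM mulrCA mulfV ?mulr1.
rewrite [leLHS]E.
have s6 : (0 <= (6 : R)%:E)%E by rewrite lee_fin.
have d0 : (0 <= (dens f (a, b))%:E)%E by rewrite lee_fin dens_ge0.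
exact: (lee_wpmul2l s6 (lee_wpmul2l d0 kge)).
Qed.

(** The turn by [4 - j] undoes the [j] turns of the point, so each summand is [dens f p] times an
    indicator. One of the indicators is 1: if [|Im| <= 1/4], turn by 0 or 2 according to the half of
    the square; otherwise [|Re - 1/2| < 1/4], and an odd turn exchanges the two coordinates. *)
Lemma D0_cover f p : dens f p <=
  \sum_(j < 4) (\1_D0 (iter j qtp p) * dens (f \o iter (4 - j) qt) (iter j qtp p)).
Proof.
have qtp4 q : iter 4 qtp q = q by case: q => a b; rewrite /qtp /=; congr (_, _); lra.
have E (j : 'I_4) : dens (f \o iter (4 - j) qt) (iter j qtp p) = dens f p.
  by rewrite dens_iter_qtp -iterD subnK ?qtp4// ltnW.
rewrite (eq_bigr (fun j : 'I_4 => \1_D0 (iter j qtp p) * dens f p)); last by move=> j _; rewrite E.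
rewrite -mulr_suml.
have [d0|dn0] := eqVneq (dens f p) 0; first by rewrite d0 mulr0.
have pD : D (toC p).
  by apply: contrapT => pnD; move: dn0; rewrite /dens indicE memNset// mul0r eqxx.
rewrite ler_peMl ?dens_ge0//.
have cov (j : 'I_4) : D0 (iter j qtp p) -> 1 <= \sum_(i < 4) (\1_D0 (iter i qtp p) : R).
  move=> jD; rewrite (bigD1 j)//= indicE mem_set// lerDl.
  by apply: sumr_ge0 => i _; rewrite indicE.
move: cov; set S := (\sum_(i < 4) _); clearbody S => cov.
case: p {E dn0} pD cov => a b abD cov; rewrite /square /= in abD.
have c0 := cov (@Ordinal 4 0 isT); have c1 := cov (@Ordinal 4 1 isT).
have c2 := cov (@Ordinal 4 2 isT); have c3 := cov (@Ordinal 4 3 isT).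
move: c0 c1 c2 c3 abD; clear; rewrite /D0 /qtp /= !in_itv/= => c0 c1 c2 c3.
have [h1|h1] := ger0P (a - 2^-1); have [h2|h2] := ger0P b => abD.
- have [b4|b4] := lerP b 4^-1; first by apply: c2; split; [|apply/andP; split]; lra.
  by apply: c1; split; [|apply/andP; split]; lra.
- have [b4|b4] := lerP (- b) 4^-1; first by apply: c2; split; [|apply/andP; split]; lra.
  by apply: c3; split; [|apply/andP; split]; lra.
- have [b4|b4] := lerP b 4^-1; first by apply: c0; split; [|apply/andP; split]; lra.
  by apply: c1; split; [|apply/andP; split]; lra.
- have [b4|b4] := lerP (- b) 4^-1; first by apply: c0; split; [|apply/andP; split]; lra.
  by apply: c3; split; [|apply/andP; split]; lra.
Qed.

Lemma sqnormL2_le f : holomorphic D f ->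
  (sqnormL2 D f <= (6 * kappa R)%:E * \sum_(j < 4) corner (f \o iter j qt))%E.
Proof.
move=> hf; rewrite sqnormL2_dens.
pose F (j : 'I_4) p := (\1_D0 p * dens (f \o iter (4 - j) qt) p)%:E.
have hj (j : 'I_4) : holomorphic D (f \o iter (4 - j) qt) := @holomorphic_iter_qt (4 - j)%N f hf.
have mF (j : 'I_4) : measurable_fun setT (F j) := measurable_D0_dens (hj j).
have F0 j p : (0 <= F j p)%E by exact: D0_dens_ge0.
have mFj (j : 'I_4) : measurable_fun setT (fun p => F j (iter j qtp p)).
  by apply: (measurableT_comp (mF j)); have [] := ipres_iter_qtp j.
apply: (@le_trans _ _ (\int[mu2]_p \sum_(j < 4) F j (iter j qtp p))%E).
  apply: ge0_le_integral => //.
  - by move=> p _; rewrite lee_fin dens_ge0.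
  - by apply/measurable_EFinP; exact: measurable_dens.
  - exact: emeasurable_sum.
  - by move=> p _; rewrite sumEFin lee_fin; exact: D0_cover.
rewrite ge0_integral_sum//.
have -> : (\sum_(j < 4) \int[mu2]_p F j (iter j qtp p) = \sum_(j < 4) \int[mu2]_p F j p)%E.
  by apply: eq_bigr => j _; have [_ ->] := ipres_iter_qtp j.
rewrite ge0_sume_distrr; last first.
  by move=> j _; rewrite corner_iter_qt//; apply: cser_ge0; exact: good_iter_qt.
have B m := @corner_ge _ (@holomorphic_iter_qt m f hf).
(* The summands involve the turns 4, 3, 2, 1; since four turns are the identity, they are a
   permutation of those on the right. *)
have E4 : f \o iter (4 - 0) qt = f \o iter 0 qt.
  by apply/funext => z; rewrite /= qt4.
rewrite !big_ord_recr !big_ord0 /= !add0e /F.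
rewrite [leRHS]addeAC [X in (_ <= X + _)%E]addeAC [leRHS]addeAC.
apply: leeD; last exact: (B 1%N).
apply: leeD; last exact: (B 2%N).
apply: leeD; last exact: (B 3%N).
by rewrite E4; exact: (B 0%N).
Qed.

(** The constant 24 is the number of corners times the bound 6 of the kernel. The upper constant
    keeps the factor 6 alone, because the four turned copies of [D0] each account for one corner. *)
Theorem sqnormL2_S_hol f : holomorphic D f ->
  ((kappa R / 24)%:E * S_hol f <= sqnormL2 D f)%E /\
  (sqnormL2 D f <= (6 * kappa R)%:E * S_hol f)%E.
Proof.
move=> hf; rewrite S_hol_corner//; split; last exact: sqnormL2_le.
have c0 (j : 'I_4) : (0 <= corner (f \o iter j qt))%E.
  by rewrite corner_iter_qt//; apply: cser_ge0; exact: good_iter_qt.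
have : ((kappa R)%:E * \sum_(j < 4) corner (f \o iter j qt) <= 24%:E * sqnormL2 D f)%E.
  rewrite ge0_sume_distrr//.
  apply: (@le_trans _ _ (\sum_(j < 4) 6%:E * sqnormL2 D f)%E).
    apply: lee_sum => j _; rewrite -(sqnormL2_iter_qt j hf).
    by exact: (corner_le (@holomorphic_iter_qt j f hf)).
  have -> : (\sum_(j < 4) 6%:E * sqnormL2 D f = 4%:R%:E * (6%:E * sqnormL2 D f))%E.
    by rewrite [RHS]mule_natl sumr_const card_ord.
  rewrite muleA -EFinM.
  by rewrite (_ : 4%:R * 6 = 24 :> R)// -natrM.
move=> h; rewrite mulrC EFinM -muleA.
have := lee_wpmul2l (_ : 0%R <= (24^-1)%:E)%E h.
have -> : (24^-1%:E * (24%:E * sqnormL2 D f) = sqnormL2 D f)%E.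
  by rewrite muleA -EFinM mulVf// mul1e.
by apply; rewrite lee_fin invr_ge0.
Qed.

End Estimate.

(** * Complex functions of a real variable *)

Section RealVariable.
Variable R : realType.
Local Notation C := (R[i]^o).
Local Notation normc := (@Normc.normc R).
Local Notation mu := (@lebesgue_measure R).
Local Notation I := (`]0%R, 2^-1%R[%classic : set R).

Definition rdiff (P : R -> C) (y : R) (l : C) := forall e : R, 0 < e ->
  exists2 d : R, 0 < d & forall h, `|h| < d ->
    normc (P (y + h) - P y - l * h%:C) <= e * `|h|.

Lemma is_derive_eps (f : R -> R) (x l : R) :
  (forall e, 0 < e -> exists2 d, 0 < d & forall h, `|h| < d ->
    `|f (x + h) - f x - l * h| <= e * `|h|) -> is_derive x 1 f l.
Proof.
move=> H.
have E : (fun h : R => h^-1 *: ((f \o shift x) (h *: (1 : R)) - f x)) =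
         (fun h : R => h^-1 * (f (x + h) - f x)).
  by apply/funext => h /=; rewrite [h *: (1:R)]mulr1 [h + x]addrC.
have cv : (fun h : R => h^-1 * (f (x + h) - f x)) @ 0^' --> l.
  apply/cvgrPdist_lt => e e0; rewrite /dnbhs /within/=; apply/nbhs_ballP.
  have [d d0 dH] := H (e / 2) (divr_gt0 e0 (ltr0Sn R 1)).
  exists d => //= h; rewrite /ball/= sub0r normrN => hd h0.
  have h0' : 0 < `|h| by rewrite normr_gt0.
  apply: (@le_lt_trans _ _ (e / 2)); last by rewrite ltr_pdivrMr// ltr_pMr// ltr1n.
  rewrite distrC -(ler_pM2r h0') -normrM mulrBl mulrAC mulVf// mul1r.
  exact: dH.
apply: DeriveDef; first by rewrite /derivable E; apply/cvg_ex; exists l.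
by rewrite /derive E; apply/cvg_lim.
Qed.

Lemma rdiff_ReIm P y l : rdiff P y l ->
  is_derive y 1 (fun t => complex.Re (P t)) (complex.Re l) /\
  is_derive y 1 (fun t => complex.Im (P t)) (complex.Im l).
Proof.
move=> dP; split; apply: is_derive_eps => e e0; have [d d0 H] := dP e e0;
  exists d => // h hd; apply: le_trans (H h hd).
  apply: le_trans (normc_Re _); rewrite le_eqVlt; apply/orP; left; apply/eqP; congr `|_|.
  by case: (P (y + h)) (P y) l {dP H} => ? ? [? ?] [? ?] /=; ring.
apply: le_trans (normc_Im _); rewrite le_eqVlt; apply/orP; left; apply/eqP; congr `|_|.
by case: (P (y + h)) (P y) l {dP H} => ? ? [? ?] [? ?] /=; ring.
Qed.

Lemma ReIm_rdiff (P : R -> C) (y : R) (l : C) : is_derive y 1 (fun t => complex.Re (P t)) (complex.Re l) ->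
  is_derive y 1 (fun t => complex.Im (P t)) (complex.Im l) -> rdiff P y l.
Proof.
move=> dR dI e e0; have e2 : 0 < e / 2 by rewrite divr_gt0.
have [d1 d10 H1] := is_derive_affine dR e2.
have [d2 d20 H2] := is_derive_affine dI e2.
exists (Num.min d1 d2) => [|h]; first by rewrite lt_min d10.
rewrite lt_min => /andP[/H1 h1 /H2 h2].
apply: le_trans (normc_le_ReIm _) _.
apply: (@le_trans _ _ (e / 2 * `|h| + e / 2 * `|h|)); last by rewrite -mulrDl -splitr.
apply: lerD; [apply: le_trans h1|apply: le_trans h2];
  rewrite le_eqVlt; apply/orP; left; apply/eqP; congr `|_|.
  by case: (P (y + h)) (P y) l {dR dI H1 H2 h2} => ? ? [? ?] [? ?] /=; ring.
by case: (P (y + h)) (P y) l {dR dI H1 H2 h1} => ? ? [? ?] [? ?] /=; ring.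
Qed.

Lemma rdiff_near P Q y l r : 0 < r -> (forall t, `|t - y| < r -> P t = Q t) ->
  rdiff P y l -> rdiff Q y l.
Proof.
move=> r0 PQ dP e e0; have [d d0 H] := dP e e0.
exists (Num.min d r) => [|h]; first by rewrite lt_min d0.
rewrite lt_min => /andP[hd hr].
rewrite -(PQ y) ?subrr ?normr0// -(PQ (y + h)); first exact: H.
by rewrite addrAC subrr add0r.
Qed.

Lemma rdiff_line (g : C -> C) (z d : C) y l : cdiff g (z + d * y%:C) l ->
  rdiff (fun t => g (z + d * t%:C)) y (d * l).
Proof.
move=> dg e e0.
have n0 := normc_ge0 d; have n1 : 0 < normc d + 1 by rewrite ltr_wpDl.
have [r r0 H] := dg (e / (normc d + 1)) (divr_gt0 e0 n1).
exists (r / (normc d + 1)) => [|h]; first by rewrite divr_gt0.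
rewrite ltr_pdivlMr// => hr.
have hh : normc (d * h%:C) <= (normc d + 1) * `|h|.
  by rewrite normcM normc_real ler_wpM2r// lerDl.
have := H (d * h%:C) (le_lt_trans hh _); rewrite [_ * `|h|]mulrC => /(_ hr).
have -> : z + d * y%:C + d * h%:C = z + d * (y + h)%:C by rewrite rmorphD mulrDr addrA.
rewrite mulrA [l * d]mulrC => /le_trans; apply.
apply: (@le_trans _ _ (e / (normc d + 1) * ((normc d + 1) * `|h|))).
  by rewrite ler_wpM2l// ltW// divr_gt0.
by rewrite mulrA divfK// gt_eqF.
Qed.

Lemma rdiffD P Q y l m : rdiff P y l -> rdiff Q y m -> rdiff (fun t => P t + Q t) y (l + m).
Proof.
move=> dP dQ e e0; have e2 : 0 < e / 2 by rewrite divr_gt0.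
have [d1 d10 H1] := dP _ e2; have [d2 d20 H2] := dQ _ e2.
exists (Num.min d1 d2) => [|h]; first by rewrite lt_min d10.
rewrite lt_min => /andP[/H1 h1 /H2 h2].
have -> : P (y + h) + Q (y + h) - (P y + Q y) - (l + m) * h%:C =
  (P (y + h) - P y - l * h%:C) + (Q (y + h) - Q y - m * h%:C) by ring.
by apply: le_trans (normcD _ _) _; rewrite [e]splitr mulrDl lerD.
Qed.

Lemma rdiffM P Q y l m : rdiff P y l -> rdiff Q y m ->
  rdiff (fun t => P t * Q t) y (l * Q y + P y * m).
Proof.
move=> dP dQ.
have [pR pI] := rdiff_ReIm dP; have [qR qI] := rdiff_ReIm dQ.
apply: ReIm_rdiff.
  have -> : (fun t => complex.Re (P t * Q t)) = (fun t => complex.Re (P t) * complex.Re (Q t)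
      - complex.Im (P t) * complex.Im (Q t)).
    by apply/funext => t; case: (P t) (Q t) => ? ? [].
  apply: (is_derive_eq (is_deriveB (is_deriveM pR qR) (is_deriveM pI qI))).
  rewrite /GRing.scale /=; case: (P y) (Q y) l m {dP dQ pR pI qR qI} => ? ? [? ?] [? ?] [? ?] /=; ring.
have -> : (fun t => complex.Im (P t * Q t)) = (fun t => complex.Re (P t) * complex.Im (Q t)
    + complex.Im (P t) * complex.Re (Q t)).
  by apply/funext => t; case: (P t) (Q t) => ? ? [].
apply: (is_derive_eq (is_deriveD (is_deriveM pR qI) (is_deriveM pI qR))).
rewrite /GRing.scale /=; case: (P y) (Q y) l m {dP dQ pR pI qR qI} => ? ? [? ?] [? ?] [? ?] /=; ring.
Qed.

Lemma rdiff_cst (k : C) y : rdiff (fun=> k) y 0.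
Proof.
move=> e e0; exists 1 => // h _.
by rewrite subrr mul0r subrr normc0 mulr_ge0// ltW.
Qed.

(* [d/dy (z-y)^n/n! = - wm z n y]. *)
Definition wq (z : C) (n : nat) (y : R) : C := (z - y%:C) ^+ n / n`!%:R.
Definition wm (z : C) (n : nat) (y : R) : C := if n is m.+1 then wq z m y else 0.

Lemma cdiff_id z : cdiff (@id C) z 1.
Proof.
move=> e e0; exists 1 => // h _.
by rewrite mul1r /= [z + h]addrC addrK subrr normc0 mulr_ge0 ?normc_ge0// ltW.
Qed.

Lemma wq1 z t : wq z 1 t = z - t%:C.
Proof. by rewrite /wq expr1 (_ : 1`!%N = 1%N)// divr1. Qed.

Lemma rdiff_wq z n y : rdiff (wq z n) y (- wm z n y).
Proof.
case: n => [|n].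
  rewrite /= oppr0; apply: (@rdiff_near (fun=> 1) _ _ _ 1) => // [t _|].
    by rewrite /wq expr0 fact0 divr1.
  exact: rdiff_cst.
elim: n => [|n IH].
  have -> : wq z 1 = (fun t => z + (- 1) * t%:C).
    by apply/funext => t; rewrite wq1 mulN1r.
  have -> : - wm z 1 y = -1 * 1 by rewrite /= /wq expr0 fact0 divr1 mulr1.
  exact: (@rdiff_line id _ _ _ _ (cdiff_id _)).
have n2 : (n.+2%:R : C) != 0 by rewrite pnatr_eq0.
have -> : wq z n.+2 = (fun t => n.+2%:R^-1 * (wq z 1 t * wq z n.+1 t)).
  apply/funext => t; rewrite wq1 /wq [_ ^+ n.+2]exprS factS natrM invfM.
  by move: (_ ^+ n.+1) (_^-1) (_^-1) => a b c; ring.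
have d1 : rdiff (wq z 1) y (- 1).
  have -> : wq z 1 = (fun t => z + (- 1) * t%:C).
    by apply/funext => t; rewrite wq1 mulN1r.
  rewrite -[X in rdiff _ _ X]mulr1; exact: (@rdiff_line id _ _ _ _ (cdiff_id _)).
have := rdiffM (rdiff_cst n.+2%:R^-1 y) (rdiffM d1 IH).
congr (rdiff _ _ _); rewrite mul0r add0r mulN1r mulrN /=.
have -> : wq z 1 y * wq z n y = n.+1%:R * wq z n.+1 y.
  rewrite wq1 /wq [_ ^+ n.+1]exprS factS natrM invfM.
  have n1 : (n.+1%:R : C) != 0 by rewrite pnatr_eq0.
  transitivity (n.+1%:R * n.+1%:R^-1 * ((z - y%:C) * ((z - y%:C) ^+ n / n`!%:R)) : C).
    by rewrite mulfV// mul1r.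
  by move: (_ ^+ n) (n.+1%:R^-1 : C) (n`!%:R^-1 : C) (n.+1%:R : C) => a b c d; ring.
rewrite -opprD mulrN; congr (- _).
by rewrite -{1}[wq z n.+1 y]mul1r -mulrDl -[1]/(1%:R) -natrD add1n mulrA mulVf// mul1r.
Qed.

(** Differentiating the term of index [n] gives two products, the second of which cancels the first
    one of index [n - 1]. What survives of [N.+1] terms is [u N.+1 * wq z N]. *)
Lemma rdiff_taylor (u : nat -> R -> C) z y : (forall n, rdiff (u n) y (u n.+1 y)) ->
  forall N, rdiff (fun t => \sum_(n < N) u n t * wq z n t) y (u N y * wm z N y).
Proof.
move=> du; elim=> [|N IH].
  rewrite mulr0; apply: (@rdiff_near (fun=> 0) _ _ _ 1) => // [t _|]; last exact: rdiff_cst.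
  by rewrite big_ord0.
apply: (@rdiff_near (fun t => (\sum_(n < N) u n t * wq z n t) + u N t * wq z N t) _ _ _ 1) => // [t _|].
  by rewrite big_ord_recr.
have := rdiffD IH (rdiffM (du N) (rdiff_wq z N y)).
by congr (rdiff _ _ _); rewrite mulrN addrCA subrr addr0.
Qed.

(** The derivative is bounded pointwise only through [A], whose integral is controlled, so the bound
    is integrated; [M] is multiplied by a length at most 1. *)
Lemma FTC_bound (G g A : R -> R) (a b k M S : R) : 0 < a -> a < b -> b <= 2^-1 ->
  (forall y, a <= y <= b -> is_derive y 1 G (g y)) ->
  (forall y, a <= y <= b -> {for y, continuous g}) ->
  measurable_fun I A -> (forall y, 0 <= A y) ->
  (forall y, a <= y <= b -> `|g y| <= k * (A y + M)) -> 0 <= k -> 0 <= M ->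
  (\int[mu]_(x in `]0%R, 2^-1%R[) (A x)%:E <= S%:E)%E ->
  `|G b - G a| <= k * (S + M).
Proof.
move=> a0 ab b2 dG cg mA A0 gA k0 M0 AS.
have mJ : measurable (`]a, b[%classic : set R) by exact: measurable_itv.
have JI : (`]a, b[%classic : set R) `<=` I.
  by move=> y; rewrite /= !in_itv/= => /andP[h1 h2]; apply/andP; split; lra.
have mAJ : measurable_fun (`]a, b[%classic : set R) A by exact: measurable_funS mA.
have mgc : measurable_fun (`[a, b]%classic : set R) g.
  apply: subspace_continuous_measurable_fun => //.
  exact: (@cont_on_within R a b g).
have mg : measurable_fun (`]a, b[%classic : set R) g.
  by apply: measurable_funS mgc => // y; rewrite /= !in_itv/= => /andP[h1 h2]; rewrite !ltW.
rewrite -lee_fin -abse_EFin -(integral_FTC ab cg dG).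
rewrite integral_itv_bndoo; last by apply/measurable_EFinP.
apply: le_trans (le_abse_integral _ _ _) _ => //; first by apply/measurable_EFinP.
apply: (@le_trans _ _ (\int[mu]_(x in `]a, b[) (k%:E * ((A x)%:E + M%:E)))%E).
  apply: ge0_le_integral => //.
  - by apply/measurable_EFinP; exact: measurableT_comp.
  - apply: measurable_funeM; apply: emeasurable_funD; last exact: measurable_cst.
    exact/measurable_EFinP.
  - move=> y; rewrite /= in_itv/= => /andP[ay yb].
    by rewrite -EFinD -EFinM lee_fin gA// !ltW.
have mAE : measurable_fun (`]a, b[%classic : set R) (fun x => (A x)%:E) by exact/measurable_EFinP.
have AE0 x : (0 <= (A x)%:E)%E by rewrite lee_fin.
have ME0 : (0 <= M%:E)%E by rewrite lee_fin.
have mAM : measurable_fun (`]a, b[%classic : set R) (fun x => (A x)%:E + M%:E)%E.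
  by apply: emeasurable_funD => //; exact: measurable_cst.
have AM0 x : (0 <= (A x)%:E + M%:E)%E by rewrite adde_ge0.
have kE0 : (0 <= k%:E)%E by rewrite lee_fin.
rewrite ge0_integralZl//.
rewrite EFinM lee_wpmul2l// ge0_integralD//.
rewrite EFinD; apply: leeD.
  apply: le_trans AS; apply: ge0_subset_integral => //.
  exact/measurable_EFinP.
rewrite integral_cst//= lebesgue_measure_itv/= lte_fin ab -EFinD -EFinM lee_fin.
by rewrite ler_piMr//; lra.
Qed.

(** If [A] exceeded this value throughout, its integral over []a, b[] would be at least [S + 1]. *)
Lemma exists_small (A : R -> R) (a b S : R) : 0 < a -> a < b -> b <= 2^-1 ->
  measurable_fun I A -> (forall y, 0 <= A y) ->
  (\int[mu]_(x in `]0%R, 2^-1%R[) (A x)%:E <= S%:E)%E ->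
  exists2 y, a <= y <= b & A y <= (S + 1) / (b - a).
Proof.
move=> a0 ab b2 mA A0 AS; apply: contrapT => H.
have ba : 0 < b - a by rewrite subr_gt0.
have mJ : measurable (`]a, b[%classic : set R) by exact: measurable_itv.
have JI : (`]a, b[%classic : set R) `<=` I.
  by move=> y; rewrite /= !in_itv/= => /andP[h1 h2]; apply/andP; split; lra.
have mAE : measurable_fun (`]a, b[%classic : set R) (fun x => (A x)%:E).
  by apply/measurable_EFinP; exact: measurable_funS mA.
have S0 : 0 <= S by rewrite -lee_fin; apply: le_trans AS; apply: integral_ge0 => y _; rewrite lee_fin.
have : ((S + 1)%:E <= S%:E)%E.
  apply: le_trans AS.
  apply: (@le_trans _ _ (\int[mu]_(x in `]a, b[) (A x)%:E)%E); last first.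
    apply: ge0_subset_integral => //; first exact/measurable_EFinP.
    by move=> y _; rewrite lee_fin.
  have -> : ((S + 1)%:E = \int[mu]_(x in `]a, b[) (((S + 1) / (b - a))%R)%:E)%E.
    rewrite integral_cst//= lebesgue_measure_itv/= lte_fin ab -EFinD -EFinM.
    by rewrite divfK// gt_eqF.
  apply: ge0_le_integral => //.
  - by move=> y _; rewrite lee_fin divr_ge0 ?ltW//; lra.
  - move=> y; rewrite /= in_itv/= => /andP[ay yb]; rewrite lee_fin leNgt; apply/negP => h.
    by apply: H; exists y; rewrite ?ltW.
rewrite lee_fin; lra.
Qed.

End RealVariable.

(** * Extension to one corner *)

Section Patching.
Variable R : realType.
Local Notation C := (R[i]^o).
Local Notation normc := (@Normc.normc R).
Local Notation mu := (@lebesgue_measure R).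
Local Notation I := (`]0%R, 2^-1%R[%classic : set R).

(** A weak form of Wallis's estimate: [cn N] and [1 / (2^N N!^2)] agree up to a polynomial factor.
    The terms of the sum thus have the size of squared Taylor terms at distance [y / sqrt 2] from
    [y], and a geometric gain is left strictly inside that disc. *)
Lemma cn_wallis N : 1 <= N.+1%:R * (2 ^+ N * N`!%:R ^+ 2 * cn R N).
Proof.
elim: N => [|N IH]; first by rewrite /cn !expr0 fact0 expr1n (_ : ((2 * 0).+1)`! = 1%N)// invr1 !mul1r.
apply: le_trans IH _; rewrite cnS factS natrM [2 ^+ N.+1]exprS.
have f0 : 0 <= 2 ^+ N * N`!%:R ^+ 2 * cn R N :> R.
  by rewrite mulr_ge0 ?(ltW (cn_gt0 _ _))// mulr_ge0 ?exprn_ge0.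
have -> : N.+2%:R * (2 * 2 ^+ N * (N.+1%:R * N`!%:R) ^+ 2 * (cn R N / ((2 * N + 3)%:R * N.+1%:R))) =
    (N.+2%:R * 2 * N.+1%:R / (2 * N + 3)%:R) * (2 ^+ N * N`!%:R ^+ 2 * cn R N) :> R.
  have h1 : (2 * N + 3)%:R != 0 :> R by rewrite pnatr_eq0 addnS.
  have h2 : N.+1%:R != 0 :> R by rewrite pnatr_eq0.
  move: h1 h2; move: (N`!%:R : R) (2 ^+ N : R) (cn R N) (N.+2%:R : R) ((2 * N + 3)%:R : R) (N.+1%:R : R).
  by move=> a b c d e f h1 h2; field; rewrite h1.
rewrite ler_wpM2r// ler_pdivlMr; last by rewrite ltr0n addn_gt0 orbT.
have -> : (2 * N + 3)%:R = 2 * N%:R + 3 :> R by rewrite natrD natrM.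
have -> : N.+2%:R = N%:R + 2 :> R by rewrite -addn2 natrD.
have -> : N.+1%:R = N%:R + 1 :> R by rewrite -addn1 natrD.
by have := ler0n R N; move: (N%:R : R) => n; nra.
Qed.

(* Bounds [B] in the inequality [ab <= s^N A + s^(-N) B] used for the derivative of the
   Taylor polynomials. *)
Lemma quot_bound (s a : R) : 0 < s -> s < 1 -> 0 < a -> exists2 M : R, 0 <= M &
  forall N y q, a <= y -> y <= 2^-1 -> 0 <= q -> 2 * q ^+ 2 <= s ^+ 8 * y ^+ 2 ->
    (q ^+ N / N`!%:R) ^+ 2 <= cn R N.+1 * y ^+ (2 * N.+1).+1 * (M * (s ^+ N) ^+ 2).
Proof.
move=> s0 s1 a0.
have [K KP] := exprn_nat_bound (ltW s0) s1.
have KS N : N.+1%:R * s ^+ N <= K / s.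
  by rewrite ler_pdivlMr// -mulrA -exprSr; exact: KP.
have K0 : 0 <= K / s by apply: le_trans (KS 0%N); rewrite expr0 mulr1.
(* The cube of [K / s] pays for three factors [N.+1], and [a ^+ 3] for the surplus [y ^+ 3] in
   [y ^+ (2N + 3)]. *)
exists (3 * (K / s) ^+ 3 / a ^+ 3) => [|N y q ay y2 q0 qy].
  by rewrite divr_ge0 ?exprn_ge0 ?(ltW a0)// mulr_ge0// exprn_ge0.
have y0 : 0 < y by apply: lt_le_trans ay.
have F0 : 0 < 2 ^+ N * N`!%:R ^+ 2 :> R by rewrite mulr_gt0 ?exprn_gt0// ltr0n fact_gt0.
rewrite -(ler_pM2l F0).
have -> : 2 ^+ N * N`!%:R ^+ 2 * (q ^+ N / N`!%:R) ^+ 2 = (2 * q ^+ 2) ^+ N.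
  rewrite [RHS]exprMn (_ : (q ^+ 2) ^+ N = (q ^+ N) ^+ 2); last by rewrite -!exprM mulnC.
  rewrite expr_div_n -mulrA; congr (_ * _).
  by rewrite mulrCA mulfV ?mulr1// expf_neq0// pnatr_eq0 -lt0n fact_gt0.
apply: (@le_trans _ _ ((s ^+ 8 * y ^+ 2) ^+ N)).
  by rewrite lerXn2r ?nnegrE// mulr_ge0 ?exprn_ge0 ?(ltW s0) ?(ltW y0)//.
set t := 2 ^+ N * N`!%:R ^+ 2 * cn R N.
have wal : 1 <= N.+1%:R * t by exact: cn_wallis.
have n0 : 0 < N.+1%:R :> R by rewrite ltr0n.
have e0 : 0 < (2 * N + 3)%:R :> R by rewrite ltr0n addnS.
have e3 : (2 * N + 3)%:R <= 3 * N.+1%:R :> R by rewrite -natrM ler_nat mulnS addnC leq_add2l leq_mul2r orbT.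
have -> : 2 ^+ N * N`!%:R ^+ 2 * (cn R N.+1 * y ^+ (2 * N.+1).+1 *
      (3 * (K / s) ^+ 3 / a ^+ 3 * (s ^+ N) ^+ 2)) =
    (y ^+ 2) ^+ N * (y / a) ^+ 3 * (3 * (K / s) ^+ 3 * (s ^+ N) ^+ 2 * (t / ((2 * N + 3)%:R * N.+1%:R))).
  rewrite cnS /t (_ : (2 * N.+1).+1 = (2 * N + 3)%N); last by rewrite mulnS addnC !addnS addn0.
  rewrite exprD exprM (expr_div_n y).
  move: (2 ^+ N : R) (N`!%:R ^+ 2 : R) (cn R N) (((2 * N + 3)%:R * N.+1%:R)^-1 : R) ((y ^+ 2) ^+ N)
    (y ^+ 3) ((a ^+ 3)^-1) ((K / s) ^+ 3) ((s ^+ N) ^+ 2) => x1 x2 x3 x4 x5 x6 x7 x8 x9; ring.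
rewrite exprMn mulrC -mulrA; apply: ler_wpM2l; first by rewrite exprn_ge0 ?sqr_ge0.
have ya : 1 <= (y / a) ^+ 3 by rewrite exprn_ege1// ler_pdivlMr// mul1r.
(* The powers of [v] are spent as follows: three against [N.+1 ^+ 3], two kept in the bound, and
   three discarded since [v <= 1]. The cube of [N.+1] comes from [cn_wallis] and from the
   denominator of [cnS]; hence the exponent 8 in the hypothesis. *)
have key : s ^+ 8 ^+ N <= 3 * (K / s) ^+ 3 * (s ^+ N) ^+ 2 * (t / ((2 * N + 3)%:R * N.+1%:R)).
  set v := s ^+ N; have v0 : 0 <= v by rewrite exprn_ge0// ltW.
  have v1 : v <= 1 by rewrite exprn_ile1// ltW.
  have -> : s ^+ 8 ^+ N = v ^+ 8 by rewrite -!exprM mulnC.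
  have cub : N.+1%:R ^+ 3 * v ^+ 3 <= (K / s) ^+ 3.
    by rewrite -exprMn lerXn2r ?nnegrE//; first [exact: K0|exact: KS|rewrite mulr_ge0].
  rewrite mulrA ler_pdivlMr ?mulr_gt0//.
  apply: (@le_trans _ _ (3 * (K / s) ^+ 3 * v ^+ 2 / N.+1%:R)); last first.
    apply: ler_wpM2l.
      by apply: mulr_ge0; [apply: mulr_ge0 => //; exact: exprn_ge0|exact: sqr_ge0].
    by rewrite -[leLHS]div1r ler_pdivrMr// mulrC.
  rewrite ler_pdivlMr//.
  apply: (@le_trans _ _ (v ^+ 8 * (3 * N.+1%:R * N.+1%:R) * N.+1%:R)).
    apply: ler_wpM2r; first exact: ltW.
    apply: ler_wpM2l; first exact: exprn_ge0.
    by apply: ler_wpM2r => //; exact: ltW.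
  have -> : v ^+ 8 * (3 * N.+1%:R * N.+1%:R) * N.+1%:R = 3 * (N.+1%:R ^+ 3 * v ^+ 3) * v ^+ 2 * v ^+ 3.
    by move: (N.+1%:R : R) => n; ring.
  have c1 : 3 * (N.+1%:R ^+ 3 * v ^+ 3) * v ^+ 2 <= 3 * (K / s) ^+ 3 * v ^+ 2.
    by apply: ler_wpM2r; [exact: sqr_ge0|exact: ler_wpM2l].
  apply: le_trans c1; rewrite ler_piMr ?exprn_ile1//.
  apply: mulr_ge0; last exact: sqr_ge0.
  by apply: mulr_ge0 => //; apply: mulr_ge0; apply: exprn_ge0 => //; exact: ltW.
  exact: ltW.
  exact: ltW.
apply: le_trans key _; rewrite ler_peMl//.
apply: mulr_ge0.
  by apply: mulr_ge0; [apply: mulr_ge0 => //; exact: exprn_ge0|exact: sqr_ge0].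
apply: divr_ge0; last by apply: mulr_ge0; exact: ltW.
exact: (mulr_ge0 (ltW F0) (ltW (cn_gt0 R N))).
Qed.

(** Lets the bound of [quot_bound], stated with the coefficient of index [N.+1], serve for [u N] as
    well as for [u N.+1]. *)
Lemma cn_decr N (y : R) : 0 < y -> y <= 2^-1 ->
  cn R N.+1 * y ^+ (2 * N.+1).+1 <= cn R N * y ^+ (2 * N).+1.
Proof.
move=> y0 y2; rewrite ler_pM ?exprn_ge0 ?(ltW y0) ?(ltW (cn_gt0 _ _))//.
  rewrite cnS ler_pdivrMr ?mulr_gt0 ?ltr0n ?addnS// ler_peMr ?(ltW (cn_gt0 _ _))//.
  by rewrite -natrM ler1n muln_gt0.
by rewrite mulnS ler_wiXn2l ?(ltW y0)//; [lra|rewrite ltnS leq_addl].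
Qed.

(** Used with [p] a derivative and [w] a Taylor weight: the product is replaced by the integrable
    density [c * p ^+ 2] plus a constant, at geometric scale [v]. *)
Lemma amgm (p w c M v : R) : 0 <= p -> 0 <= w -> 0 <= c -> 0 <= M -> 0 <= v ->
  w ^+ 2 <= c * (M * v ^+ 2) -> p * w <= v * (c * p ^+ 2 + M).
Proof.
move=> p0 w0 c0 M0 v0 h.
have cp : 0 <= c * p ^+ 2 by rewrite mulr_ge0 ?sqr_ge0.
rewrite -(@ler_pXn2r _ 2) ?nnegrE ?mulr_ge0 ?addr_ge0//.
apply: (@le_trans _ _ (p ^+ 2 * (c * (M * v ^+ 2)))).
  by rewrite exprMn ler_wpM2l ?sqr_ge0.
have -> : p ^+ 2 * (c * (M * v ^+ 2)) = v ^+ 2 * ((c * p ^+ 2) * M) by ring.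
rewrite exprMn ler_wpM2l ?sqr_ge0//.
move: (c * p ^+ 2) cp => x x0; rewrite sqrrD.
have := mulr_ge0 x0 M0; have := sqr_ge0 x; have := sqr_ge0 M; lra.
Qed.

Definition disc (z : C) (y : R) := 2 * normc (z - y%:C) ^+ 2 < y ^+ 2.

(** The function [y^2 - 2 |z - y|^2] is concave in [y], so on [[a, b]] it is at least [m], its
    smaller end value. With [s = 1 - m / 2], the inequality [1 - 4 m <= s^8] and [y^2 <= 1/4] turn
    this additive margin into a multiplicative one. *)
Lemma disc_interp z (a b : R) : 0 < a -> a < b -> b <= 2^-1 -> disc z a -> disc z b ->
  exists s : R, [/\ 0 < s, s < 1 & forall y, a <= y <= b ->
    2 * normc (z - y%:C) ^+ 2 <= s ^+ 8 * y ^+ 2].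
Proof.
rewrite /disc; case: z => p q a0 ab b2.
have E y : normc ((p +i* q) - y%:C) ^+ 2 = (p - y) ^+ 2 + q ^+ 2.
  by rewrite sqr_normc /= subr0.
rewrite !E => da db.
pose fa := a ^+ 2 - 2 * ((p - a) ^+ 2 + q ^+ 2).
pose fb := b ^+ 2 - 2 * ((p - b) ^+ 2 + q ^+ 2).
pose m := Num.min fa fb.
have m0 : 0 < m by rewrite lt_min !subr_gt0 da db.
have ma : m <= fa by rewrite ge_min lexx.
have mb : m <= fb by rewrite ge_min lexx orbT.
have m4 : m <= 4^-1.
  apply: le_trans ma _; rewrite /fa; have := sqr_ge0 (p - a); have := sqr_ge0 q.
  have : a ^+ 2 <= 2^-1 ^+ 2 by rewrite lerXn2r ?nnegrE; lra.
  by move: (a ^+ 2) => A; move: ((p - a) ^+ 2) (q ^+ 2) => B D; rewrite expr2; lra.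
exists (1 - m / 2); split; [lra|lra|] => y /andP[ay yb]; rewrite E.
have y2 : y ^+ 2 <= 4^-1.
  have -> : 4^-1 = 2^-1 ^+ 2 :> R by field.
  by rewrite lerXn2r ?nnegrE; lra.
have conc : m <= y ^+ 2 - 2 * ((p - y) ^+ 2 + q ^+ 2).
  rewrite -subr_ge0 -(pmulr_rge0 _ (_ : 0 < b - a)) ?subr_gt0//.
  have -> : (b - a) * (y ^+ 2 - 2 * ((p - y) ^+ 2 + q ^+ 2) - m) =
     (b - y) * (fa - m) + (y - a) * (fb - m) + (b - a) * ((y - a) * (b - y)).
    by rewrite /fa /fb; ring.
  by rewrite !addr_ge0// mulr_ge0 ?subr_ge0// ?(ltW ab)// mulr_ge0 ?subr_ge0.
have s8 : 1 - 4 * m <= (1 - m / 2) ^+ 8.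
  have sq (x e : R) : 0 <= 1 - e -> 1 - e <= x -> 1 - 2 * e <= x ^+ 2.
    move=> h1 h2; apply: (@le_trans _ _ ((1 - e) ^+ 2)).
      by have := sqr_ge0 e; rewrite sqrrB expr1n; lra.
    by rewrite lerXn2r ?nnegrE//; lra.
  have -> : (1 - m / 2) ^+ 8 = (((1 - m / 2) ^+ 2) ^+ 2) ^+ 2 by rewrite -!exprM.
  have -> : 4 * m = 2 * (2 * (2 * (m / 2))) by field.
  by apply: (sq); [lra|]; apply: (sq); [lra|]; apply: (sq); lra.
apply: (@le_trans _ _ ((1 - 4 * m) * y ^+ 2)); last by rewrite ler_wpM2r// sqr_ge0.
have : 4 * m * y ^+ 2 <= m.
  by rewrite mulrAC -[leRHS]mul1r ler_wpM2r ?(ltW m0)//; lra.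
by rewrite mulrBl mul1r; lra.
Qed.

(** * Convergence of the Taylor polynomials based on one half-diagonal *)

Section Corner.
Variables (u : nat -> R -> C) (S : R).
Hypothesis du : forall n y, 0 < y < 1 -> rdiff (u n) y (u n.+1 y).
Let A n (y : R) : R := cn R n * (`|y| ^+ (2 * n).+1 * normc (u n y) ^+ 2).
Hypothesis mA : forall n, measurable_fun I (A n).
Hypothesis AS : forall n, (\int[mu]_(x in `]0%R, 2^-1%R[) (A n x)%:E <= S%:E)%E.

Let A0 n y : 0 <= A n y.
Proof. by rewrite mulr_ge0 ?(ltW (cn_gt0 _ _))// mulr_ge0 ?sqr_ge0// exprn_ge0. Qed.

Let S0 : 0 <= S.
Proof.
rewrite -lee_fin; apply: le_trans (AS 0%N); apply: integral_ge0 => y _.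
by rewrite lee_fin; exact: A0.
Qed.

Definition taylor z N (y : R) : C := \sum_(n < N.+1) u n y * wq z n y.

(** Both estimates come from the integral bound on [A N]. The first integrates the derivative of the
    polynomial along the base points; the second finds, for each [N], a base point where the density
    is not above its mean by much. *)
Lemma taylor_estimate z (a b : R) : 0 < a -> a < b -> b <= 2^-1 -> disc z a -> disc z b ->
  exists K s, [/\ 0 <= s, s < 1,
    forall N y, a <= y <= b -> normc (taylor z N b - taylor z N y) <= K * s ^+ N &
    forall N, exists2 y, a <= y <= b & normc (u N y * wq z N y) <= K * s ^+ N].
Proof.
move=> a0 ab b2 da db.
have [s [s0 s1 sP]] := disc_interp a0 ab b2 da db.
have [M M0 MP] := quot_bound s0 s1 a0.
have wE N y : normc (wq z N y) = normc (z - y%:C) ^+ N / N`!%:R.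
  by rewrite /wq normcM normcX normcV normc_nat.
have v0 N : 0 <= s ^+ N by rewrite exprn_ge0// ltW.
have bound N k y : (k = N \/ k = N.+1) -> a <= y <= b ->
    normc (u k y * wq z N y) <= s ^+ N * (A k y + M).
  move=> kN yab; have [ay yb] := andP yab; have y0 : 0 < y by apply: lt_le_trans ay.
  have y2 : y <= 2^-1 by apply: le_trans yb b2.
  rewrite normcM /A gtr0_norm// mulrA.
  apply: amgm => //; [exact: normc_ge0|exact: normc_ge0| |].
    by rewrite mulr_ge0 ?(ltW (cn_gt0 _ _))// exprn_ge0// ltW.
  have h := MP N y _ ay y2 (normc_ge0 _) (sP y yab); rewrite wE.
  have n0 : 0 <= M * (s ^+ N) ^+ 2 by rewrite mulr_ge0 ?sqr_ge0.
  by case: kN => ->; [apply: le_trans h _; rewrite ler_wpM2r// cn_decr|].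
have D0 : 0 <= 2 * (S + M) by rewrite mulr_ge0// addr_ge0.
have ba : 0 < b - a by rewrite subr_gt0.
have E0 : 0 <= (S + 1) / (b - a) + M by rewrite addr_ge0// divr_ge0 ?(ltW ba)// addr_ge0.
exists (2 * (S + M) + ((S + 1) / (b - a) + M)), s; split; [exact: ltW|by []| |].
- move=> N y /andP[ay yb].
  apply: (@le_trans _ _ (2 * (S + M) * s ^+ N)); last by rewrite ler_wpM2r// lerDl.
  have [->|yb'] := eqVneq y b; first by rewrite subrr normc0 mulr_ge0.
  have yb2 : y < b by rewrite lt_neqAle yb'.
  have y0 : 0 < y by apply: lt_le_trans ay.
  have t01 t : y <= t <= b -> 0 < t < 1 by move=> /andP[h1 h2]; apply/andP; split; lra.
  have tab t : y <= t <= b -> a <= t <= b by move=> /andP[h1 h2]; apply/andP; split; lra.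
  have dT t : y <= t <= b -> rdiff (taylor z N) t (u N.+1 t * wq z N t).
    by move=> ht; apply: (@rdiff_taylor _ u z t _ N.+1) => n; exact: du (t01 _ ht).
  (* Computed for the continuity of the derivative, which the fundamental theorem of calculus
     requires. *)
  have dW t : y <= t <= b -> rdiff (fun t => u N.+1 t * wq z N t) t
      (u N.+2 t * wq z N t + u N.+1 t * - wm z N t).
    by move=> ht; apply: (rdiffM (du _ (t01 _ ht)) (rdiff_wq _ _ _)).
  have hR := @FTC_bound R (fun t => complex.Re (taylor z N t))
    (fun t => complex.Re (u N.+1 t * wq z N t)) (A N.+1) y b (s ^+ N) M S y0 yb2 b2
    (fun t ht => proj1 (rdiff_ReIm (dT t ht)))
    (fun t ht => is_derive_continuous (proj1 (rdiff_ReIm (dW t ht)))) (mA _) (A0 _)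
    (fun t ht => le_trans (normc_Re _) (bound N N.+1 t (or_intror erefl) (tab t ht))) (v0 N) M0 (AS _).
  have hI := @FTC_bound R (fun t => complex.Im (taylor z N t))
    (fun t => complex.Im (u N.+1 t * wq z N t)) (A N.+1) y b (s ^+ N) M S y0 yb2 b2
    (fun t ht => proj2 (rdiff_ReIm (dT t ht)))
    (fun t ht => is_derive_continuous (proj2 (rdiff_ReIm (dW t ht)))) (mA _) (A0 _)
    (fun t ht => le_trans (normc_Im _) (bound N N.+1 t (or_intror erefl) (tab t ht))) (v0 N) M0 (AS _).
  apply: le_trans (normc_le_ReIm _) _.
  have -> : complex.Re (taylor z N b - taylor z N y) = complex.Re (taylor z N b) - complex.Re (taylor z N y).
    by case: (taylor z N b) (taylor z N y) => ? ? [].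
  have -> : complex.Im (taylor z N b - taylor z N y) = complex.Im (taylor z N b) - complex.Im (taylor z N y).
    by case: (taylor z N b) (taylor z N y) => ? ? [].
  by apply: le_trans (lerD hR hI) _; rewrite -mulrDr mulrC; lra.
- move=> N; have [y yab Ay] := exists_small a0 ab b2 (mA N) (A0 N) (AS N).
  exists y => //; apply: le_trans (bound N N y (or_introl erefl) yab) _.
  rewrite mulrC ler_wpM2r//; apply: (@le_trans _ _ ((S + 1) / (b - a) + M)); last by rewrite lerDr.
  by rewrite lerD2r.
Qed.

(** Averaging needs a whole interval of base points whose discs contain [z]; moving to the left
    keeps them below [1/2]. *)
Lemma disc_left z x : 0 < x -> x <= 2^-1 -> disc z x -> exists a, [/\ 0 < a, a < x & disc z a].
Proof.
move=> x0 x2; rewrite /disc; case: z => p q.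
have E y : normc ((p +i* q) - y%:C) ^+ 2 = (p - y) ^+ 2 + q ^+ 2.
  by rewrite sqr_normc /= subr0.
rewrite E => h; pose f := x ^+ 2 - 2 * ((p - x) ^+ 2 + q ^+ 2).
have f0 : 0 < f by rewrite subr_gt0.
have p1 : p <= 1.
  have h1 := @disc_bound R (p - x) q x x0 h.
  have h2 := ler_norm (p - x); have h3 := normr_ge0 q; clear -h1 h2 h3 x2.
  by move: (`|p - x|) (`|q|) h1 h2 h3 => X Y h1 h2 h3; lra.
(* Since [p <= 1], shifting the center by [d] lowers the margin [f] by at most [5 * d], so half of
   it survives. *)
pose d := Num.min (x / 2) (f / 10).
have d0 : 0 < d by rewrite lt_min !divr_gt0.
have dx : d <= x / 2 by rewrite ge_min lexx.
have df : d <= f / 10 by rewrite ge_min lexx orbT.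
exists (x - d); split; [lra|lra|]; rewrite E -subr_gt0.
have -> : (x - d) ^+ 2 - 2 * ((p - (x - d)) ^+ 2 + q ^+ 2) = f + 2 * x * d - d * d - 4 * p * d.
  by rewrite /f; ring.
have h1 : 0 <= x * d by rewrite mulr_ge0// ltW.
have h2 : d * d <= d by rewrite -[leRHS]mulr1 ler_wpM2l ?(ltW d0)//; lra.
have h3 : p * d <= d by rewrite -[leRHS]mul1r ler_wpM2r ?(ltW d0)//; lra.
by clear -f0 df h1 h2 h3; lra.
Qed.

(* Compare consecutive polynomials at [x] with those at a nearby point [y], depending on
   [N], where the last term is small because its weighted mean square is. *)
Lemma taylor_cvg z x : 0 < x -> x <= 2^-1 -> disc z x ->
  exists l : C, (fun N => taylor z N x) @ \oo --> l.
Proof.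
move=> x0 x2 d; have [a [a0 ax da]] := disc_left x0 x2 d.
have [K [s [s0 s1 H1 H2]]] := taylor_estimate a0 ax x2 da d.
have K0 : 0 <= K.
  by have [y _] := H2 0%N; rewrite expr0 mulr1; apply: le_trans; exact: normc_ge0.
have bd N : normc (taylor z N.+1 x - taylor z N x) <= 3 * K * s ^+ N.
  have [y yax Hy] := H2 N.+1.
  have Ks : K * s ^+ N.+1 <= K * s ^+ N.
    by rewrite ler_wpM2l// [s ^+ N.+1]exprS ler_piMl ?exprn_ge0// ltW.
  have -> : taylor z N.+1 x - taylor z N x = (taylor z N.+1 x - taylor z N.+1 y)
      - (taylor z N x - taylor z N y) + u N.+1 y * wq z N.+1 y.
    have -> : taylor z N.+1 y = taylor z N y + u N.+1 y * wq z N.+1 y by rewrite /taylor big_ord_recr.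
    by move: (taylor z N.+1 x) (taylor z N x) (taylor z N y) (_ * _) => p q r t; ring.
  apply: le_trans (normcD _ _) _; apply: le_trans (lerD (normcD _ _) (lexx _)) _.
  have h1 := H1 N.+1 y yax; have h2 := H1 N y yax; rewrite normcN.
  rewrite -mulrA; move: (K * s ^+ N) (K * s ^+ N.+1) h1 h2 Hy Ks => r v.
  move: (normc _) (normc _) (normc _) => p q t; lra.
have [l lP] := cseries_cvg s0 s1 bd.
exists (l - - taylor z 0 x).
have E : (fun N => taylor z N x) = (fun N => \sum_(n < N) (taylor z n.+1 x - taylor z n x) - - taylor z 0 x).
  apply/funext; elim=> [|N IH]; first by rewrite big_ord0 opprK add0r.
  rewrite big_ord_recr /= opprK addrAC.
  by move: IH; rewrite opprK => <-; rewrite addrC subrK.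
by rewrite E; apply: (ccvgB lP); exact: ccvg_cst.
Qed.

Lemma taylor_lim_unique z x y (l m : C) : 0 < x -> x < y -> y <= 2^-1 -> disc z x -> disc z y ->
  (fun N => taylor z N x) @ \oo --> l -> (fun N => taylor z N y) @ \oo --> m -> l = m.
Proof.
move=> x0 xy y2 dx dy lx my.
have [K [s [s0 s1 H1 _]]] := taylor_estimate x0 xy y2 dx dy.
have c0 : (fun N => taylor z N y - taylor z N x) @ \oo --> (0 : C).
  apply: (@cvg_normc_squeeze _ _ _ (geometric K s)) => [N|].
    by rewrite subr0; apply: H1; rewrite lexx ltW.
  by apply: cvg_geometric; rewrite ger0_norm.
have := ccvg_unique (ccvgB my lx) c0.
by move/eqP; rewrite subr_eq0 => /eqP ->.
Qed.

(** By [taylor_lim_unique] the limit is the same for all admissible [x], so [get] selects the only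
    element as soon as some disc contains [z]. *)
Definition corner_fun (z : C) : C := get [set l | exists x : R,
  [/\ 0 < x, x <= 2^-1, disc z x & (fun N => taylor z N x) @ \oo --> l]].

Lemma corner_fun_cvg z x : 0 < x -> x <= 2^-1 -> disc z x ->
  (fun N => taylor z N x) @ \oo --> corner_fun z.
Proof.
move=> x0 x2 dx; have [l lP] := taylor_cvg x0 x2 dx.
suff -> : corner_fun z = l by [].
apply: get_unique; first by exists x; split.
move=> m [y [y0 y2 dy mP]].
have [xy|yx|xy] := ltgtP x y.
- by apply/esym; exact: (taylor_lim_unique x0 xy y2 dx dy lP mP).
- exact: (taylor_lim_unique y0 yx x2 dy dx mP lP).
- by rewrite -xy in mP; exact: (ccvg_unique mP lP).
Qed.

Lemma corner_pser x : 0 < x -> x <= 2^-1 ->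
  pser corner_fun (hdiag x) (Num.sqrt (x ^+ 2 / 2)) (fun n => u n x / n`!%:R).
Proof.
move=> x0 x2 w wr.
have dw : disc (hdiag x + w) x.
  rewrite /disc (_ : hdiag x + w - x%:C = w); last by rewrite addrC addrA [- _ + _]addrC subrr add0r.
  have x20 : 0 < x ^+ 2 / 2 by rewrite divr_gt0// exprn_gt0.
  have : normc w ^+ 2 < Num.sqrt (x ^+ 2 / 2) ^+ 2.
    by rewrite ltrXn2r ?nnegrE ?normc_ge0 ?sqrtr_ge0.
  by rewrite sqr_sqrtr ?ltW//; lra.
apply/ccvg_shiftS; rewrite (_ : (fun n => _) = (fun N => taylor (hdiag x + w) N x)).
  exact: corner_fun_cvg.
apply/funext => N; apply: eq_bigr => n _; rewrite /wq.
rewrite (_ : hdiag x + w - x%:C = w); last by rewrite addrC addrA [- _ + _]addrC subrr add0r.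
by rewrite mulrAC mulrA.
Qed.

End Corner.

Theorem corner_extension (u : nat -> R -> C) :
  (forall n y, 0 < y < 1 -> rdiff (u n) y (u n.+1 y)) ->
  good (nsq u) -> (cser (nsq u) < +oo)%E ->
  exists F0 : C -> C, forall x, 0 < x -> x <= 2^-1 ->
    pser F0 (hdiag x) (Num.sqrt (x ^+ 2 / 2)) (fun n => u n x / n`!%:R).
Proof.
move=> du gu fin.
have fn : cser (nsq u) \is a fin_num by rewrite ge0_fin_numE// cser_ge0.
have AE n x : I x -> cn R n * (`|x| ^+ (2 * n).+1 * normc (u n x) ^+ 2) =
    cn R n * (x ^+ (2 * n).+1 * nsq u n x).
  by rewrite /= in_itv/= => /andP[x0 _]; rewrite gtr0_norm.
exists (corner_fun u); apply: (@corner_pser u (fine (cser (nsq u))) du) => n.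
  apply: (@eq_measurable_fun _ _ _ _ _ (fun x : R => cn R n * (x ^+ (2 * n).+1 * nsq u n x))).
    by move=> x; rewrite inE => xI; rewrite AE.
  apply: measurable_funM; first exact: measurable_cst.
  by apply/measurable_EFinP; exact: measurable_cser_term.
rewrite fineK//.
have i0 k : (0 <= (cn R k)%:E * \int[mu]_(x in `]0%R, 2^-1%R[) (x ^+ (2 * k).+1 * nsq u k x)%:E)%E.
  apply: mule_ge0; first by rewrite lee_fin ltW// cn_gt0.
  by apply: integral_ge0 => x; exact: cser_term_ge0.
apply: (@le_trans _ _ ((cn R n)%:E * \int[mu]_(x in `]0%R, 2^-1%R[) (x ^+ (2 * n).+1 * nsq u n x)%:E)%E).
  have c0 : (0 <= (cn R n)%:E)%E by rewrite lee_fin ltW// cn_gt0.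
  have mt := measurable_cser_term n gu.
  have t0 x : I x -> (0 <= (x ^+ (2 * n).+1 * nsq u n x)%:E)%E by move=> xI; exact: cser_term_ge0.
  rewrite -ge0_integralZl// le_eqVlt; apply/orP; left; apply/eqP.
  by apply: eq_integral => x; rewrite inE => xI; rewrite AE// EFinM.
apply: (le_trans _ (nneseries_lim_ge n.+1 (fun k _ _ => i0 k))).
by rewrite big_nat_recr//= leeDr// sume_ge0.
Qed.

End Patching.

(** * Gluing the four corners *)

Section Gluing.
Variable R : realType.
Local Notation C := (R[i]^o).
Local Notation normc := (@Normc.normc R).
Local Notation mu := (@lebesgue_measure R).
Local Notation I := (`]0%R, 2^-1%R[%classic : set R).
Local Notation D := (@square R).
Local Notation qt := (@qt R).

Lemma smooth_rdiff (J : set R) (g : R -> C) n t : smooth_on J g -> J t ->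
  rdiff (derivRC n g) t (derivRC n.+1 g t).
Proof.
move=> sg /(sg n)[dR dI]; apply: ReIm_rdiff.
  by have := derivableP dR; rewrite -derive1E.
by have := derivableP dI; rewrite -derive1E.
Qed.

Lemma rdiff_affine (P : R -> C) (k s : R) y l : `|s| = 1 -> rdiff P (k + s * y) l ->
  rdiff (fun t => P (k + s * t)) y (s%:C * l).
Proof.
move=> s1 dP e e0; have [d d0 H] := dP e e0; exists d => // h hd.
have sh : `|s * h| = `|h| by rewrite normrM s1 mul1r.
have := H (s * h); rewrite sh => /(_ hd).
rewrite mulrDr addrA rmorphM /=; congr (normc (_ - _) <= _).
by rewrite mulrA [l * _]mulrC.
Qed.

Lemma rdiff_good (u : nat -> R -> C) :
  (forall n y, 0 < y < 1 -> rdiff (u n) y (u n.+1 y)) -> good (nsq u).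
Proof.
move=> du; split=> [n x|n]; first exact: sqr_ge0.
have y01 y : I y -> 0 < y < 1 by rewrite /= in_itv/= => /andP[h1 h2]; apply/andP; split; lra.
have oI : open I by exact: interval_open.
apply: (@eq_measurable_fun _ _ _ _ _ (fun x => complex.Re (u n x) ^+ 2 + complex.Im (u n x) ^+ 2)).
  by move=> x _; rewrite /nsq sqr_normc.
apply: measurable_funD; apply: measurable_funX; apply: open_continuous_measurable_fun => // y;
  rewrite inE => /y01 y1; have [dR dI] := rdiff_ReIm (du n y y1).
  exact: (is_derive_continuous dR).
exact: (is_derive_continuous dI).
Qed.

(** The chain rule along a line of direction [d]. On the vertical diagonal [d] is [i], and the
    factor [(- i)^n] of [S_diag] undoes [d ^+ n]. *)
Lemma derivRC_line (f : C -> C) (U : set C) (z d : C) n t : copen U -> holomorphic U f ->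
  U (z + d * t%:C) ->
  derivRC n (fun t => f (z + d * t%:C)) t = d ^+ n * derive1n n f (z + d * t%:C).
Proof.
move=> oU hf; pose G t := f (z + d * t%:C); rewrite -/G.
elim: n t => [|n IH] t Ut.
  by rewrite /derivRC /= mul1r -/(G t); case: (G t).
have [r r0 rU] := oU _ Ut.
have dl := rdiff_line (derivable_cdiff (holomorphic_derive1n (n := n) oU hf Ut)).
have dm := rdiffM (rdiff_cst (d ^+ n) t) dl.
have n1 : 0 < normc d + 1 by rewrite ltr_wpDl// normc_ge0.
have dG : rdiff (derivRC n G) t (d ^+ n.+1 * derive1n n.+1 f (z + d * t%:C)).
  rewrite [d ^+ n.+1]exprSr -mulrA derive1nS.
  move: dm; rewrite mul0r add0r; apply: (rdiff_near (r := r / (normc d + 1))).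
    by rewrite divr_gt0.
  move=> s sr; rewrite IH//.
  have -> : z + d * s%:C = z + d * t%:C + d * (s - t)%:C by rewrite rmorphB mulrBr -addrA; congr (_ + _); rewrite addrC subrK.
  apply: rU; rewrite normcM normc_real.
  apply: (@le_lt_trans _ _ ((normc d + 1) * `|s - t|)); first by rewrite ler_wpM2r// lerDl.
  by rewrite mulrC -ltr_pdivlMr.
have [[_ dR] [_ dI]] := rdiff_ReIm dG.
transitivity (complex.Re (d ^+ n.+1 * derive1n n.+1 f (z + d * t%:C)) +i*
              complex.Im (d ^+ n.+1 * derive1n n.+1 f (z + d * t%:C))); last by case: (_ * _).
by rewrite -dR -dI /derivRC !derive1nS !derive1E.
Qed.

(** * The region filled by the discs of one vertex, and how its four turns cover the square and
    overlap *)

Definition Omega (z : C) := exists x : R, [/\ 0 < x, x <= 2^-1 & disc z x].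

Lemma disc_hdiag x w : disc (hdiag x + w) x <-> 2 * normc w ^+ 2 < x ^+ 2.
Proof.
by rewrite /disc (_ : hdiag x + w - x%:C = w)// addrC addrA [- _ + _]addrC subrr add0r.
Qed.

Lemma OmegaE p q : Omega (p +i* q) <->
  exists x : R, [/\ 0 < x, x <= 2^-1 & 2 * ((p - x) ^+ 2 + q ^+ 2) < x ^+ 2].
Proof.
by split=> -[x [x0 x2 h]]; exists x; split => //; move: h; rewrite /disc sqr_normc /= subr0.
Qed.

Lemma Omega_square z : Omega z -> D z.
Proof.
move=> [x [x0 x2 dx]]; rewrite -[z](subrK (hdiag x)) addrC; exact: square_disc.
Qed.

(** As a function of [x], the margin [x^2 - 2 |z - x|^2] increases up to [x = 2 Re z]. When
    [Re z >= 1/4] membership therefore passes from [x] to [1/2], whose disc is the inscribed one. *)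
Lemma Omega_inscribed z : Omega z -> 4^-1 <= complex.Re z ->
  2 * normc (z - center R) ^+ 2 < 4^-1.
Proof.
case: z => p q /OmegaE[x [x0 x2 h]] /= p4; rewrite sqr_normc /= subr0.
have : 0 <= (2^-1 - x) * (4 * p - x - 2^-1) by rewrite mulr_ge0//; lra.
by move: h; rewrite !expr2; lra.
Qed.

Lemma inscribed_Omega z : 2 * normc (z - center R) ^+ 2 < 4^-1 -> Omega z.
Proof.
case: z => p q; rewrite sqr_normc /= subr0 => h; apply/OmegaE; exists 2^-1; split=> //.
by rewrite (_ : 2^-1 ^+ 2 = 4^-1 :> R)//; field.
Qed.

Lemma Omega_D0 (a b : R) : a <= 2^-1 -> `|b| <= 4^-1 -> `|a - 2^-1| + `|b| < 2^-1 -> Omega (a +i* b).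
Proof.
move=> a2 b4; rewrite ler0_norm ?subr_le0// => ab; apply/OmegaE.
have b2 : b ^+ 2 = `|b| ^+ 2 by rewrite real_normK// num_real.
have b0 := normr_ge0 b; rewrite b2; move: (`|b|) b0 b4 ab => c c0 c4 ac.
have [a4|a4] := leP a 4^-1.
  (* The center [2 * a] maximizes the margin; when it exceeds [1/2] the last center [1/2] is taken
     instead. *)
  exists (2 * a); split; [lra|lra|].
  have : c ^+ 2 < a ^+ 2 by rewrite ltrXn2r ?nnegrE//; lra.
  by rewrite !expr2; lra.
exists 2^-1; split=> //.
have : c ^+ 2 <= 4^-1 ^+ 2 by rewrite lerXn2r ?nnegrE//; lra.
have : (2^-1 - a) ^+ 2 < 4^-1 ^+ 2 by rewrite ltrXn2r ?nnegrE//; lra.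
by rewrite !expr2; lra.
Qed.

Lemma Omega_cover z : D z -> exists j z', [/\ (j < 4)%N, Omega z' & iter j qt z' = z].
Proof.
case: z => a b zD.
have at_ m j : (j < 4)%N -> (j + m = 4 \/ j + m = 0)%N ->
    complex.Re (iter m qt (a +i* b)) <= 2^-1 -> `|complex.Im (iter m qt (a +i* b))| <= 4^-1 ->
    exists j z', [/\ (j < 4)%N, Omega z' & iter j qt z' = (a +i* b)].
  move=> j4 jm h1 h2; exists j, (iter m qt (a +i* b)); split => //.
    have : D (iter m qt (a +i* b)) by apply/square_iter_qt.
    by case: (iter m qt _) h1 h2 => a' b' h1 h2; exact: Omega_D0.
  by rewrite -iterD; case: jm => ->//=; rewrite qt4.
have c0 := at_ 0%N 0%N isT (or_intror erefl); have c1 := at_ 1%N 3%N isT (or_introl erefl).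
have c2 := at_ 2%N 2%N isT (or_introl erefl); have c3 := at_ 3%N 1%N isT (or_introl erefl).
rewrite /= in c0 c1 c2 c3; move: zD; rewrite /square /=; clear at_.
have [h1|h1] := ger0P (a - 2^-1); have [h2|h2] := ger0P b => abD.
- have [b4|b4] := lerP b 4^-1; first by apply: c2; [lra|rewrite ler_norml; lra].
  by apply: c1; [lra|rewrite ler_norml; lra].
- have [b4|b4] := lerP (- b) 4^-1; first by apply: c2; [lra|rewrite ler_norml; lra].
  by apply: c3; [lra|rewrite ler_norml; lra].
- have [b4|b4] := lerP b 4^-1; first by apply: c0; [lra|rewrite ler_norml; lra].
  by apply: c1; [lra|rewrite ler_norml; lra].
- have [b4|b4] := lerP (- b) 4^-1; first by apply: c0; [lra|rewrite ler_norml; lra].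
  by apply: c3; [lra|rewrite ler_norml; lra].
Qed.

Lemma iter_qt_center j w : iter j qt (center R + w) = center R + cI R ^+ j * w.
Proof.
elim: j => [|j IH]; first by rewrite mul1r.
rewrite /= IH qtD [_ ^+ j.+1]exprS mulrA; congr (_ + _).
by apply/eqP; rewrite eq_complex /=; apply/andP; split; apply/eqP; ring.
Qed.

Lemma normc_iter_qt j z : normc (iter j qt z - center R) = normc (z - center R).
Proof.
rewrite -{1}[z](subrK (center R)) addrC [_ - _ + _]addrC iter_qt_center addrA [- _ + _]addrC subrr add0r.
by rewrite normcM normcX normc_cI expr1n mul1r.
Qed.

Lemma iter_qtK j z : (j < 4)%N -> iter (4 - j) qt (iter j qt z) = z /\ iter j qt (iter (4 - j) qt z) = z.
Proof.
move=> j4.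
have e1 : (4 - j + j = 4)%N by rewrite subnK// ltnW.
have e2 : (j + (4 - j) = 4)%N by rewrite subnKC// ltnW.
by split; rewrite -iterD ?e1 ?e2; exact: qt4.
Qed.

(** Otherwise, by [Omega_inscribed], both points have real part below [1/4]. The part of the square
    with [Re < 1/4] satisfies [|Im| < 1/4], so it is disjoint from its other three turns. *)
Lemma Omega_overlap j k z z' : (j < 4)%N -> (k < 4)%N -> j != k -> Omega z -> Omega z' ->
  iter j qt z = iter k qt z' -> 2 * normc (z - center R) ^+ 2 < 4^-1.
Proof.
move=> j4 k4 jk oz oz' E.
have [/(Omega_inscribed oz)//|z4] := leP 4^-1 (complex.Re z).
have [/(Omega_inscribed oz')|z4'] := leP 4^-1 (complex.Re z').
  by rewrite -(normc_iter_qt k) -E normc_iter_qt.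
exfalso; move: (Omega_square oz) (Omega_square oz'); clear oz oz'.
case: z z' E z4 z4' => p q [p' q'] E /= z4 z4'; rewrite /square /=.
rewrite (ltr0_norm (_ : p - 2^-1 < 0)); last by lra.
rewrite (ltr0_norm (_ : p' - 2^-1 < 0)); last by lra.
move=> h h'; have q1 := ler_norm q; have q2 := ler_norm (- q); rewrite normrN in q2.
have q1' := ler_norm q'; have q2' := ler_norm (- q'); rewrite normrN in q2'.
move: (`|q|) (`|q'|) h h' q1 q2 q1' q2' => Q Q' h h' q1 q2 q1' q2'.
move: (congr1 (@complex.Re R) E) (congr1 (@complex.Im R) E) jk; clear E.
by case: j j4 => [|[|[|[|//]]]] _; case: k k4 => [|[|[|[|//]]]] _ //=; lra.
Qed.

(** * Construction of the extension from the derivatives along the diagonals *)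

Section Extension.
Variables (f : C -> C) (U : set C).
Hypotheses (sf : smooth_diagonals f) (oU : copen U) (cU : U (center R)) (hU : holomorphic U f).
Hypothesis fin : (S_diag f < +oo)%E.

Let h n x := derivRC n (f \o @hdiag R) x.
Let v n y := derivRC n (f \o @vdiag R) y.

(* [uu j n x] is the derivative of order [n] of [f \o iter j qt] at [hdiag x] along the
   diagonal; the affine arguments are in the shape of [rdiff_affine]. *)
Let uu (j n : nat) (x : R) : C :=
  match j with
  | 0 => h n x
  | 1 => v n (- 2^-1 + 1 * x)
  | 2 => (- 1) ^+ n * h n (1 + -1 * x)
  | _ => (- 1) ^+ n * v n (2^-1 + -1 * x)
  end.

Let uu_rdiff j n y : 0 < y < 1 -> rdiff (uu j n) y (uu j n.+1 y).
Proof.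
move=> /andP[y0 y1]; have [sh sv] := sf.
have hr t : 0 < t < 1 -> rdiff (h n) t (h n.+1 t).
  by move=> t01; apply: (@smooth_rdiff _ _ n t sh); rewrite /= in_itv.
have vr t : - 2^-1 < t < 2^-1 -> rdiff (v n) t (v n.+1 t).
  by move=> t01; apply: (@smooth_rdiff _ _ n t sv); rewrite /= in_itv.
have sgn (P : R -> C) k l : rdiff P (k + -1 * y) l ->
    rdiff (fun t => (- 1) ^+ n * P (k + -1 * t)) y ((- 1) ^+ n.+1 * l).
  move=> dP; have N1 : `|-1 : R| = 1 by rewrite normrN1.
  have := rdiffM (rdiff_cst ((- 1) ^+ n) y) (rdiff_affine N1 dP).
  congr (rdiff _ _ _); rewrite mul0r add0r [(- 1) ^+ n.+1]exprSr -mulrA.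
  by rewrite rmorphN rmorph1.
case: j => [|[|[|j]]] /=.
- by apply: hr; rewrite y0.
- have hy : - 2^-1 < - 2^-1 + 1 * y < 2^-1 by apply/andP; split; lra.
  have := rdiff_affine (normr1 _) (vr _ hy).
  by congr (rdiff _ _ _); exact: mul1r.
- by apply: sgn; apply: hr; apply/andP; split; lra.
- by apply: sgn; apply: vr; apply/andP; split; lra.
Qed.

Let uu_good j : good (nsq (uu j)).
Proof. by apply: rdiff_good => n y; exact: uu_rdiff. Qed.

Let S_diagE : S_diag f = (\sum_(j < 4) cser (nsq (uu j)))%E.
Proof.
have n1 n : normc ((- 1) ^+ n) = 1 by rewrite normcX normcN (normc_nat R 1) expr1n.
have ni n : normc ((0 +i* (- 1)) ^+ n) = 1.
  have -> : 0 +i* (- 1) = - cI R by apply/eqP; rewrite eq_complex /= oppr0 !eqxx.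
  by rewrite normcX normcN normc_cI expr1n.
pose v' n y := (0 +i* (- 1)) ^+ n * v n y.
have E1 : nsq (fun n x => v' n (x - 2^-1)) = nsq (uu 1).
  apply/funext => n; apply/funext => x.
  by rewrite /nsq /v' /= normcM ni !mul1r [_ + x]addrC.
have E2 : nsq (fun n x => h n (1 - x)) = nsq (uu 2).
  by apply/funext => n; apply/funext => x; rewrite /nsq /= normcM n1 mul1r mulN1r.
have E3 : nsq (fun n x => v' n (2^-1 - x)) = nsq (uu 3).
  by apply/funext => n; apply/funext => x; rewrite /nsq /v' /= !normcM n1 ni !mul1r mulN1r.
have := @diag_sum_cser R h v'; rewrite /= E1 E2 E3.
move=> /(_ (uu_good 0) (uu_good 2) (uu_good 3) (uu_good 1)) E.
transitivity (cser (nsq (uu 0)) + cser (nsq (uu 2)) + cser (nsq (uu 3)) + cser (nsq (uu 1)))%E.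
  exact: E.
rewrite (sum_ord4 (fun j => cser (nsq (uu j)))).
move: (cser (nsq (uu 0))) (cser (nsq (uu 1))) (cser (nsq (uu 2))) (cser (nsq (uu 3))) => a b c d.
by rewrite (addeAC a b c) (addeAC (a + c)%E b d).
Qed.

(** Holomorphy near the center makes the four sequences of derivatives there turns of a single one;
    this is what forces the corner functions to agree on the inscribed disc. *)
Let uu_center j n : (j < 4)%N -> uu j n 2^-1 = (cI R ^+ j) ^+ n * derive1n n f (center R).
Proof.
have hE : f \o @hdiag R = (fun t => f (0 + 1 * t%:C)).
  by apply/funext => t; rewrite mul1r add0r.
have vE : f \o @vdiag R = (fun t => f (center R + cI R * t%:C)).
  apply/funext => t /=; congr f; apply/eqP; rewrite eq_complex /=.
  by apply/andP; split; apply/eqP; ring.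
have c0 : 0 + 1 * (2^-1 : R)%:C = center R :> C by rewrite mul1r add0r.
have c1 : center R + cI R * (0 : R)%:C = center R :> C by rewrite mulr0 addr0.
have h0 : h n 2^-1 = derive1n n f (center R).
  by rewrite /h hE (derivRC_line _ oU hU) c0// expr1n mul1r.
have v0 : v n 0 = cI R ^+ n * derive1n n f (center R).
  by rewrite /v vE (derivRC_line _ oU hU) c1.
have half : 1 + -1 * 2^-1 = 2^-1 :> R by field.
have I2 : cI R ^+ 2 = -1.
  by apply/eqP; rewrite eq_complex /=; apply/andP; split; apply/eqP; ring.
case: j => [|[|[|[|//]]]] _ /=.
- by rewrite expr0 expr1n mul1r.
- by rewrite mul1r addNr v0 expr1.
- have E2 : h n (1 + -1 * 2^-1) = derive1n n f (center R) by rewrite half.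
  exact: (congr2 (fun p q : C => p ^+ n * q) (esym I2) E2).
- have c3 : cI R ^+ 3 = - cI R.
    by apply/eqP; rewrite eq_complex /=; apply/andP; split; apply/eqP; ring.
  have z0 : 2^-1 + -1 * 2^-1 = 0 :> R by rewrite mulN1r subrr.
  have E3 : v n (2^-1 + -1 * 2^-1) = cI R ^+ n * derive1n n f (center R) by rewrite z0.
  have E4 : (cI R ^+ 3) ^+ n = (- 1) ^+ n * cI R ^+ n by rewrite c3; exact: exprNn.
  rewrite E4 -mulrA; exact: (congr1 (fun q : C => (- 1) ^+ n * q) E3).
Qed.

Let fin_uu j : (j < 4)%N -> (cser (nsq (uu j)) < +oo)%E.
Proof.
move=> j4; apply: le_lt_trans fin; rewrite S_diagE (bigD1 (Ordinal j4))//= leeDl//.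
by apply: sume_ge0 => i _; exact: cser_ge0.
Qed.

Lemma extension_corner : exists F : C -> C,
  (forall j x, (j < 4)%N -> 0 < x -> x <= 2^-1 ->
    pser (F \o iter j qt) (hdiag x) (Num.sqrt (x ^+ 2 / 2)) (fun n => uu j n x / n`!%:R)) /\
  (forall w, 2 * normc w ^+ 2 < 4^-1 ->
    psum (fun n => derive1n n f (center R) / n`!%:R) w @ \oo --> F (center R + w)).
Proof.
(* The condition [j < 4] is placed inside the existential so that [choice] applies; the zero
   function fills the other indices. *)
have ex j : exists F0 : C -> C, (j < 4)%N -> forall x, 0 < x -> x <= 2^-1 ->
    pser F0 (hdiag x) (Num.sqrt (x ^+ 2 / 2)) (fun n => uu j n x / n`!%:R).
  have [j4|_] := boolP (j < 4)%N; last by exists (fun=> 0).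
  have [F0 F0P] := corner_extension (@uu_rdiff j) (uu_good j) (fin_uu j4).
  by exists F0.
have [Fs FsP] := choice ex.
have rad (x : R) w : 0 < x -> 2 * normc w ^+ 2 < x ^+ 2 <-> normc w < Num.sqrt (x ^+ 2 / 2).
  move=> x0; have x20 : 0 <= x ^+ 2 / 2 by rewrite divr_ge0 ?sqr_ge0.
  split=> hw.
    rewrite -(@ltr_pXn2r _ 2) ?nnegrE ?normc_ge0 ?sqrtr_ge0// sqr_sqrtr//; lra.
  have : normc w ^+ 2 < Num.sqrt (x ^+ 2 / 2) ^+ 2.
    by rewrite ltrXn2r ?nnegrE ?normc_ge0 ?sqrtr_ge0.
  by rewrite sqr_sqrtr//; lra.
have x2 : 0 < 2^-1 :> R by [].
have q4 : 2^-1 ^+ 2 = 4^-1 :> R by field.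
have inner j w : (j < 4)%N -> 2 * normc w ^+ 2 < 4^-1 ->
    psum (fun n => derive1n n f (center R) / n`!%:R) (cI R ^+ j * w) @ \oo --> Fs j (center R + w).
  move=> j4 hw; have wr : normc w < Num.sqrt (2^-1 ^+ 2 / 2) by apply/rad; rewrite ?q4.
  have := FsP j j4 2^-1 x2 (lexx _) w wr.
  rewrite (_ : psum _ w = psum (fun n => derive1n n f (center R) / n`!%:R) (cI R ^+ j * w))//.
  apply/funext => N; apply: eq_bigr => n _.
  have pm : (cI R ^+ j * w) ^+ n = (cI R ^+ j) ^+ n * w ^+ n.
    by apply: exprMn_comm; exact: mulrC.
  rewrite pm uu_center//.
  move: ((cI R ^+ j) ^+ n) (derive1n n f (center R)) (n`!%:R^-1 : C) (w ^+ n) => p q r t; ring.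
have inner_eq j z : (j < 4)%N -> 2 * normc (z - center R) ^+ 2 < 4^-1 -> Fs j z = Fs 0 (iter j qt z).
  move=> j4 hz; have E : z = center R + (z - center R) by rewrite addrC subrK.
  rewrite E iter_qt_center; apply: ccvg_unique (inner j _ j4 hz) _.
  have := inner 0%N (cI R ^+ j * (z - center R)) isT.
  by rewrite mul1r; apply; rewrite normcM normcX normc_cI expr1n mul1r.
(* The value does not depend on the representation of [z]: with the same [j] the turn is injective,
   and with different ones [Omega_overlap] brings the points into the inscribed disc, where
   [inner_eq] compares both values with the corner 0. *)
pose F z : C := get [set t | exists j z', [/\ (j < 4)%N, Omega z', iter j qt z' = z & t = Fs j z']].
have FE j z : (j < 4)%N -> Omega z -> F (iter j qt z) = Fs j z.
  move=> j4 oz; apply: get_unique; first by exists j, z; split.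
  move=> _ [k [z' [k4 oz' E ->]]].
  have [jk|jk] := eqVneq j k.
    rewrite -jk in E *; congr (Fs j _).
    by rewrite -[z'](proj1 (iter_qtK _ j4)) E (proj1 (iter_qtK _ j4)).
  have iz := Omega_overlap j4 k4 jk oz oz' (esym E).
  have iz' : 2 * normc (z' - center R) ^+ 2 < 4^-1 by rewrite -(normc_iter_qt k) E normc_iter_qt.
  by rewrite (inner_eq j)// (inner_eq k)// E.
exists F; split=> [j x j4 x0 xle w wr|w hw].
  have := FsP j j4 x x0 xle w wr; rewrite -(FE j)//.
  by exists x; split=> //; apply/disc_hdiag; apply/rad.
have -> : F (center R + w) = Fs 0 (center R + w).
  by apply: (FE 0%N) => //; apply: inscribed_Omega; rewrite addrAC subrr add0r.
by have := inner 0%N w isT hw; rewrite mul1r.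
Qed.

Theorem extension_exists : exists F : C -> C, [/\ holomorphic D F,
  (forall z, diagonals z -> F z = f z), (\forall z \near center R, F z = f z) &
  S_hol F = S_diag f].
Proof.
have [F [FP Fc]] := extension_corner; exists F.
have r0 (x : R) : 0 < x -> 0 < Num.sqrt (x ^+ 2 / 2).
  by move=> x0; rewrite sqrtr_gt0 divr_gt0// exprn_gt0.
have Fh j x : (j < 4)%N -> 0 < x -> x <= 2^-1 -> F (iter j qt (hdiag x)) = uu j 0 x.
  move=> j4 x0 x2; have := pser0 (r0 x x0) (FP j x j4 x0 x2).
  by rewrite /= fact0 divr1.
have hF : holomorphic D F.
  move=> z /Omega_cover[j [z' [j4 [x [x0 x2 dx]] <-]]].
  have zE : z' = hdiag x + (z' - hdiag x) by rewrite addrC subrK.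
  have wr : normc (z' - hdiag x) < Num.sqrt (x ^+ 2 / 2).
    rewrite -(@ltr_pXn2r _ 2) ?nnegrE ?normc_ge0 ?sqrtr_ge0//.
    by rewrite sqr_sqrtr ?divr_ge0 ?sqr_ge0//; move: dx; rewrite /disc; lra.
  have dF := pser_derivable (FP j x j4 x0 x2) wr; rewrite -zE in dF.
  have [K1 _] := iter_qtK z' j4.
  have cq k (w : C) : exists m, cdiff (iter k qt) w m.
    elim: k => [|k [m hm]]; first by exists 1; exact: cdiff_id.
    by exists (cI R * m); exact: (cdiff_comp hm (cdiff_qt _)).
  (* [F] is recovered as the composite of [F \o iter j qt], differentiable at [z'] by its power
     series, with the inverse turn. *)
  have [m hm] := cq (4 - j)%N (iter j qt z').
  have dF' : cdiff (F \o iter j qt) (iter (4 - j) qt (iter j qt z')) (derive1 (F \o iter j qt) z').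
    by rewrite K1; exact: derivable_cdiff.
  have := cdiff_comp hm dF'.
  rewrite (_ : (F \o iter j qt) \o iter (4 - j) qt = F); first exact: cdiff_derivable.
  by apply/funext => w /=; congr F; have [_ ->] := iter_qtK w j4.
split; [exact: hF| | |].
- have half x : uu 1 0 x = f (vdiag (x - 2^-1)) by rewrite /uu /v /derivRC /= mul1r addrC; case: (f _).
  have half3 x : uu 3 0 x = f (vdiag (2^-1 - x)).
    by rewrite /uu /v /derivRC /= mul1r mulN1r; case: (f _).
  have h0 x : uu 0 0 x = f (hdiag x) by rewrite /uu /h /derivRC /=; case: (f _).
  have h2 x : uu 2 0 x = f (hdiag (1 - x)).
    by rewrite /uu /h /derivRC /= mul1r mulN1r; case: (f _).
  move=> z [[x + <-]|[y + <-]]; rewrite /= in_itv/= => /andP[l1 l2].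
    have [xl|xl] := leP x 2^-1; first by rewrite -h0 -(Fh 0%N).
    have x1 : 0 < 1 - x by lra.
    have xx : 1 - x <= 2^-1 by lra.
    have := Fh 2%N _ isT x1 xx; have [_ -> _] := qt_hdiag (1 - x).
    by rewrite h2 opprB addrCA subrr addr0.
  have [yl|yl] := leP y 0.
    have x1 : 0 < y + 2^-1 by lra.
    have xx : y + 2^-1 <= 2^-1 by lra.
    have := Fh 1%N _ isT x1 xx; have [-> _ _] := qt_hdiag (y + 2^-1).
    by rewrite half addrK.
  have x1 : 0 < 2^-1 - y by lra.
  have xx : 2^-1 - y <= 2^-1 by lra.
  have := Fh 3%N _ isT x1 xx; have [_ _ ->] := qt_hdiag (2^-1 - y).
  by rewrite half3 opprB addrCA subrr addr0.
- have [r rp rU] := oU cU.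
  have ser : pser f (center R) r (fun n => derive1n n f (center R) / n`!%:R).
    by apply: taylor_series => // w wr; apply: hU; exact: rU.
  apply/nbhs_normcP; exists (Num.min r 4^-1) => [|z]; first by rewrite lt_min; apply/andP; split; [exact: rp|lra].
  rewrite lt_min => /andP[zr z4].
  have zE : z = center R + (z - center R) by rewrite addrC subrK.
  rewrite zE; apply: ccvg_unique (Fc _ _) (ser _ zr).
  have : normc (z - center R) ^+ 2 < 4^-1 ^+ 2 by rewrite ltrXn2r ?nnegrE ?normc_ge0.
  by rewrite [4^-1 ^+ 2]expr2; lra.
- rewrite (S_hol_corner hF) S_diagE; apply: eq_bigr => -[j j4] _ /=.
  apply: (@eq_cser _ (nsq (fun n x => derive1n n (F \o iter j qt) (hdiag x)))) => n x.
  rewrite /= in_itv/= => /andP[x0 x2].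
  (* The power series at [hdiag x] determines the derivatives of the turned extension there: they
     are the prescribed [uu j n x], so the two sums agree term by term. *)
  rewrite /nsq (pser_coef n (r0 x x0) (FP j x j4 x0 (ltW x2))).
  by rewrite mulrC divfK// factr_neq0.
Qed.

End Extension.
End Gluing.

Theorem theorem4p1 (R : realType) :
  exists c C : R, [/\ 0 < c, c <= C,
    (forall f : R[i]^o -> R[i]^o, bergman (@square R) f ->
      (c%:E * S_hol f <= sqnormL2 (@square R) f)%E /\
      (sqnormL2 (@square R) f <= C%:E * S_hol f)%E) &
    (forall f : R[i]^o -> R[i]^o,
      smooth_diagonals f ->
      (exists U : set R[i]^o, open_nbhs (center R) U /\ holomorphic U f) ->
      (S_diag f < +oo)%E ->
      exists F : R[i]^o -> R[i]^o,
        [/\ bergman (@square R) F,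
            (forall z, diagonals z -> F z = f z),
            (\forall z \near center R, F z = f z),
            (c%:E * S_diag f <= sqnormL2 (@square R) F)%E &
            (sqnormL2 (@square R) F <= C%:E * S_diag f)%E])].
Proof.
have k0 := kappa_gt0 R.
exists (kappa R / 24), (6 * kappa R); split; [by rewrite divr_gt0|by lra| |].
  by move=> f [hf _]; exact: sqnormL2_S_hol.
move=> f sf [U [[oU cU] hU]] fin.
have cpU : copen U.
  move=> z Uz; have /nbhs_normcP[d d0 dU] : nbhs z U by exact: open_nbhs_nbhs.
  by exists d => // w wd; apply: dU; rewrite addrC addKr.
have [F [hF Fd Fn SF]] := extension_exists sf cpU cU hU fin.
have [lo up] := sqnormL2_S_hol hF; rewrite SF in lo up.
exists F; split; [split; [exact: hF|]|exact: Fd|exact: Fn|exact: lo|exact: up].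
by apply: le_lt_trans up _; rewrite lte_mul_pinfty// lee_fin; lra.
Qed.
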